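(* There exist real numbers $A<0$, $C<3|A|$ and $T>0$ such that the linearized operator $$\mathcal{L}(\mathbf{v},q)=-\Delta\mathbf{v}+(\mathbf{v}\cdot\nabla)\mathbf{u}_*+(\mathbf{u}_*\cdot\nabla)\mathbf{v}+\nabla q$$ at the Couette--Poiseuille flow $\mathbf{u}_*(x,y)=\mathcal{F}(y)\mathbf{e}_1$, $\mathcal{F}(y)=3Ay^2+C$, in the periodic channel $x\in[0,2\pi/T]/\!\sim$, $y\in[-1,1]$, with the corresponding boundary conditions, is not injective; that is, there exists a pair $(\mathbf{v},q)$ with $\mathbf{v}\not\equiv\mathbf{0}$ in the domain of $\mathcal{L}$ (described in the context) such that $\mathcal{L}(\mathbf{v},q)=\mathbf{0}$.
   Context: $\mathbf{e}_1=(1,0)$, $S=\mathbb{R}\times(-1,1)$; vector fields are real and two-dimensional. In $[0,2\pi/T]/\!\sim$ the endpoints $0$ and $2\pi/T$ are identified. The operator $\mathcal{L}$ in the periodic channel acts on pairs $(\mathbf{v},q)$ where: $\mathbf{v}\in H^2_{\mathrm{loc}}(\mathbb{R}\times[-1,1])$ is a vector field that is $2\pi/T$-periodic in $x$, with $\nabla\cdot\mathbf{v}=0$ in $S$, $\mathbf{v}=\mathbf{0}$ for $y=\pm1$, and $\int_{-1}^1\mathbf{v}(0,y)\cdot\mathbf{e}_1\,dy=0$; and $q\in H^1_{\mathrm{loc}}(\mathbb{R}\times[-1,1])$, considered modulo additive constants, has $\nabla q$ which is $2\pi/T$-periodic in $x$. (Here $H^k_{\mathrm{loc}}(\mathbb{R}\times[-1,1])$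 means $H^k$ on every bounded slice $(a,b)\times(-1,1)$.) *)

(* Defs.v *)
From mathcomp Require Export all_boot all_order all_algebra.
From mathcomp Require Export all_classical all_reals all_analysis.
From mathcomp Require Export Rstruct Rstruct_topology.

Set Implicit Arguments.
Unset Strict Implicit.
Unset Printing Implicit Defensive.

Import Order.TTheory GRing.Theory Num.Theory.
Import numFieldNormedType.Exports.

Local Open Scope classical_set_scope.
Local Open Scope ring_scope.

Section Sobolev.
Variable R : realType.
Implicit Types (U : set (R * R)) (f g phi : R * R -> R) (v w : R * R -> R * R).

Definition e_x : R * R := (1, 0).
Definition e_y : R * R := (0, 1).

(* [measurableTypeR R] is [R] with the Borel sigma-algebra that carries
   [lebesgue_measure]. *)
Definition leb2 : {measure set (measurableTypeR R * measurableTypeR R) -> \bar R} :=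
  (@lebesgue_measure R \x @lebesgue_measure R)%E.

Fixpoint Ck (k : nat) phi : Prop :=
  continuous phi /\
  if k is k'.+1 then
    [/\ forall p, derivable phi p e_x, forall p, derivable phi p e_y,
        Ck k' ('D_e_x phi) & Ck k' ('D_e_y phi)]
  else True.

Definition test_function U phi : Prop :=
  (forall k, Ck k phi) /\
  exists K : set (R * R),
    [/\ compact K, K `<=` U & forall p, ~ K p -> phi p = 0].

Definition loc_integrable U f : Prop :=
  forall K : set (R * R), compact K -> K `<=` U ->
    leb2.-integrable K (EFin \o f).

Definition partial (m n : nat) phi : R * R -> R :=
  iter m (fun psi => 'D_e_x psi) (iter n (fun psi => 'D_e_y psi) phi).

(* [g] is the distributional derivative d_x^m d_y^n f on [U].  Local
   integrability makes both integrands integrable, so that no integral takes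
   the conventional value of a divergent [Rintegral]. *)
Definition weak_deriv U (m n : nat) f g : Prop :=
  [/\ loc_integrable U f, loc_integrable U g &
      forall phi, test_function U phi ->
        \int[leb2]_(p in U) (f p * partial m n phi p) =
        (-1) ^+ (m + n) * \int[leb2]_(p in U) (g p * phi p)].

Definition weak_deriv_vec U (m n : nat) v w : Prop :=
  weak_deriv U m n (fst \o v) (fst \o w) /\
  weak_deriv U m n (snd \o v) (snd \o w).

Definition weak_gradient U f w : Prop :=
  weak_deriv U 1 0 f (fst \o w) /\ weak_deriv U 0 1 f (snd \o w).

Definition L2 U f : Prop :=
  measurable_fun (U : set (measurableTypeR R * measurableTypeR R)) f /\
  leb2.-integrable U (fun p => (f p ^+ 2)%:E).

Definition Hk (k : nat) U f : Prop :=
  L2 U f /\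
  forall m n, (m + n <= k)%N -> exists g, L2 U g /\ weak_deriv U m n f g.

Definition strip : set (R * R) := [set p | -1 < p.2 < 1].

Definition closed_strip : set (R * R) := [set p | -1 <= p.2 <= 1].

Definition slice (a b : R) : set (R * R) :=
  [set p | a < p.1 < b /\ -1 < p.2 < 1].

(* H^k_loc(R x [-1,1]): the slices reach the walls y = -1 and y = 1. *)
Definition Hk_loc (k : nat) f : Prop := forall a b : R, Hk k (slice a b) f.

Definition divergence_free U v : Prop :=
  exists gx gy : R * R -> R,
    [/\ weak_deriv U 1 0 (fst \o v) gx, weak_deriv U 0 1 (snd \o v) gy &
        {ae leb2, forall p, U p -> gx p + gy p = 0}].

End Sobolev.

Section LinearizedOperator.
Variable R : realType.
Implicit Types (u v f : R * R -> R * R) (q : R * R -> R).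

(* An H^2_loc field is given by its representative that is continuous up to
   the walls (Sobolev embedding in dimension 2), so that periodicity, boundary
   values and flux are pointwise conditions.  The pressure [q] is a
   representative modulo constants and enters only through its gradient. *)
Definition channel_domain (T : R) v q : Prop :=
  [/\ [/\ Hk_loc 2 (fst \o v), Hk_loc 2 (snd \o v) &
          {within @closed_strip R, continuous v}],
      [/\ forall x y : R, -1 <= y <= 1 -> v (x + 2 * pi / T, y) = v (x, y),
          divergence_free (@strip R) v,
          forall x : R, v (x, 1) = 0 /\ v (x, -1) = 0 &
          \int[@lebesgue_measure R]_(y in `[-1, 1]) (v (0, y)).1 = 0],
      Hk_loc 1 q &
      exists gq : R * R -> R * R, weak_gradient (@strip R) q gq /\
        {ae @leb2 R, forall p, strip p ->
           gq (p.1 + 2 * pi / T, p.2) = gq p}].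

(* [linearized_operator u v q f] : f = - Laplacian v + (v . grad) u
   + (u . grad) v + grad q almost everywhere in the strip, the derivatives of
   [v] and [q] being weak ones and the base flow [u] being smooth. *)
Definition linearized_operator u v q f : Prop :=
  exists vx vy vxx vyy gq : R * R -> R * R,
    [/\ weak_deriv_vec (@strip R) 1 0 v vx /\
          weak_deriv_vec (@strip R) 0 1 v vy,
        weak_deriv_vec (@strip R) 2 0 v vxx /\
          weak_deriv_vec (@strip R) 0 2 v vyy,
        weak_gradient (@strip R) q gq &
        {ae @leb2 R, forall p, strip p ->
           f p = - (vxx p + vyy p)
                 + ((v p).1 *: 'D_(e_x R) u p + (v p).2 *: 'D_(e_y R) u p)
                 + ((u p).1 *: vx p + (u p).2 *: vy p)
                 + gq p}].

Definition couette_poiseuille (A C : R) : R * R -> R * R :=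
  fun p => (3 * A * p.2 ^+ 2 + C) *: e_x R.

End LinearizedOperator.

(* Main.v *)
From HB Require Import structures.
Require Import Defs.
From mathcomp Require Import measurable_realfun complex.
From Stdlib Require Import ZArith RIneq.
From mathcomp Require Import ring lra zify.

(** The flow that witnesses non-injectivity is a neutral Tollmien-Schlichting
    wave of plane Poiseuille flow, seen in the frame that travels with it.

    Take T = 1 and look for v = (d psi / dy, - d psi / dx) with stream function
    psi = Re (phi(y) e^{ix}).  With F(y) = b y^2 + g, b = 3A, g = C and
    w = phi'' - phi, eliminating the pressure turns L(v, q) = 0 into the
    Orr-Sommerfeld equation w'' - w = i (F w - 2 b phi), and the pressure is
    recovered as q = Re (qhat e^{ix}) with qhat = - i w' - F phi' + F' phi.  The
    boundary values and the zero flux reduce to phi(1) = phi'(1) = 0 once phi is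
    even.  In the classical scaling -b is the Reynolds number, and the real phase
    speed of a neutral wave is absorbed in C by the change of frame.  For wave
    number 1 the neutral curve is met near b = -5814.83, and there
    g = 4295.81 < -b, which is C < 3|A|.

    Even solutions are power series in y^2, normalized by phi(0) = 1, so that
    they are determined by z = (b, g, Re mu, Im mu) with mu = w(0).  The real
    vector [wall_map z] = (phi(1), phi'(1)) in R^4 has to vanish, and its zero is
    found by a Newton map with a constant approximate inverse of the Jacobian
    ([approx_newton]).  The estimates that this needs all come from one weighted
    bound for the recurrence of the coefficients ([os_mode_bound]), in which
    source terms are allowed: rounding errors, truncation and a shift of the
    parameters are source terms, and so is the remainder of the first-order
    expansion of the solution ([wall_expansion]).  The weighted bound
    ignores all cancellation and overestimates by a factor up to 2^160.  This is
    affordable because the approximate zero is given to 210 binary places, its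
    residual is evaluated with 400 places and the Jacobian with 210, in integers
    ([chi_check], [tan_check]).  Hence [neutral_parameters].

    The series is entire and even in y, so it can be differentiated termwise,
    and its real and imaginary parts solve a real system of ordinary differential
    equations ([os_mode_system], [neutral_mode]).  A continuous function with
    continuous classical derivatives has them as distributional derivatives,
    by Fubini's theorem and the fundamental theorem of calculus on lines
    ([weak_deriv_step_x], [weak_deriv_step_y]).  The equation L(v, q) = 0 then
    becomes a pointwise identity of trigonometric modes ([flow_linearized]). *)

Import Order.TTheory GRing.Theory Num.Theory.
Import numFieldNormedType.Exports.
Set Implicit Arguments.
Unset Strict Implicit.
Unset Printing Implicit Defensive.
Local Open Scope classical_set_scope.
Local Open Scope ring_scope.
Local Open Scope complex_scope.
Local Notation IZR := Rdefinitions.IZR.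
Delimit Scope nat_scope with N.
Bind Scope ring_scope with Rdefinitions.RbaseSymbolsImpl.R.

(** * Coefficient sequences of even solutions *)

Section L1Norm.
Variable R : realType.
Implicit Types (x y : R[i]) (a : R).

Definition ii : R[i] := 0 +i* 1.

(** The l^1 norm rather than the modulus: it is rational on rational points
    and is still invariant under multiplication by i. *)
Definition cnorm x : R := `|complex.Re x| + `|complex.Im x|.

Lemma cnorm_ge0 x : 0 <= cnorm x.
Proof. by rewrite addr_ge0. Qed.

Lemma cnorm0 : cnorm 0 = 0.
Proof. by rewrite /cnorm /= normr0 addr0. Qed.

Lemma cnormN x : cnorm (- x) = cnorm x.
Proof. by case: x => a b; rewrite /cnorm /= !normrN. Qed.

Lemma cnormD x y : cnorm (x + y) <= cnorm x + cnorm y.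
Proof.
case: x y => a b [c d]; rewrite /cnorm /=.
by rewrite addrACA lerD// ler_normD.
Qed.

Lemma cnormB x y : cnorm (x - y) <= cnorm x + cnorm y.
Proof. by rewrite -(cnormN y) cnormD. Qed.

Lemma cnormZ a x : cnorm (a%:C * x) = `|a| * cnorm x.
Proof.
by case: x => b c; rewrite /cnorm /= !mul0r subr0 addr0 !normrM mulrDr.
Qed.

Lemma cnormi x : cnorm (ii * x) = cnorm x.
Proof.
case: x => b c; rewrite /ii /cnorm /= !mul0r !mul1r sub0r add0r normrN.
exact: addrC.
Qed.

Lemma normr_Re_le x : `|complex.Re x| <= cnorm x.
Proof. by rewrite lerDl. Qed.

Lemma normr_Im_le x : `|complex.Im x| <= cnorm x.
Proof. by rewrite lerDr. Qed.

End L1Norm.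
Arguments ii {R}.

Section Recurrence.
Variable R : realType.
Implicit Types (b g : R) (n : nat).

Definition delay (T : nmodType) (u : nat -> T) n : T :=
  if n is m.+1 then u m else 0.

(** The second derivative sends the coefficients u_n of a series in y^2 to
    diff2 n * u_{n+1}. *)
Definition diff2 n : nat := ((2 * n + 1) * (2 * n + 2))%N.

Lemma diff2_gt0 n : (0 < diff2 n)%N.
Proof. by rewrite /diff2 muln_gt0 !addn_gt0 !orbT. Qed.

(** The system phi'' = phi + w, w'' = w + i ((b y^2 + g) w - 2 b phi) read
    on the coefficients of phi = sum f_n y^{2n} and w = sum w_n y^{2n}, with
    source terms F and W. The sources absorb rounding, truncation and
    changes of the parameters, so that one a priori bound covers all of
    them. *)
Definition os_mode b g (F W : nat -> R[i]) f w : Prop := forall n,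
  (diff2 n)%:R%:C * f n.+1 = f n + w n + F n /\
  (diff2 n)%:R%:C * w n.+1 =
    w n + ii * (b%:C * (delay w n - 2 * f n) + g%:C * w n) + W n.

(** The third component carries the previous w, which multiplication by y^2
    brings into the recurrence. *)
Fixpoint os_coef b g (f0 w0 : R[i]) n : (R[i] * R[i]) * R[i] :=
  if n is m.+1 then
    let: ((f, w), v) := os_coef b g f0 w0 m in
    let c := (diff2 m)%:R^-1%:C in
    ((c * (f + w), c * (w + ii * (b%:C * (v - 2 * f) + g%:C * w))), w)
  else ((f0, w0), 0).

Definition os_f b g f0 w0 n := (os_coef b g f0 w0 n).1.1.
Definition os_w b g f0 w0 n := (os_coef b g f0 w0 n).1.2.

Lemma os_coefP b g f0 w0 : os_mode b g (fun=> 0) (fun=> 0)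
  (os_f b g f0 w0) (os_w b g f0 w0).
Proof.
have vE n : (os_coef b g f0 w0 n).2 = delay (os_w b g f0 w0) n.
  case: n => //= n; rewrite /os_w.
  by case: (os_coef b g f0 w0 n) => -[].
move=> n; rewrite !addr0 -vE /os_f /os_w /=.
have d0 : (diff2 n)%:R%:C * (diff2 n)%:R^-1%:C = 1 :> R[i].
  rewrite -rmorphM /= divff ?rmorph1// pnatr_eq0.
  by rewrite -lt0n diff2_gt0.
by case: (os_coef b g f0 w0 n) => -[f w] v /=; rewrite !mulrA d0 !mul1r.
Qed.

(** The recurrence is affine in (b, g), so a solution for one pair of
    parameters solves the recurrence of another one with an explicit source. *)
Lemma os_mode_change b g b' g' (F W f w : nat -> R[i]) : os_mode b g F W f w ->
  os_mode b' g' F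
    (fun n => W n + ii * ((b - b')%:C * (delay w n - 2 * f n)
                          + (g - g')%:C * w n)) f w.
Proof.
move=> h n; have [-> ->] := h n; split=> //.
rewrite !rmorphB /=; ring.
Qed.

Lemma os_modeB b g (F W f w F' W' f' w' : nat -> R[i]) :
  os_mode b g F W f w -> os_mode b g F' W' f' w' ->
  os_mode b g (fun n => F n - F' n) (fun n => W n - W' n)
    (fun n => f n - f' n) (fun n => w n - w' n).
Proof.
move=> h h' n; have [h1 h2] := h n; have [h1' h2'] := h' n; split.
  by rewrite mulrBr h1 h1'; ring.
rewrite mulrBr h2 h2'; case: n {h1 h2 h1' h2'} => [|n] /=; ring.
Qed.

Lemma os_modeZ b g (F W f w : nat -> R[i]) (a : R[i]) : os_mode b g F W f w ->
  os_mode b g (fun n => a * F n) (fun n => a * W n)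
    (fun n => a * f n) (fun n => a * w n).
Proof.
move=> h n; have [h1 h2] := h n; split.
  by rewrite mulrCA h1; ring.
rewrite mulrCA h2; case: n {h1 h2} => [|n] /=; ring.
Qed.

End Recurrence.

(** * A weighted bound for the recurrence *)

Section Majorant.
Variable R : realType.
Variables theta L : R.
Hypothesis theta_gt0 : 0 < theta.

(** The step of the recurrence multiplies by about L / diff2 n, where L
    bounds the size of its right-hand side. Keeping the ratio above theta
    makes the delayed term w_{n-1} harmless, at the price of a geometric
    tail instead of a factorial one. *)
Fixpoint majorant n : R :=
  if n is m.+1 then Num.max theta (L / (diff2 m)%:R) * majorant m else 1.

Lemma majorant_gt0 n : 0 < majorant n.
Proof.
elim: n => //= n IH; rewrite mulr_gt0// lt_max theta_gt0//.
Qed.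

Lemma majorant_theta n : theta * majorant n <= majorant n.+1.
Proof. by rewrite /= ler_pM2r ?majorant_gt0// le_max lexx. Qed.

Lemma majorant_L n : L * majorant n <= (diff2 n)%:R * majorant n.+1.
Proof.
rewrite /= mulrA ler_pM2r ?majorant_gt0//.
have d0 : 0 < (diff2 n)%:R :> R by rewrite ltr0n diff2_gt0.
by rewrite mulrC -ler_pdivrMr// le_max lexx orbT.
Qed.

Lemma majorant_delay n (u : nat -> R[i]) (M : R) : 0 <= M ->
  (forall k, (k < n)%N -> cnorm (u k) <= M * majorant k) ->
  cnorm (delay u n) <= M / theta * majorant n.
Proof.
move=> M0; case: n => [|n] h /=.
  by rewrite cnorm0 mulr1 divr_ge0// ltW.
rewrite (le_trans (h n _))// -mulrA ler_wpM2l//.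
by rewrite ler_pdivlMl// majorant_theta.
Qed.

(** Induction on n: each right-hand side is at most L times the previous
    weight, and [majorant] was made for that. The sequence f is measured in
    the smaller unit s * M, since its own equation has no large coefficient
    (this is the condition s + 2 <= s * L); this keeps the term 2 b f from
    dominating the condition on L. *)
Lemma os_mode_bound (b g : R) (F W f w : nat -> R[i]) (s M : R) : 0 <= M -> 0 <= s ->
  s + 2 <= s * L -> 2 + `|g| + 2 * s * `|b| + `|b| / theta <= L ->
  os_mode b g F W f w ->
  cnorm (f 0) <= s * M -> cnorm (w 0) <= M ->
  (forall n, cnorm (F n) <= M * majorant n) ->
  (forall n, cnorm (W n) <= M * majorant n) ->
  forall n, cnorm (f n) <= s * M * majorant n /\ cnorm (w n) <= M * majorant n.
Proof.
move=> M0 s0 hs hL h hf hw hF hW n; elim/ltn_ind: n => -[|n] IH.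
  by rewrite /= !mulr1.
have [fn wn] := IH n (ltnSn n).
have [h1 h2] := h n.
have d0 : 0 < (diff2 n)%:R :> R by rewrite ltr0n diff2_gt0.
have dn x : cnorm ((diff2 n)%:R%:C * x) = (diff2 n)%:R * cnorm x.
  by rewrite cnormZ ger0_norm// ltW.
have m0 := majorant_gt0 n.
have M1 : 0 <= M * majorant n by rewrite mulr_ge0// ltW.
have mL := majorant_L n.
have shn : cnorm (delay w n) <= M / theta * majorant n.
  by apply: majorant_delay => // k kn; have [] := IH k (ltnW kn).
split; rewrite -(ler_pM2l d0) -dn ?h1 ?h2.
- have H : cnorm (f n + w n + F n) <= (s + 2) * (M * majorant n).
    apply: (le_trans (cnormD _ _)); apply: (le_trans (lerD (cnormD _ _) (hF n))).
    apply: (le_trans (lerD (lerD fn wn) (lexx _))); lra.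
  apply: (le_trans H); apply: (@le_trans _ _ (s * L * (M * majorant n))).
    by rewrite ler_wpM2r.
  have -> : s * L * (M * majorant n) = s * M * (L * majorant n) by ring.
  rewrite [leRHS]mulrCA; apply: ler_wpM2l => //; exact: mulr_ge0.
- apply: (@le_trans _ _ (L * (M * majorant n))); last first.
    rewrite mulrCA [leRHS]mulrCA; exact: ler_wpM2l.
  apply: le_trans (ler_wpM2r M1 hL).
  apply: (le_trans (cnormD _ _)).
  apply: (le_trans (lerD (cnormD _ _) (hW n))).
  rewrite cnormi.
  have H1 := cnormD (b%:C * (delay w n - 2 * f n)) (g%:C * w n).
  rewrite !cnormZ in H1.
  have H2 : cnorm (delay w n - 2 * f n) <=
      (M / theta + 2 * s * M) * majorant n.
    apply: (le_trans (cnormB _ _)).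
    rewrite [leRHS]mulrDl lerD// -[2]/(2%:R) -(rmorph_nat (real_complex R)) /= cnormZ.
    rewrite ger0_norm//; nra.
  have H3 := ler_wpM2l (normr_ge0 b) H2.
  have H4 := ler_wpM2l (normr_ge0 g) wn.
  have -> : (2 + `|g| + 2 * s * `|b| + `|b| / theta) * (M * majorant n) =
     M * majorant n + (`|b| * ((M / theta + 2 * s * M) * majorant n)
      + `|g| * (M * majorant n)) + M * majorant n by ring.
  rewrite lerD2r lerD//; lra.
Qed.

End Majorant.

Section MajorantGrowth.
Variable R : realType.
Variables theta L : R.
Hypotheses (theta_gt0 : 0 < theta) (L_gt0 : 0 < L).
Local Notation om := (majorant theta L).

Lemma diff2_le m n : (m <= n)%N -> (diff2 m <= diff2 n)%N.
Proof. by move=> mn; rewrite /diff2 leq_mul// leq_add2r leq_mul2l. Qed.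

Lemma prod_diff2 m : (\prod_(j < m) diff2 j)%N = (2 * m)`!.
Proof.
elim: m => [|m IH]; first by rewrite big_ord0.
rewrite big_ord_recr /= IH /diff2 mulnS !addSn add0n !factS addn1 addn2.
by rewrite mulnC -mulnA mulnCA.
Qed.

(** From m on the maximum in [majorant] is theta, so only the first m
    factors can exceed theta. *)
Lemma majorant_geometric m : (forall j, (m <= j)%N -> L <= theta * (diff2 j)%:R) ->
  forall n, om n <= (\prod_(j < m) Num.max 1 (L / (theta * (diff2 j)%:R))) * theta ^+ n.
Proof.
move=> hm.
have d0 j : 0 < (diff2 j)%:R :> R by rewrite ltr0n diff2_gt0.
have maxE j : Num.max theta (L / (diff2 j)%:R)
    = theta * Num.max 1 (L / (theta * (diff2 j)%:R)).
  rewrite maxr_pMr ?ltW// mulr1 invfM mulrA [theta * _]mulrC.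
  by rewrite -[L * theta * _]mulrA mulVKf ?mulrA ?gt_eqF//.
have p1 k : 1 <= \prod_(j < k) Num.max 1 (L / (theta * (diff2 j)%:R)).
  elim: k => [|k IH]; first by rewrite big_ord0.
  by rewrite big_ord_recr /= mulr_ege1// le_max lexx.
have omE n : om n = (\prod_(j < n) Num.max 1 (L / (theta * (diff2 j)%:R))) * theta ^+ n.
  elim: n => [|n IH]; first by rewrite big_ord0 mulr1.
  rewrite big_ord_recr /= IH exprS maxE; ring.
move=> n; rewrite omE; apply: ler_wpM2r; first by rewrite exprn_ge0// ltW.
have ge k i : \prod_(j < k) Num.max 1 (L / (theta * (diff2 j)%:R)) <=
    \prod_(j < k + i) Num.max 1 (L / (theta * (diff2 j)%:R)).
  elim: i => [|i IH]; first by rewrite addn0.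
  rewrite addnS big_ord_recr /=; apply: (le_trans IH).
  by rewrite ler_peMr ?le_max ?lexx// (le_trans ler01).
have [nm|mn] := leqP n m; first by have := ge n (m - n)%N; rewrite subnKC.
rewrite -(subnKC (ltnW mn)); elim: (n - m)%N => [|k IH]; first by rewrite addn0.
rewrite addnS big_ord_recr /= max_l ?mulr1//.
by rewrite ler_pdivrMr ?mul1r ?mulr_gt0// hm// leq_addr.
Qed.

Lemma majorant_geometric_ex : exists2 W, 0 <= W & forall n, om n <= W * theta ^+ n.
Proof.
have [m hm] : exists m : nat, L / theta < m%:R.
  by exists (Num.truncn (L / theta)).+1; exact: truncnS_gt.
eexists; last first.
  apply: (@majorant_geometric m) => j mj.
  rewrite -ler_pdivrMl// mulrC (le_trans (ltW hm))// ler_nat /diff2; nia.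
by apply: prodr_ge0 => j _; rewrite le_max ler01.
Qed.

(** With m the exact place where the ratio drops below theta, the constant
    is (L / theta)^m / (2m)!, as the product of the diff2 j is a factorial. *)
Lemma majorant_le m : (forall j, (m <= j)%N -> L <= theta * (diff2 j)%:R) ->
  (forall j, (j < m)%N -> theta * (diff2 j)%:R <= L) ->
  forall n, om n <= (L / theta) ^+ m / ((2 * m)`!)%:R * theta ^+ n.
Proof.
move=> h1 h2 n; rewrite (le_trans (majorant_geometric h1 n))//.
apply: ler_wpM2r; first by rewrite exprn_ge0// ltW.
have d0 j : 0 < (diff2 j)%:R :> R by rewrite ltr0n diff2_gt0.
under eq_bigr => j _.
  rewrite max_r; last by rewrite ler_pdivlMr ?mulr_gt0// mul1r h2.
  rewrite invfM mulrA; over.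
by rewrite big_split /= prodr_const card_ord prodfV -natr_prod prod_diff2.
Qed.

Lemma majorant_ge m : L ^+ m / ((2 * m)`!)%:R <= om m.
Proof.
elim: m => [|m IH]; first by rewrite divr1.
have d0 : 0 < (diff2 m)%:R :> R by rewrite ltr0n diff2_gt0.
have -> : L ^+ m.+1 / ((2 * m.+1)`!)%:R
    = (L / (diff2 m)%:R) * (L ^+ m / ((2 * m)`!)%:R).
  rewrite -!prod_diff2 big_ord_recr /= natrM invfM exprS; ring.
apply: ler_pM => //; first by rewrite divr_ge0 ?ltW.
  by rewrite divr_ge0// exprn_ge0// ltW.
by rewrite le_max lexx orbT.
Qed.

Lemma majorantD m k : theta ^+ k * om m <= om (m + k).
Proof.
elim: k => [|k IH]; first by rewrite mul1r addn0.
rewrite exprS -mulrA addnS (le_trans (ler_wpM2l (ltW theta_gt0) IH))//.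
exact: majorant_theta.
Qed.

Lemma majorant_ge1 m : (forall j, (j < m)%N -> (diff2 j)%:R <= L) -> 1 <= om m.
Proof.
elim: m => [|m IH] h //=; rewrite mulr_ege1//; last first.
  by apply: IH => j jm; apply: h; rewrite ltnS ltnW.
by rewrite le_max ler_pdivlMr ?ltr0n ?diff2_gt0// mul1r h ?orbT.
Qed.

End MajorantGrowth.

(** * Sums of geometrically bounded sequences *)

Section SeriesSum.
Variable R : realType.
Implicit Types (u v : nat -> R).

Definition tsum u : R := limn (series u).

Variable theta : R.
Hypotheses (theta_gt0 : 0 < theta) (theta_lt1 : theta < 1).

Definition geo_bounded u := exists M, forall n, `|u n| <= M * theta ^+ n.

Lemma geo_bounded_normed u : geo_bounded u -> cvgn [normed series u].
Proof.
move=> [M hM].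
have M0 : 0 <= M by have := hM 0; rewrite mulr1; exact: le_trans.
apply: (@series_le_cvg _ _ (fun n => M * theta ^+ n)) => //.
- by move=> n /=.
- by move=> n; rewrite mulr_ge0// exprn_ge0// ltW.
- by apply: is_cvg_geometric_series; rewrite gtr0_norm.
Qed.

Lemma geo_bounded_cvg u : geo_bounded u -> cvgn (series u).
Proof. by move/geo_bounded_normed; exact: (@normed_cvg _ R^o). Qed.

Lemma tsum_le u M : (forall n, `|u n| <= M * theta ^+ n) ->
  `|tsum u| <= M / (1 - theta).
Proof.
move=> hM; have hc : geo_bounded u by exists M.
have th1 : `|theta| < 1 by rewrite gtr0_norm.
apply: (le_trans (@lim_series_norm _ R^o _ (geo_bounded_normed hc))).
have <- : limn (series (geometric M theta)) = M / (1 - theta).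
  by apply/cvg_lim => //; exact: cvg_geometric_series.
apply: lim_series_le; [exact: geo_bounded_normed|exact: is_cvg_geometric_series|].
exact: hM.
Qed.

Lemma tsumB u v : geo_bounded u -> geo_bounded v ->
  tsum (fun n => u n - v n) = tsum u - tsum v.
Proof.
move=> /geo_bounded_cvg hu /geo_bounded_cvg hv.
exact: (lim_seriesB hu hv).
Qed.

Lemma tsumZ (a : R) u : geo_bounded u -> tsum (fun n => a * u n) = a * tsum u.
Proof. move=> /geo_bounded_cvg hu; exact: (lim_seriesZ a hu). Qed.

Lemma tsum_finite N u : (forall n, (N <= n)%N -> u n = 0) ->
  tsum u = \sum_(0 <= i < N) u i.
Proof.
move=> h; apply: lim_near_cst => //; near=> n.
have Nn : (N <= n)%N by near: n; exact: nbhs_infty_ge.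
rewrite /series /= (big_cat_nat _ Nn)//= [X in _ + X]big_nat_cond.
by rewrite [X in _ + X]big1 ?addr0// => i /andP[/andP[Ni _] _]; exact: h.
Unshelve. all: by end_near. Qed.

End SeriesSum.

(** * A zero from an approximate inverse of the Jacobian *)

Section Newton.
Variable R : realType.
Variable n : nat.
Local Notation V := 'cV[R]_n.+1.
Implicit Types (A B J : 'M[R]_n.+1) (x z : V).

Lemma normr_coord_le x i : `|x i 0| <= `|x|.
Proof. by rewrite [leRHS]/Num.norm /= mx_normrE (le_bigmax _ _ (i, 0)). Qed.

Lemma norm_cV_le x (c : R) : 0 <= c -> (forall i, `|x i 0| <= c) -> `|x| <= c.
Proof.
move=> c0 h; rewrite [leLHS]/Num.norm /= mx_normrE.
by apply: bigmax_le => //= -[i j] _ /=; rewrite ord1.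
Qed.

Lemma norm_mulmx_le A (c : R) x : 0 <= c ->
  (forall i, \sum_j `|A i j| <= c) -> `|A *m x| <= c * `|x|.
Proof.
move=> c0 h; apply: norm_cV_le => [|i]; first by rewrite mulr_ge0.
rewrite mxE (le_trans (ler_norm_sum _ _ _))//.
apply: le_trans (ler_wpM2r (normr_ge0 x) (h i)).
rewrite mulr_suml; apply: ler_sum => j _.
by rewrite normrM ler_wpM2l// normr_coord_le.
Qed.

(** The map z - B G(z) is a contraction of the ball by 1/2: its increment is
    (1 - B J)(z - z') up to beta * e. The Banach fixed point z has B G(z) =
    0, and B is invertible because 1 - B J has norm below 1. Neither J nor
    the differentiability of G has to be known beyond the expansion of G
    with error e. *)
Lemma approx_newton (G : V -> V) (J B : 'M[R]_n.+1) (z0 : V) (r kappa beta e : R) :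
  0 < r -> 0 <= kappa -> 0 <= beta -> 0 <= e ->
  (forall z z', `|z - z0| <= r -> `|z' - z0| <= r ->
     `|G z - G z' - J *m (z - z')| <= e * `|z - z'|) ->
  (forall i, \sum_j `|(1%:M - B *m J) i j| <= kappa) ->
  (forall i, \sum_j `|B i j| <= beta) ->
  kappa + beta * e <= 2^-1 -> `|B *m G z0| <= r / 2 ->
  exists2 z, `|z - z0| <= r & G z = 0.
Proof.
move=> r0 k0 b0 e0 hG hK hB hq hz0.
pose N z : V := z - B *m G z.
pose U : set V := [set z | `|z - z0| <= r].
have Nlip z z' : U z -> U z' -> `|N z - N z'| <= 2^-1 * `|z - z'|.
  move=> Uz Uz'.
  have -> : N z - N z' = (1%:M - B *m J) *m (z - z')
      - B *m (G z - G z' - J *m (z - z')).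
    rewrite /N mulmxBl mul1mx -mulmxA !mulmxBr.
    move: (B *m G z) (B *m G z') (B *m (J *m z)) (B *m (J *m z')) => a a' b b'.
    apply/matrixP => i j; rewrite !mxE; lra.
  apply: (le_trans (ler_normB _ _)).
  apply: le_trans (ler_wpM2r (normr_ge0 (z - z')) hq).
  rewrite mulrDl lerD//; first exact: norm_mulmx_le.
  apply: (le_trans (norm_mulmx_le _ b0 hB)); rewrite -mulrA ler_wpM2l//.
  exact: hG.
have Uz0 : U z0 by rewrite /U /= subrr normr0 ltW.
have NU : {homo N : z / U z >-> U z}.
  move=> z Uz; rewrite /U /=.
  have -> : N z - z0 = (N z - N z0) - B *m G z0.
    rewrite /N; apply/matrixP => i j; rewrite !mxE; lra.
  rewrite (le_trans (ler_normB _ _))//.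
  rewrite [leRHS](splitr r) lerD//.
  apply: (le_trans (Nlip z z0 Uz Uz0)).
  by rewrite mulrC ler_pM2r// invr_gt0.
pose Nfun : {fun U >-> U} := HB.pack N (isFun.Build _ _ U U N NU).
have ctr : is_contraction Nfun.
  have half0 : 0 <= 2^-1 :> R by rewrite invr_ge0.
  exists (NngNum half0); split => /=; first by rewrite invf_lt1// ltr1n.
  by move=> [z z'] [/= Uz Uz']; exact: Nlip.
have Ucl : closed U.
  rewrite (_ : U = closed_ball_ Num.norm z0 r); first exact: closed_closed_ball_.
  by apply/seteqP; split=> z; rewrite /U /closed_ball_ /= distrC.
pose X : completeNormedModType R := HB.pack V.
have [z Uz zN] := @banach_fixed_point R X U Nfun ctr Ucl (ex_intro _ z0 Uz0).
exists z => //.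
have BG : B *m G z = 0.
  have : z = z - B *m G z := zN.
  by move=> /(congr1 (fun y => z - y)); rewrite subrr opprB addrC subrK.
have kappa1 : kappa < 1.
  by rewrite (le_lt_trans _ (_ : 2^-1 < 1))// ?invf_lt1 ?ltr1n//; nra.
have Bu : B \in unitmx.
  have : B *m J \in unitmx.
    rewrite -unitmx_tr -row_free_unit; apply: inj_row_free => v hv.
    (* A vector in the kernel of B J is fixed by 1 - B J, hence zero. *)
    have vE : v^T = (1%:M - B *m J) *m v^T.
      apply: trmx_inj; rewrite trmx_mul trmxK linearB /= trmx1 mulmxBr.
      by rewrite mulmx1 hv subr0.
    have := norm_mulmx_le v^T k0 hK; rewrite -vE => hv1.
    have v0 : `|v^T| <= 0 by have := normr_ge0 v^T; nra.
    by apply: trmx_inj; rewrite trmx0; apply/eqP; rewrite -normr_le0.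
  by rewrite unitmx_mul => /andP[].
by rewrite -[G z]mul1mx -(mulVmx Bu) -mulmxA BG mulmx0.
Qed.
End Newton.

(** * Values at the wall *)

Section WallValues.
Variable R : realType.
Variables theta L s W : R.
Hypotheses (theta_gt0 : 0 < theta) (theta_lt1 : theta < 1).
Hypotheses (s_ge0 : 0 <= s) (s_le1 : s <= 1) (sL : s + 2 <= s * L).
Hypothesis tsL : theta^-1 + 2 * s <= 2.
Local Notation om := (majorant theta L).
Hypothesis omW : forall n, om n <= W * theta ^+ n.
Implicit Types (f w : nat -> R[i]) (n : nat) (i : 'I_4).

(** The terms of phi(1) = sum f_n and of phi'(1) = sum (f_n + w_n) / (2n +
    1); the latter is sum (2n + 2) f_{n+1} after the recurrence for f. Both
    are taken in real coordinates, since b and g are real unknowns while phi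
    is complex. *)
Definition wall_coef f w n i : R :=
  let p := (2 * n + 1)%:R^-1%:C * (f n + w n) in
  [tuple complex.Re (f n); complex.Im (f n); complex.Re p; complex.Im p]`_i.

Definition wall f w : 'cV[R]_4 :=
  \col_i tsum (fun n => wall_coef f w n i).

Definition om_bounded (M : R) f w := forall n,
  cnorm (f n) <= s * M * om n /\ cnorm (w n) <= M * om n.

Lemma wall_coef_le f w n i : `|wall_coef f w n i| <= cnorm (f n) + cnorm (w n).
Proof.
have hp : cnorm ((2 * n + 1)%:R^-1%:C * (f n + w n)) <= cnorm (f n) + cnorm (w n).
  rewrite cnormZ; apply: le_trans (cnormD _ _).
  rewrite ler_piMl ?cnorm_ge0// ger0_norm ?invr_ge0//.
  by rewrite invf_le1 ?ler1n ?ltr0n addn1.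
have hf : cnorm (f n) <= cnorm (f n) + cnorm (w n) by rewrite lerDl cnorm_ge0.
rewrite /wall_coef; case: i => -[|[|[|[|//]]]] /= _.
- exact: le_trans (normr_Re_le _) hf.
- exact: le_trans (normr_Im_le _) hf.
- exact: le_trans (normr_Re_le _) hp.
- exact: le_trans (normr_Im_le _) hp.
Qed.

Lemma wall_coefB f w f' w' n i :
  wall_coef (fun n => f n - f' n) (fun n => w n - w' n) n i =
  wall_coef f w n i - wall_coef f' w' n i.
Proof.
rewrite /wall_coef; case: i => -[|[|[|[|//]]]] /= _;
  case: (f n) (w n) (f' n) (w' n) => a b [c d] [a' b'] [c' d'] //=; ring.
Qed.

Lemma wall_coefZ (a : R) f w n i :
  wall_coef (fun n => a%:C * f n) (fun n => a%:C * w n) n i =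
  a * wall_coef f w n i.
Proof.
rewrite /wall_coef; case: i => -[|[|[|[|//]]]] /= _;
  case: (f n) (w n) => b c [b' c'] //=; ring.
Qed.

Lemma wall_coef_bounded M f w n i : om_bounded M f w ->
  `|wall_coef f w n i| <= 2 * M * W * theta ^+ n.
Proof.
move=> h; apply: (le_trans (wall_coef_le _ _ _ _)).
have [h1 h2] := h n.
have M0 : 0 <= M.
  have [_] := h 0; rewrite mulr1; exact: le_trans (cnorm_ge0 _).
have mo := majorant_gt0 L theta_gt0 n.
have Mo : 0 <= M * om n by rewrite mulr_ge0// ltW.
have -> : 2 * M * W * theta ^+ n = 2 * (M * (W * theta ^+ n)) by ring.
have sMo : s * (M * om n) <= M * om n by rewrite ler_piMl.
have := ler_wpM2l M0 (omW n); lra.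
Qed.

Lemma wall_geo M f w i : om_bounded M f w ->
  geo_bounded theta (fun n => wall_coef f w n i).
Proof. by move=> h; exists (2 * M * W) => n; exact: wall_coef_bounded. Qed.

Lemma wall_le M f w : om_bounded M f w ->
  `|wall f w| <= 2 * M * (W / (1 - theta)).
Proof.
move=> h; have hb i := tsum_le theta_gt0 theta_lt1
  (fun n => wall_coef_bounded n i h).
have b0 : 0 <= 2 * M * (W / (1 - theta)).
  by have := hb 0; rewrite -mulrA; apply: le_trans.
by apply: norm_cV_le => // i; rewrite mxE (mulrA _ W).
Qed.

Lemma wallB M M' f w f' w' : om_bounded M f w -> om_bounded M' f' w' ->
  wall (fun n => f n - f' n) (fun n => w n - w' n) = wall f w - wall f' w'.
Proof.
move=> h h'; apply/colP => i; rewrite !mxE.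
rewrite -(tsumB theta_gt0 theta_lt1 (wall_geo i h) (wall_geo i h')).
by congr tsum; apply/funext => n; rewrite wall_coefB.
Qed.

Lemma wallZ M (a : R) f w : om_bounded M f w ->
  wall (fun n => a%:C * f n) (fun n => a%:C * w n) = a *: wall f w.
Proof.
move=> h; apply/colP => i; rewrite !mxE.
rewrite -(tsumZ theta_gt0 theta_lt1 a (wall_geo i h)).
by congr tsum; apply/funext => n; rewrite wall_coefZ.
Qed.

Lemma om_boundedB M M' f w f' w' : om_bounded M f w -> om_bounded M' f' w' ->
  om_bounded (M + M') (fun n => f n - f' n) (fun n => w n - w' n).
Proof.
move=> h h' n; have [h1 h2] := h n; have [h1' h2'] := h' n.
by split; apply: (le_trans (cnormB _ _)); rewrite ?mulrDr !mulrDl lerD.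
Qed.

Lemma om_boundedZ M (a : R) f w : om_bounded M f w ->
  om_bounded (`|a| * M) (fun n => a%:C * f n) (fun n => a%:C * w n).
Proof.
move=> h n; have [h1 h2] := h n; rewrite !cnormZ; split.
  by rewrite (mulrCA s) -mulrA ler_wpM2l.
by rewrite -mulrA ler_wpM2l.
Qed.

(** The derivatives of the recurrence in b and in g: these are the sources
    that drive the derivatives of the solution in the parameters. *)
Definition dbeta f w n : R[i] := ii * (delay w n - 2 * f n).
Definition dgamma w n : R[i] := ii * w n.

Lemma dbeta_le M f w n : om_bounded M f w -> cnorm (dbeta f w n) <= 2 * M * om n.
Proof.
move=> h; rewrite /dbeta cnormi; apply: (le_trans (cnormB _ _)).
have M0 : 0 <= M.
  have [_] := h 0; rewrite mulr1; exact: le_trans (cnorm_ge0 _).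
have h1 : cnorm (delay w n) <= M / theta * om n.
  by apply: majorant_delay => // k _; have [] := h k.
have [h2 _] := h n.
have h3 : cnorm (2 * f n) = 2 * cnorm (f n).
  by rewrite -[2 in LHS]/(2%:R) -(rmorph_nat (real_complex R)) /= cnormZ ger0_norm.
have mo := majorant_gt0 L theta_gt0 n.
have Mo : 0 <= M * om n by rewrite mulr_ge0// ltW.
rewrite h3; apply: (@le_trans _ _ ((theta^-1 + 2 * s) * (M * om n))).
  rewrite mulrDl; move: h1 h2; rewrite -[M / theta * _]mulrAC [_ / theta]mulrC; lra.
by rewrite -mulrA ler_wpM2r.
Qed.

Lemma dgamma_le M f w n : om_bounded M f w -> cnorm (dgamma w n) <= M * om n.
Proof. by move=> h; rewrite cnormi; have [] := h n. Qed.

Lemma os_mode_le b g (F S f w : nat -> R[i]) M :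
  2 + `|g| + 2 * s * `|b| + `|b| / theta <= L ->
  os_mode b g F S f w -> cnorm (f 0) <= s * M -> cnorm (w 0) <= M ->
  (forall n, cnorm (F n) <= M * om n) -> (forall n, cnorm (S n) <= M * om n) ->
  om_bounded M f w.
Proof.
move=> hL h f0 w0 hF hS n; have M0 : 0 <= M := le_trans (cnorm_ge0 _) w0.
exact: (os_mode_bound theta_gt0 M0 s_ge0 sL hL h f0 w0 hF hS n).
Qed.

End WallValues.

(** * Dependence of the wall values on the parameters *)

(** In this part chi is the solution with f_0 = 1 and w_0 = mu, and the
    parameters stay within r of a centre (b0, g0, mu0). *)
Section Perturbation.
Variable R : realType.
Variables theta L s W : R.
Hypotheses (theta_gt0 : 0 < theta) (theta_lt1 : theta < 1).
Hypotheses (s_ge0 : 0 <= s) (s_le1 : s <= 1) (sL : s + 2 <= s * L).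
Hypothesis tsL : theta^-1 + 2 * s <= 2.
Local Notation om := (majorant theta L).
Hypothesis omW : forall n, om n <= W * theta ^+ n.
Local Notation om_bounded := (om_bounded theta L s).
Implicit Types (b g : R) (mu : R[i]) (n : nat).

Variables (b0 g0 : R) (mu0 : R[i]) (r eps : R).
Hypotheses (r_ge0 : 0 <= r) (r_le : r <= 1000^-1).
Hypotheses (eps_ge0 : 0 <= eps) (eps_le1 : eps <= 1).
Hypothesis s50 : 1 <= s * 50.
Hypothesis mu0_le : cnorm mu0 <= 49.
Hypothesis ball_le : forall b g, `|b - b0| <= r -> `|g - g0| <= r ->
  2 + `|g| + 2 * s * `|b| + `|b| / theta <= L.

Local Notation chif b g mu := (os_f b g 1 mu).
Local Notation chiw b g mu := (os_w b g 1 mu).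

Let om_le (x y : R) n : x <= y -> x * om n <= y * om n.
Proof. by apply: ler_wpM2r; exact/ltW/majorant_gt0. Qed.

Lemma dbetaB (f w f' w' : nat -> R[i]) n :
  dbeta (fun n => f n - f' n) (fun n => w n - w' n) n
  = dbeta f w n - dbeta f' w' n.
Proof. by case: n => [|n]; rewrite /dbeta /=; ring. Qed.

Lemma os_mode_move b g b' g' (F S f w : nat -> R[i]) : os_mode b g F S f w ->
  os_mode b' g' F
    (fun n => S n + ((b - b')%:C * dbeta f w n + (g - g')%:C * dgamma w n)) f w.
Proof.
move=> /(os_mode_change b' g') h n; have [-> ->] := h n; split=> //.
rewrite /dbeta /dgamma; ring.
Qed.

Lemma chi_bounded b g mu : `|b - b0| <= r -> `|g - g0| <= r ->
  cnorm mu <= 50 -> om_bounded 50 (chif b g mu) (chiw b g mu).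
Proof.
move=> hb hg hmu.
apply: (os_mode_le theta_gt0 s_ge0 sL (ball_le hb hg) (os_coefP b g 1 mu)).
- by rewrite /os_f /= /cnorm /= normr0 normr1 addr0.
- by rewrite /os_w.
- by move=> n; rewrite cnorm0 mulr_ge0// ltW// majorant_gt0.
- by move=> n; rewrite cnorm0 mulr_ge0// ltW// majorant_gt0.
Qed.

Lemma ball0 : 2 + `|g0| + 2 * s * `|b0| + `|b0| / theta <= L.
Proof. by apply: ball_le; rewrite subrr normr0. Qed.

(** The sequences fa, wa are an approximate solution, in practice a rounded
    and truncated one; its defects Fa, Sa are below eps. *)
Section Approximation.
Variables (M : R) (Fa Sa fa wa : nat -> R[i]).
Hypothesis ha : os_mode b0 g0 Fa Sa fa wa.
Hypotheses (fa0 : fa 0 = 1) (wa0 : cnorm (wa 0 - mu0) <= eps).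
Hypothesis Fa_le : forall n, cnorm (Fa n) <= eps * om n.
Hypothesis Sa_le : forall n, cnorm (Sa n) <= eps * om n.

(** The difference solves the recurrence at (b0, g0) with sources of the
    size of the change of the parameters and of the defects. *)
Lemma chi_close b g mu : `|b - b0| <= r -> `|g - g0| <= r ->
  cnorm (mu - mu0) <= 2 * r -> cnorm mu <= 50 ->
  om_bounded (150 * r + eps) (fun n => chif b g mu n - fa n)
    (fun n => chiw b g mu n - wa n).
Proof.
move=> hb hg hmu hmu50.
have h := os_modeB (os_mode_move b0 g0 (os_coefP b g 1 mu)) ha.
have bd := chi_bounded hb hg hmu50.
apply: (os_mode_le theta_gt0 s_ge0 sL ball0 h).
- rewrite fa0 /os_f /= subrr cnorm0; apply: mulr_ge0 => //.
  by apply: addr_ge0 => //; apply: mulr_ge0; [exact: ler0n|].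
- rewrite /os_w /=; have -> : mu - wa 0 = (mu - mu0) - (wa 0 - mu0) by ring.
  apply: (le_trans (cnormB _ _)); apply: (le_trans (lerD hmu wa0)).
  by rewrite lerD2r ler_wpM2r// ler_nat.
- move=> n; rewrite sub0r cnormN (le_trans (Fa_le n))//.
  by apply: om_le; rewrite lerDr; apply: mulr_ge0; [exact: ler0n|].
- move=> n; rewrite add0r; apply: (le_trans (cnormB _ _)).
  rewrite mulrDl lerD//; apply: (le_trans (cnormD _ _)); rewrite !cnormZ.
  have mo := majorant_gt0 L theta_gt0 n.
  have h1 := dbeta_le theta_gt0 tsL n bd; have h2 := dgamma_le n bd.
  have := ler_pM (normr_ge0 _) (cnorm_ge0 _) hb h1.
  have := ler_pM (normr_ge0 _) (cnorm_ge0 _) hg h2.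
  lra.
Qed.

Lemma approx_bounded : om_bounded 51 fa wa.
Proof.
apply: (os_mode_le theta_gt0 s_ge0 sL ball0 ha).
- rewrite fa0 /cnorm /= normr0 normr1 addr0; have := s_ge0; have := s50; lra.
- have -> : wa 0 = (wa 0 - mu0) + mu0 by ring.
  apply: (le_trans (cnormD _ _)); apply: (le_trans (lerD wa0 mu0_le)); have := eps_le1; lra.
- by move=> n; apply: (le_trans (Fa_le n)); apply: om_le; have := eps_le1; lra.
- by move=> n; apply: (le_trans (Sa_le n)); apply: om_le; have := eps_le1; lra.
Qed.

Lemma wall_close : `|wall (chif b0 g0 mu0) (chiw b0 g0 mu0) - wall fa wa|
  <= 2 * (150 * r + eps) * (W / (1 - theta)).
Proof.
have mu50 : cnorm mu0 <= 50 by apply: (le_trans mu0_le); rewrite ler_nat.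
have e0 (x : R) : `|x - x| <= r by rewrite subrr normr0.
have := @chi_close b0 g0 mu0 (e0 b0) (e0 g0) _ mu50.
rewrite subrr cnorm0 mulr_ge0// => /(_ isT) h.
rewrite -(wallB theta_gt0 theta_lt1 s_le1 omW
  (chi_bounded (e0 b0) (e0 g0) mu50) approx_bounded).
exact: (wall_le theta_gt0 theta_lt1 s_le1 omW h).
Qed.

(** Approximate derivatives of the solution in b, g and Re mu, driven by the
    approximate solution instead of the exact one. The derivative in Im mu
    is i times the one in Re mu, because mu enters linearly. *)
Section Derivatives.
Variables (Fb Sb fb wb Fg Sg fg wg Fm Sm fm wm : nat -> R[i]).
Hypothesis hb : os_mode b0 g0 Fb (fun n => dbeta fa wa n + Sb n) fb wb.
Hypothesis hg : os_mode b0 g0 Fg (fun n => dgamma wa n + Sg n) fg wg.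
Hypothesis hm : os_mode b0 g0 Fm Sm fm wm.
Hypotheses (fb0 : fb 0 = 0) (wb0 : wb 0 = 0) (fg0 : fg 0 = 0) (wg0 : wg 0 = 0).
Hypotheses (fm0 : fm 0 = 0) (wm0 : wm 0 = 1).
Hypothesis F_le : forall n, [/\ cnorm (Fb n) <= eps * om n,
  cnorm (Fg n) <= eps * om n & cnorm (Fm n) <= eps * om n].
Hypothesis S_le : forall n, [/\ cnorm (Sb n) <= eps * om n,
  cnorm (Sg n) <= eps * om n & cnorm (Sm n) <= eps * om n].

Lemma tangent_beta_bounded : om_bounded 105 fb wb.
Proof.
have bd := approx_bounded.
apply: (os_mode_le theta_gt0 s_ge0 sL ball0 hb).
- by rewrite fb0 cnorm0 mulr_ge0.
- by rewrite wb0 cnorm0.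
- move=> n; have [h _ _] := F_le n; apply: (le_trans h).
  by apply: om_le; have := eps_le1; lra.
- move=> n; have [h _ _] := S_le n; apply: (le_trans (cnormD _ _)).
  have mo := majorant_gt0 L theta_gt0 n.
  have := dbeta_le theta_gt0 tsL n bd.
  have := om_le n eps_le1.
  lra.
Qed.

Lemma tangent_gamma_bounded : om_bounded 105 fg wg.
Proof.
have bd := approx_bounded.
apply: (os_mode_le theta_gt0 s_ge0 sL ball0 hg).
- by rewrite fg0 cnorm0 mulr_ge0.
- by rewrite wg0 cnorm0.
- move=> n; have [_ h _] := F_le n; apply: (le_trans h).
  by apply: om_le; have := eps_le1; lra.
- move=> n; have [_ h _] := S_le n; apply: (le_trans (cnormD _ _)).
  have mo := majorant_gt0 L theta_gt0 n.
  have := dgamma_le n bd.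
  have := om_le n eps_le1.
  lra.
Qed.

Lemma tangent_mu_bounded : om_bounded 1 fm wm.
Proof.
apply: (os_mode_le theta_gt0 s_ge0 sL ball0 hm).
- by rewrite fm0 cnorm0 mulr_ge0.
- by rewrite wm0 /cnorm /= normr0 normr1 addr0.
- move=> n; have [_ _ h] := F_le n; apply: (le_trans h).
  by apply: om_le; have := eps_le1; lra.
- move=> n; have [_ _ h] := S_le n; apply: (le_trans h).
  by apply: om_le; have := eps_le1; lra.
Qed.

Lemma om_bounded_ii (K : R) (f w : nat -> R[i]) : om_bounded K f w ->
  om_bounded K (fun n => ii * f n) (fun n => ii * w n).
Proof. by move=> h n; rewrite !cnormi. Qed.

Lemma source_le (K b g : R) (S f w : nat -> R[i]) n :
  `|b - b0| <= r -> `|g - g0| <= r -> om_bounded K f w ->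
  cnorm (S n) <= eps * om n ->
  cnorm (S n + ((b0 - b)%:C * dbeta f w n + (g0 - g)%:C * dgamma w n))
  <= (eps + 3 * r * K) * om n.
Proof.
move=> hbr hgr bd hS; apply: (le_trans (cnormD _ _)).
rewrite mulrDl lerD//; apply: (le_trans (cnormD _ _)); rewrite !cnormZ.
rewrite distrC in hbr; rewrite distrC in hgr.
have := ler_pM (normr_ge0 _) (cnorm_ge0 _) hbr (dbeta_le theta_gt0 tsL n bd).
have := ler_pM (normr_ge0 _) (cnorm_ge0 _) hgr (dgamma_le n bd).
lra.
Qed.

(** For the remainder of a first-order expansion in four real unknowns. *)
Lemma sub4_le (x y1 y2 y3 y4 : R[i]) (a1 a2 a3 a4 d c1 c2 c3 c4 : R) :
  `|a1| <= d -> `|a2| <= d -> `|a3| <= d -> `|a4| <= d ->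
  cnorm y1 <= c1 -> cnorm y2 <= c2 -> cnorm y3 <= c3 -> cnorm y4 <= c4 ->
  cnorm (x - a1%:C * y1 - a2%:C * y2 - a3%:C * y3 - a4%:C * y4)
  <= cnorm x + (d * c1 + d * c2 + d * c3 + d * c4).
Proof.
move=> h1 h2 h3 h4 k1 k2 k3 k4; rewrite !addrA.
have st (z y : R[i]) (a c e : R) : `|a| <= d -> cnorm y <= c ->
    cnorm z <= e -> cnorm (z - a%:C * y) <= e + d * c.
  move=> ad yc ze; apply: (le_trans (cnormB _ _)); apply: lerD => //.
  by rewrite cnormZ; apply: ler_pM => //; exact: cnorm_ge0.
by do 4!(apply: (st) => //).
Qed.

(** The remainder chi(z) - chi(z') - sum dz_k chi_k is again a solution of
    the recurrence at (b, g): its initial values vanish and its sources are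
    products of dz with the distance of chi(z') from its approximation, with
    the defects of the chi_k and with the shift of the parameters, hence
    O((r + eps) d). No second derivative appears. *)
Lemma wall_expansion b g mu b' g' mu' (d : R) :
  `|b - b0| <= r -> `|g - g0| <= r -> cnorm mu <= 50 ->
  `|b' - b0| <= r -> `|g' - g0| <= r -> cnorm (mu' - mu0) <= 2 * r ->
  cnorm mu' <= 50 ->
  `|b - b'| <= d -> `|g - g'| <= d ->
  `|complex.Re mu - complex.Re mu'| <= d ->
  `|complex.Im mu - complex.Im mu'| <= d ->
  `|wall (chif b g mu) (chiw b g mu) - wall (chif b' g' mu') (chiw b' g' mu')
    - ((b - b') *: wall fb wb + (g - g') *: wall fg wg
       + (complex.Re mu - complex.Re mu') *: wall fm wm
       + (complex.Im mu - complex.Im mu') *: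
         wall (fun n => ii * fm n) (fun n => ii * wm n))|
  <= 2 * (2000 * r + 7 * eps) * (W / (1 - theta)) * d.
Proof.
move=> hbr hgr hmu hbr' hgr' hmur' hmu' dh0 dh1 dh2 dh3.
pose hm0 := complex.Re mu - complex.Re mu'.
pose hm1 := complex.Im mu - complex.Im mu'.
rewrite -/hm0 -/hm1 in dh2 dh3 *.
have bd := chi_bounded hbr hgr hmu.
have bd' := chi_bounded hbr' hgr' hmu'.
have cl' := chi_close hbr' hgr' hmur' hmu'.
have bdb := tangent_beta_bounded; have bdg := tangent_gamma_bounded; have bdm := tangent_mu_bounded.
have bdi := om_bounded_ii bdm.
have bZ (a : R) K f w := @om_boundedZ R theta L s K a f w.
have B1 := om_boundedB bd bd'.
have B2 := om_boundedB B1 (bZ (b - b') _ _ _ bdb).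
have B3 := om_boundedB B2 (bZ (g - g') _ _ _ bdg).
have B4 := om_boundedB B3 (bZ hm0 _ _ _ bdm).
have wB K K' f w f' w' := @wallB R theta L s W theta_gt0 theta_lt1 s_le1 omW K K' f w f' w'.
have wZ K a f w := @wallZ R theta L s W theta_gt0 theta_lt1 s_le1 omW K a f w.
have -> : forall a x y z t : 'cV[R]_4, a - (x + y + z + t) = a - x - y - z - t.
  by move=> a x y z t; rewrite !opprD !addrA.
rewrite -(wB _ _ _ _ _ _ bd bd') -(wZ _ (b - b') _ _ bdb).
rewrite -(wB _ _ _ _ _ _ B1 (bZ _ _ _ _ bdb)) -(wZ _ (g - g') _ _ bdg).
rewrite -(wB _ _ _ _ _ _ B2 (bZ _ _ _ _ bdg)) -(wZ _ hm0 _ _ bdm).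
rewrite -(wB _ _ _ _ _ _ B3 (bZ _ _ _ _ bdm)) -(wZ _ hm1 _ _ bdi).
rewrite -(wB _ _ _ _ _ _ B4 (bZ _ _ _ _ bdi)).
rewrite mulrAC -[2 * _ * d]mulrA.
apply: (wall_le theta_gt0 theta_lt1 s_le1 omW).
have mv (a : R) F S f w (h : os_mode b0 g0 F S f w) :=
  os_modeZ (a%:C) (os_mode_move b g h).
have H := os_modeB (os_modeB (os_modeB (os_modeB (os_modeB
  (os_coefP b g 1 mu) (os_mode_move b g (os_coefP b' g' 1 mu')))
  (mv (b - b') _ _ _ _ hb)) (mv (g - g') _ _ _ _ hg))
  (mv hm0 _ _ _ _ hm))
  (os_modeZ hm1%:C (os_modeZ ii (os_mode_move b g hm))).
have d0 : 0 <= d := le_trans (normr_ge0 _) dh0.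
have e0 : 0 <= 2000 * r + 7 * eps.
  by apply: addr_ge0; (apply: mulr_ge0; [exact: ler0n|]).
apply: (os_mode_le theta_gt0 s_ge0 sL (ball_le hbr hgr) H).
- rewrite fb0 fg0 fm0 !mulr0 !subr0 /os_f /= subrr cnorm0.
  exact: (mulr_ge0 s_ge0 (mulr_ge0 e0 d0)).
- rewrite wb0 wg0 wm0 !mulr0 !subr0 /os_w /= !mulr1.
  (* The initial value of w is mu itself, so the two mu-tangents remove its
     increment exactly. *)
  set X := (X in cnorm X).
  suff [h1 h2] : complex.Re X = 0 /\ complex.Im X = 0.
    by rewrite /cnorm h1 h2 normr0 addr0; exact: (mulr_ge0 e0 d0).
  rewrite /X /hm0 /hm1; case: (mu) (mu') => [x y] [x' y'] /=.
  by split; ring.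
- move=> n; rewrite subrr; have [h1 h2 h3] := F_le n.
  have mo := majorant_gt0 L theta_gt0 n.
  have h4 : cnorm (ii * Fm n) <= eps * om n by rewrite cnormi.
  apply: (le_trans (sub4_le _ dh0 dh1 dh2 dh3 h1 h2 h3 h4)).
  rewrite cnorm0 add0r; have := mulr_ge0 d0 (mulr_ge0 r_ge0 (ltW mo)).
  have := mulr_ge0 d0 (mulr_ge0 eps_ge0 (ltW mo)); lra.
- move=> n; have [h1 h2 h3] := S_le n.
  have mo := majorant_gt0 L theta_gt0 n.
  have s1 := source_le hbr hgr bdb h1.
  have s2 := source_le hbr hgr bdg h2.
  have s3 := source_le hbr hgr bdm h3.
  have s4 : cnorm (ii * (Sm n + ((b0 - b)%:C * dbeta fm wm n
      + (g0 - g)%:C * dgamma wm n))) <= (eps + 3 * r * 1) * om n.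
    by rewrite cnormi.
  set X := (X in cnorm X).
  have -> : X = (b - b')%:C * dbeta (fun n => chif b' g' mu' n - fa n)
         (fun n => chiw b' g' mu' n - wa n) n
     + (g - g')%:C * dgamma (fun n => chiw b' g' mu' n - wa n) n
     - (b - b')%:C * (Sb n + ((b0 - b)%:C * dbeta fb wb n
         + (g0 - g)%:C * dgamma wb n))
     - (g - g')%:C * (Sg n + ((b0 - b)%:C * dbeta fg wg n
         + (g0 - g)%:C * dgamma wg n))
     - hm0%:C * (Sm n + ((b0 - b)%:C * dbeta fm wm n
         + (g0 - g)%:C * dgamma wm n))
     - hm1%:C * (ii * (Sm n + ((b0 - b)%:C * dbeta fm wm n
         + (g0 - g)%:C * dgamma wm n))).
    rewrite /X dbetaB /dgamma !rmorphB /=. ring.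
  apply: (le_trans (sub4_le _ dh0 dh1 dh2 dh3 s1 s2 s3 s4)).
  have c1 := dbeta_le theta_gt0 tsL n cl'; have c2 := dgamma_le n cl'.
  have := cnormD ((b - b')%:C * dbeta (fun n => chif b' g' mu' n - fa n)
         (fun n => chiw b' g' mu' n - wa n) n)
     ((g - g')%:C * dgamma (fun n => chiw b' g' mu' n - wa n) n).
  rewrite !cnormZ.
  have := ler_pM (normr_ge0 _) (cnorm_ge0 _) dh0 c1.
  have := ler_pM (normr_ge0 _) (cnorm_ge0 _) dh1 c2.
  have := mulr_ge0 d0 (mulr_ge0 r_ge0 (ltW mo)).
  have := mulr_ge0 d0 (mulr_ge0 eps_ge0 (ltW mo)).
  lra.
Qed.

End Derivatives.
End Approximation.
End Perturbation.

(** * Integer arithmetic with a fixed binary point *)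

Section IZRMorphism.
Local Notation R := Rdefinitions.R.
Implicit Types a b d : Z.

Lemma izrD a b : IZR (a + b) = IZR a + IZR b.
Proof. by rewrite RIneq.plus_IZR RplusE. Qed.

Lemma izrM a b : IZR (a * b) = IZR a * IZR b.
Proof. by rewrite RIneq.mult_IZR RmultE. Qed.

Lemma izrN a : IZR (- a) = - IZR a.
Proof. by rewrite RIneq.opp_IZR RoppE. Qed.

Lemma izrB a b : IZR (a - b) = IZR a - IZR b.
Proof. by rewrite -izrN -izrD Z.add_opp_r. Qed.

Lemma izr_le a b : (a <=? b)%Z -> IZR a <= IZR b.
Proof. by move=> /Z.leb_le /RIneq.IZR_le /RleP. Qed.

Lemma izr_lt a b : (a <? b)%Z -> IZR a < IZR b.
Proof. by move=> /Z.ltb_lt /RIneq.IZR_lt /RltP. Qed.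

Lemma izr_nat n : IZR (Z.of_nat n) = n%:R.
Proof. by rewrite -RIneq.INR_IZR_INZ INRE. Qed.

Lemma izr0 : IZR 0 = 0 :> R. Proof. by []. Qed.

Lemma izr1 : IZR 1 = 1 :> R. Proof. by []. Qed.

Lemma izrX a n : IZR (a ^ Z.of_nat n) = IZR a ^+ n.
Proof.
elim: n => [|n IH]; first by rewrite expr0.
by rewrite Nat2Z.inj_succ Z.pow_succ_r ?izrM ?IH ?exprS//; exact: Nat2Z.is_nonneg.
Qed.

Lemma izr_div a d : (0 <? d)%Z -> `|IZR d * IZR (a / d) - IZR a| <= IZR d.
Proof.
move=> /Z.ltb_lt d0.
have [m0 md] := Z.mod_pos_bound a d d0.
have E : a = (d * (a / d) + a mod d)%Z by apply: Z.div_mod; lia.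
rewrite {2}E izrD izrM opprD addrA subrr add0r normrN ger0_norm.
  by apply/izr_le/Z.leb_le; lia.
by rewrite -izr0; apply/izr_le/Z.leb_le.
Qed.

Lemma izr_shiftr a n : `|IZR (Z.shiftr a (Z.of_nat n)) - IZR a / 2 ^+ n| <= 1.
Proof.
have n0 : (0 <= Z.of_nat n)%Z by lia.
rewrite Z.shiftr_div_pow2//.
have h : (0 <? 2 ^ Z.of_nat n)%Z by apply/Z.ltb_lt/Z.pow_pos_nonneg.
have := izr_div a h; have := izr_lt h.
rewrite izrX izr0 (_ : IZR 2 = 2)// => p0 hp.
rewrite -(ler_pM2l p0) mulr1 -[X in X * _](gtr0_norm p0) -normrM mulrBr.
by rewrite [_ * (IZR a / _)]mulrC divfK// gt_eqF.
Qed.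

Lemma izr_diff2 n : IZR ((2 * Z.of_nat n + 1) * (2 * Z.of_nat n + 2)) = (diff2 n)%:R.
Proof.
rewrite -izr_nat /diff2; congr IZR; lia.
Qed.

End IZRMorphism.

Section FixedPoint.
Local Open Scope Z_scope.

(** Complex numbers with integer parts, in units of the last place. *)
Definition zc := (Z * Z)%type.
Implicit Types (x y : zc) (k d : Z).

Definition zcD x y : zc := (x.1 + y.1, x.2 + y.2).
Definition zcB x y : zc := (x.1 - y.1, x.2 - y.2).
Definition zcZ k x : zc := (k * x.1, k * x.2).
Definition zci x : zc := (- x.2, x.1).
Definition zc_div x d : zc := (x.1 / d, x.2 / d).
Definition zc_shr x k : zc := (Z.shiftr x.1 k, Z.shiftr x.2 k).
Definition zc_le x k : bool := (Z.abs x.1 <=? k) && (Z.abs x.2 <=? k).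
Definition zc0 : zc := (0, 0).

(** Coefficients f_n and w_n, the previous w_{n-1}, and the partial sums of
    phi(1) and phi'(1). *)
Record fxstate := Fx { fx_f : zc; fx_w : zc; fx_v : zc; fx_sf : zc; fx_sp : zc }.

Variables (KB : nat) (B G : Z).

(** The parameters B and G carry KB fractional bits while the state carries
    its own unit, so that a product is brought back by one shift and no
    common precision is needed. The source src is multiplied by i, as are
    the derivatives of the recurrence in b and g. *)
Definition fx_step (n : nat) (src : zc) (s : fxstate) : fxstate :=
  let: Fx f w v sf sp := s in
  let m := 2 * Z.of_nat n in
  let d := (m + 1) * (m + 2) in
  let fw := zcD f w in
  let t := zcD (zc_shr (zcD (zcZ B (zcB v (zcZ 2 f))) (zcZ G w)) (Z.of_nat KB)) src in
  Fx (zc_div fw d) (zc_div (zcD w (zci t)) d) w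
     (zcD sf f) (zcD sp (zc_div fw (m + 1))).

End FixedPoint.

Section FixedPointValue.
Local Notation R := Rdefinitions.R.
Variable u : R.
Hypothesis u_gt0 : 0 < u.
Implicit Types (x y : zc) (k d : Z).

(** The value of an integer pair whose last place is worth u. *)
Definition cv x : R[i] := (IZR x.1 * u) +i* (IZR x.2 * u).

Lemma cvD x y : cv (zcD x y) = cv x + cv y.
Proof. by rewrite /cv /= !izrD !mulrDl. Qed.

Lemma cvB x y : cv (zcB x y) = cv x - cv y.
Proof. by rewrite /cv /= !izrB !mulrBl. Qed.

Lemma cvi x : cv (zci x) = ii * cv x.
Proof. by rewrite /cv /ii /= izrN; congr Complex; ring. Qed.

Lemma cvZ k x : cv (zcZ k x) = (IZR k)%:C * cv x.
Proof. by rewrite /cv /= !izrM; congr Complex; ring. Qed.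

Lemma cv0 : cv zc0 = 0.
Proof. by rewrite /cv /= mul0r. Qed.

Lemma cv_div x d : (0 <? d)%Z ->
  cnorm ((IZR d)%:C * cv (zc_div x d) - cv x) <= 2 * IZR d * u.
Proof.
move=> d0; have h1 := izr_div x.1 d0; have h2 := izr_div x.2 d0.
rewrite /cnorm /= !mul0r subr0 addr0 !mulrA -!mulrBl !normrM (gtr0_norm u_gt0).
rewrite -mulrDl ler_pM2r//; lra.
Qed.

Lemma cv_shr x n : cnorm (cv (zc_shr x (Z.of_nat n)) - (2 ^- n)%:C * cv x) <= 2 * u.
Proof.
have h1 := izr_shiftr x.1 n; have h2 := izr_shiftr x.2 n.
rewrite /cnorm /= !mul0r subr0 addr0 !mulrA ![2 ^- n * _]mulrC -!mulrBl.
by rewrite !normrM (gtr0_norm u_gt0) -mulrDl ler_pM2r//; lra.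
Qed.

Lemma cnorm_cv x k : zc_le x k -> cnorm (cv x) <= 2 * IZR k * u.
Proof.
have abs_le (a : Z) : (Z.abs a <=? k)%Z -> `|IZR a| <= IZR k.
  move=> /Z.leb_le/Z.abs_le[h1 h2]; rewrite ler_norml -izrN.
  by apply/andP; split; apply/izr_le/Z.leb_le.
move=> /andP[/abs_le h1 /abs_le h2].
by rewrite /cnorm /= !normrM (gtr0_norm u_gt0) -mulrDl ler_pM2r//; lra.
Qed.

Variables (KB : nat) (B G : Z).
Local Notation b := (IZR B / 2 ^+ KB).
Local Notation g := (IZR G / 2 ^+ KB).

Lemma fx_step_f n src s :
  cnorm ((diff2 n)%:R%:C * cv (fx_f (fx_step KB B G n src s))
         - (cv (fx_f s) + cv (fx_w s))) <= 2 * (diff2 n)%:R * u.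
Proof.
case: s => f w v sf sp /=; rewrite -izr_diff2 -cvD; apply: cv_div.
by apply/Z.ltb_lt; lia.
Qed.

(** One shift and one division: their two rounding errors are at most a few
    units each, but the division error is multiplied by diff2 n when the
    equation is read before division. *)
Lemma fx_step_w n src s :
  cnorm ((diff2 n)%:R%:C * cv (fx_w (fx_step KB B G n src s))
         - (cv (fx_w s) + ii * (b%:C * (cv (fx_v s) - 2 * cv (fx_f s))
              + g%:C * cv (fx_w s)) + ii * cv src))
  <= 4 * (diff2 n)%:R * u.
Proof.
case: s => f w v sf sp; rewrite -izr_diff2.
set d := (X in IZR X); set s' := fx_step _ _ _ _ _ _.
pose y := zcD (zcZ B (zcB v (zcZ 2 f))) (zcZ G w).
pose t := zcD (zc_shr y (Z.of_nat KB)) src.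
have d0 : (0 <? d)%Z by apply/Z.ltb_lt; rewrite /d; lia.
have h1 := cv_div (zcD w (zci t)) d0.
have h2 := cv_shr y KB.
have -> : fx_w s' = zc_div (zcD w (zci t)) d by [].
have cvy : (2 ^- KB)%:C * cv y = b%:C * (cv v - 2 * cv f) + g%:C * cv w.
  have c2 : (IZR 2)%:C = 2 :> R[i] by exact: (rmorph_nat (real_complex R) 2).
  rewrite /y cvD !cvZ cvB cvZ !rmorphM /= c2; ring.
have -> : fx_v (Fx f w v sf sp) = v by [].
have -> : fx_f (Fx f w v sf sp) = f by [].
have -> : fx_w (Fx f w v sf sp) = w by [].
rewrite -cvy.
have := cnormD ((IZR d)%:C * cv (zc_div (zcD w (zci t)) d) - cv (zcD w (zci t)))
  (ii * (cv (zc_shr y (Z.of_nat KB)) - (2 ^- KB)%:C * cv y)).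
rewrite cnormi.
set A := (X in cnorm X <= _ -> _); set A' := (X in _ -> cnorm X <= _).
have -> : A = A'.
  rewrite /A /A' /t cvD cvi cvD; ring.
move=> h3; apply: (le_trans h3); apply: (le_trans (lerD h1 h2)).
have d1 : 1 <= IZR d by apply/izr_le/Z.leb_le; rewrite /d; lia.
rewrite -mulrDl ler_pM2r//; lra.
Qed.

End FixedPointValue.

(** * Fixed-point runs as solutions with small sources *)

Section Truncation.
Local Notation R := Rdefinitions.R.
Variables (u theta L : R).
Hypotheses (u_gt0 : 0 < u) (theta_gt0 : 0 < theta).
Variables (KB : nat) (B G : Z).
Local Notation b := (IZR B / 2 ^+ KB).
Local Notation g := (IZR G / 2 ^+ KB).
Local Notation om := (majorant theta L).
Variables (X : nat -> fxstate) (src : nat -> zc) (N : nat).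
Hypothesis X_step : forall n, X n.+1 = fx_step KB B G n (src n) (X n).
Hypothesis X_v0 : fx_v (X 0) = zc0.

(** Cutting the run at N gives a finitely supported sequence, whose wall
    values are finite sums. The cut leaves a defect in the equations N and N
    + 1 only. *)
Definition trunc (h : fxstate -> zc) n : R[i] :=
  if (n <= N)%N then cv u (h (X n)) else 0.

Lemma trunc_in h n : (n <= N)%N -> trunc h n = cv u (h (X n)).
Proof. by rewrite /trunc => ->. Qed.

Lemma trunc_out h n : (N < n)%N -> trunc h n = 0.
Proof. by rewrite /trunc [(n <= N)%N]leqNgt => ->. Qed.

Lemma delay_trunc n : (n <= N)%N -> delay (trunc fx_w) n = cv u (fx_v (X n)).
Proof.
case: n => [|n] nN /=; first by rewrite X_v0 cv0.
rewrite trunc_in; last exact: ltnW.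
by rewrite X_step; congr (cv u _); case: (X n).
Qed.

Variables (T : Z) (Q eps : R) (S : nat -> R[i]).
Local Notation t := (IZR T * u).
Hypotheses (fT : zc_le (fx_f (X N)) T) (wT : zc_le (fx_w (X N)) T)
  (vT : zc_le (fx_v (X N)) T).
Hypothesis om1 : forall n, (n < N)%N -> 1 <= om n.
Hypothesis omQ : Q <= om N /\ Q <= om N.+1.
Hypothesis S_in : forall n, (n < N)%N -> S n = ii * cv u (src n).
Hypothesis S_tail : forall n, (N <= n)%N -> cnorm (S n) <= 6 * t.
Hypothesis S_out : forall n, (N.+1 < n)%N -> S n = 0.
Hypothesis eps_u : 4 * (diff2 N)%:R * u <= eps.
Hypothesis eps_t : (8 + 6 * `|b| + 2 * `|g|) * t <= eps * Q.

Lemma trunc_eps_ge0 : 0 <= eps.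
Proof.
apply: le_trans eps_u; apply: mulr_ge0; last exact: ltW.
by apply: mulr_ge0; rewrite ?ler0n.
Qed.

(** Below N the defects are rounding errors, at most a few u * diff2 n, and
    the weight is at least 1 there. At N and N + 1 they are as large as the
    discarded tail T u; this is absorbed because the weight is still at
    least Q, far beyond its start value. *)
Lemma trunc_mode : exists F W : nat -> R[i],
  [/\ os_mode b g F (fun n => S n + W n) (trunc fx_f) (trunc fx_w),
      forall n, cnorm (F n) <= eps * om n &
      forall n, cnorm (W n) <= eps * om n].
Proof.
set f := trunc fx_f; set w := trunc fx_w.
pose F n := (diff2 n)%:R%:C * f n.+1 - (f n + w n).
pose W n := (diff2 n)%:R%:C * w n.+1
  - (w n + ii * (b%:C * (delay w n - 2 * f n) + g%:C * w n) + S n).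
have e0 := trunc_eps_ge0.
have om0 n := majorant_gt0 L theta_gt0 n.
have eom n : 0 <= eps * om n by exact: (mulr_ge0 e0 (ltW (om0 n))).
have t0 : 0 <= t by have := le_trans (cnorm_ge0 _) (S_tail (leqnn N)); lra.
have b0 := normr_ge0 b; have g0 := normr_ge0 g.
have bt := mulr_ge0 b0 t0; have gt := mulr_ge0 g0 t0.
have fN := cnorm_cv u_gt0 fT; have wN := cnorm_cv u_gt0 wT.
have vN := cnorm_cv u_gt0 vT.
have QN : eps * Q <= eps * om N by rewrite ler_wpM2l//; case: omQ.
have QN1 : eps * Q <= eps * om N.+1 by rewrite ler_wpM2l//; case: omQ.
have inN n : (n < N)%N -> 4 * (diff2 n)%:R * u <= eps * om n.
  move=> nN; apply: (@le_trans _ _ eps).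
    apply: le_trans eps_u; rewrite ler_pM2r// ler_pM2l ?ltr0n//.
    by rewrite ler_nat diff2_le// ltnW.
  by rewrite ler_peMr// om1.
have et := eps_t.
have c2 (x : R[i]) : cnorm (2 * x) = 2 * cnorm x.
  by rewrite -[2 in LHS]/(2%:R) -(rmorph_nat (real_complex R)) /= cnormZ ger0_norm.
have outv n : (N < n)%N -> [/\ f n = 0, w n = 0, f n.+1 = 0 & w n.+1 = 0].
  by move=> Nn; split; apply: trunc_out => //; rewrite ltnS ltnW.
exists F, W; split.
- by move=> n; rewrite /F /W; split; ring.
- move=> n; have [nN|Nn|->] := ltngtP n N.
  + rewrite /F /f /w (trunc_in _ nN) !(trunc_in _ (ltnW nN)) X_step.
    apply: (le_trans (fx_step_f u_gt0 KB B G n (src n) (X n))).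
    apply: le_trans (inN n nN).
    rewrite ler_pM2r// ler_pM2r ?ltr0n ?diff2_gt0// ler_nat//.
  + rewrite /F; have [-> -> -> _] := outv n Nn.
    by rewrite mulr0 addr0 subrr cnorm0.
  + rewrite /F {1}/f (trunc_out _ (ltnSn N)) mulr0 sub0r cnormN.
    apply: le_trans QN; apply: le_trans et.
    apply: (le_trans (cnormD _ _)); rewrite /f /w !(trunc_in _ (leqnn N)).
    apply: (le_trans (lerD fN wN)); lra.
- move=> n; have [nN|Nn|->] := ltngtP n N.
  + rewrite /W (delay_trunc (ltnW nN)) (S_in nN).
    rewrite /f /w (trunc_in _ nN) !(trunc_in _ (ltnW nN)) X_step.
    apply: le_trans (inN n nN).
    exact: (fx_step_w u_gt0 KB B G n (src n) (X n)).
  + have [fn0 wn0 _ wn1] := outv n Nn.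
    rewrite /W fn0 wn0 wn1 !mulr0 !subr0 !add0r addr0.
    case: n Nn fn0 wn0 wn1 => // n; rewrite ltnS leq_eqVlt => /predU1P[<-|Nn] _ _ _ /=.
      rewrite cnormN; apply: le_trans QN1; apply: le_trans et.
      apply: (le_trans (cnormD _ _)); rewrite cnormi cnormZ /w (trunc_in _ (leqnn N)).
      have := ler_wpM2l b0 wN; have := S_tail (leqnSn N); lra.
    rewrite S_out// /w trunc_out// !mulr0 addr0 oppr0 cnorm0; exact: (eom n.+1).
  + rewrite /W (delay_trunc (leqnn N)) {1}/w (trunc_out _ (ltnSn N)) mulr0 sub0r cnormN.
    apply: le_trans QN; apply: le_trans et.
    rewrite /f /w !(trunc_in _ (leqnn N)).
    have h1 := cnormD (b%:C * (cv u (fx_v (X N)) - 2 * cv u (fx_f (X N))))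
      (g%:C * cv u (fx_w (X N))).
    rewrite !cnormZ in h1.
    have h2 := cnormB (cv u (fx_v (X N))) (2 * cv u (fx_f (X N))).
    rewrite c2 in h2.
    have h3 : cnorm (cv u (fx_v (X N)) - 2 * cv u (fx_f (X N))) <= 6 * t.
      by apply: (le_trans h2); lra.
    have h4 := ler_wpM2l b0 h3; have h5 := ler_wpM2l g0 wN.
    apply: (le_trans (cnormD _ _)); apply: (le_trans (lerD (cnormD _ _) (S_tail (leqnn N)))).
    rewrite cnormi; move: h1 h4 h5 wN; lra.
Qed.

Hypotheses (X_sf0 : fx_sf (X 0) = zc0) (X_sp0 : fx_sp (X 0) = zc0).

Lemma sf_sum M : cv u (fx_sf (X M)) = \sum_(0 <= n < M) cv u (fx_f (X n)).
Proof.
elim: M => [|M IH]; first by rewrite big_geq// X_sf0 cv0.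
rewrite big_nat_recr//= -IH X_step -cvD; congr (cv u _).
by case: (X M).
Qed.

(** Each term of the sum of phi'(1) is rounded once; the sum of phi(1) is
    exact. *)
Lemma sp_sum M : cnorm (cv u (fx_sp (X M)) - \sum_(0 <= n < M)
    (2 * n + 1)%:R^-1%:C * (cv u (fx_f (X n)) + cv u (fx_w (X n)))) <= 2 * u *+ M.
Proof.
elim: M => [|M IH]; first by rewrite big_geq// X_sp0 cv0 subrr cnorm0.
pose q := zc_div (zcD (fx_f (X M)) (fx_w (X M))) (2 * Z.of_nat M + 1).
have spE : fx_sp (X M.+1) = zcD (fx_sp (X M)) q.
  by rewrite X_step /q; case: (X M).
rewrite big_nat_recr//= spE cvD.
set S1 := \sum_(0 <= n < M) _ in IH *.
set y := cv u (fx_f (X M)) + cv u (fx_w (X M)).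
have -> : cv u (fx_sp (X M)) + cv u q - (S1 + (2 * M + 1)%:R^-1%:C * y)
  = (cv u (fx_sp (X M)) - S1) + (cv u q - (2 * M + 1)%:R^-1%:C * y) by ring.
rewrite mulrSr; apply: (le_trans (cnormD _ _)); apply: lerD => //.
have d0 : (0 <? 2 * Z.of_nat M + 1)%Z.
  apply/Z.ltb_lt/Z.add_nonneg_pos => //.
  by apply: Z.mul_nonneg_nonneg => //; exact: Nat2Z.is_nonneg.
have := cv_div u_gt0 (zcD (fx_f (X M)) (fx_w (X M))) d0.
rewrite -/q cvD -/y.
have -> : IZR (2 * Z.of_nat M + 1) = (2 * M + 1)%:R.
  by rewrite izrD izrM izr_nat natrD natrM.
have m0 : 0 < (2 * M + 1)%:R :> R by rewrite ltr0n addn1.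
have mi : (2 * M + 1)%:R^-1%:C * (2 * M + 1)%:R%:C = 1 :> R[i].
  by rewrite -rmorphM /= mulVf ?rmorph1// gt_eqF.
move=> h.
have -> : cv u q - (2 * M + 1)%:R^-1%:C * y
    = (2 * M + 1)%:R^-1%:C * ((2 * M + 1)%:R%:C * cv u q - y).
  by rewrite mulrBr mulrA mi mul1r.
rewrite cnormZ gtr0_norm ?invr_gt0// ler_pdivrMl//.
by apply: (le_trans h); rewrite mulrAC mulrC mulrA.
Qed.

Definition fx_wall (s : fxstate) : 'cV[R]_4 := \col_i
  [tuple complex.Re (cv u (fx_sf s)); complex.Im (cv u (fx_sf s));
         complex.Re (cv u (fx_sp s)); complex.Im (cv u (fx_sp s))]`_i.

Lemma wall_trunc :
  `|wall (trunc fx_f) (trunc fx_w) - fx_wall (X N.+1)| <= 2 * u *+ N.+1.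
Proof.
have e0 : 0 <= 2 * u *+ N.+1 by apply/mulrn_wge0/mulr_ge0 => //; exact: ltW.
apply: norm_cV_le => // i; rewrite !mxE.
rewrite (@tsum_finite _ N.+1); last first.
  move=> n Nn; rewrite /wall_coef !(trunc_out _ Nn) addr0 mulr0.
  by case: i => -[|[|[|[|//]]]].
have sumRe (h : nat -> R[i]) : complex.Re (\sum_(0 <= n < N.+1) h n)
    = \sum_(0 <= n < N.+1) complex.Re (h n).
  by rewrite (big_morph _ (id1 := 0) (op1 := +%R))//; case=> a c [a' c'].
have sumIm (h : nat -> R[i]) : complex.Im (\sum_(0 <= n < N.+1) h n)
    = \sum_(0 <= n < N.+1) complex.Im (h n).
  by rewrite (big_morph _ (id1 := 0) (op1 := +%R))//; case=> a c [a' c'].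
have pE : \sum_(0 <= n < N.+1) (2 * n + 1)%:R^-1%:C
      * (cv u (fx_f (X n)) + cv u (fx_w (X n))) =
    \sum_(0 <= n < N.+1) (2 * n + 1)%:R^-1%:C
      * (trunc fx_f n + trunc fx_w n).
  by apply: eq_big_nat => n nN; rewrite !trunc_in.
have fE : \sum_(0 <= n < N.+1) cv u (fx_f (X n)) =
    \sum_(0 <= n < N.+1) trunc fx_f n.
  by apply: eq_big_nat => n nN; rewrite trunc_in.
have hp := sp_sum N.+1; rewrite pE in hp; have hf := sf_sum N.+1; rewrite fE in hf.
have ReB (x y : R[i]) : complex.Re x - complex.Re y = complex.Re (x - y).
  by case: x y => a c [a' c'].
have ImB (x y : R[i]) : complex.Im x - complex.Im y = complex.Im (x - y).
  by case: x y => a c [a' c'].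
move: hf hp; move: (cv u (fx_sf _)) (cv u (fx_sp _)) => a c hf hp.
case: i => -[|[|[|[|//]]]] /= i4; rewrite /wall_coef /=.
- by rewrite -sumRe hf subrr normr0.
- by rewrite -sumIm hf subrr normr0.
- by rewrite -sumRe distrC ReB (le_trans (normr_Re_le _)).
- by rewrite -sumIm distrC ImB (le_trans (normr_Im_le _)).
Qed.

End Truncation.

(** * Runs for the solution and its derivatives in the parameters *)

Section Runs.
Variables (KB : nat) (B G : Z).

Definition fx_init (f w : zc) : fxstate := Fx f w zc0 zc0 zc0.

Fixpoint fx_chi (one : Z) (mu : zc) n : fxstate :=
  if n is m.+1 then fx_step KB B G m zc0 (fx_chi one mu m)
  else fx_init (one, 0%Z) mu.

(** The source of the b-derivative without its factor i, which [fx_step]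
    supplies; the source of the g-derivative is w. *)
Definition src_b (x : fxstate) : zc := zcB (fx_v x) (zcZ 2 (fx_f x)).

Definition fxtangent : Type := fxstate * fxstate * fxstate * fxstate.

Definition fx_tan_step (m : nat) (y : fxtangent) : fxtangent :=
  let: (a, b, g, c) := y in
  (fx_step KB B G m zc0 a, fx_step KB B G m (src_b a) b,
   fx_step KB B G m (fx_w a) g, fx_step KB B G m zc0 c).

(** The solution and its derivatives in b, g and Re mu advance together,
    since the first one is the source of the next two. *)
Fixpoint fx_tan (one : Z) (mu : zc) n : fxtangent :=
  if n is m.+1 then fx_tan_step m (fx_tan one mu m)
  else (fx_init (one, 0%Z) mu, fx_init zc0 zc0, fx_init zc0 zc0,
        fx_init zc0 (one, 0%Z)).

Definition tail_ok (T : Z) (x : fxstate) : bool :=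
  [&& zc_le (fx_f x) T, zc_le (fx_w x) T & zc_le (fx_v x) T].

Definition tan_tail_ok (T : Z) (y : fxtangent) : bool :=
  [&& tail_ok T y.1.1.1, tail_ok T y.1.1.2, tail_ok T y.1.2 & tail_ok T y.2].

End Runs.

(** * The wall values as a map of R^4 *)

Section Rotation.
Variable R : realType.

(** Multiplication by i on both complex wall values. *)
Definition rot4 (v : 'cV[R]_4) : 'cV[R]_4 := \col_i
  [tuple - v (inord 1) 0; v (inord 0) 0; - v (inord 3) 0; v (inord 2) 0]`_i.

Lemma rot4_le v w : `|rot4 v - rot4 w| <= `|v - w|.
Proof.
have h (i : 'I_4) : `|v i 0 - w i 0| <= `|v - w|.
  by have := normr_coord_le (v - w) i; rewrite !mxE.
apply: norm_cV_le => // i; rewrite !mxE.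
by case: i => -[|[|[|[|//]]]] /= _; rewrite ?opprK ?[- _ + _]addrC //
  distrC.
Qed.

Lemma wall_ii (theta L s W : R) (M : R) (f w : nat -> R[i]) : 0 < theta -> theta < 1 ->
  s <= 1 -> (forall n, majorant theta L n <= W * theta ^+ n) ->
  om_bounded theta L s M f w ->
  wall (fun n => ii * f n) (fun n => ii * w n) = rot4 (wall f w).
Proof.
move=> th0 th1 s1 hW h; apply/colP => i; rewrite !mxE.
have tsumN u : geo_bounded theta u -> tsum (fun n => - u n) = - tsum u.
  move=> hu; rewrite -mulN1r -(tsumZ th0 th1 (-1) hu).
  by congr tsum; apply/funext => n; rewrite mulN1r.
have hg j := @wall_geo _ theta L s W th0 s1 hW M f w j h.
case: i => -[|[|[|[|//]]]] i4 /=.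
- rewrite -tsumN//; congr tsum; apply/funext => n.
  rewrite /wall_coef /= inordK//=; case: (f n) => a c /=; ring.
- congr tsum; apply/funext => n.
  rewrite /wall_coef /= inordK//=; case: (f n) => a c /=; ring.
- rewrite -tsumN//; congr tsum; apply/funext => n.
  rewrite /wall_coef /= inordK//=; case: (f n) (w n) => a c [a' c'] /=; ring.
- congr tsum; apply/funext => n.
  rewrite /wall_coef /= inordK//=; case: (f n) (w n) => a c [a' c'] /=; ring.
Qed.

Definition param_mu (z : 'cV[R]_4) : R[i] := z (inord 2) 0 +i* z (inord 3) 0.

(** The coordinates are b, g, Re mu and Im mu; the normalization phi(0) = 1
    makes phi nonzero. *)
Definition wall_map (z : 'cV[R]_4) : 'cV[R]_4 :=
  wall (os_f (z (inord 0) 0) (z (inord 1) 0) 1 (param_mu z))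
       (os_w (z (inord 0) 0) (z (inord 1) 0) 1 (param_mu z)).

Definition cols4 (a b c d : 'cV[R]_4) : 'M[R]_4 :=
  \matrix_(i, j) [tuple a i 0; b i 0; c i 0; d i 0]`_j.

Lemma cols4E a b c d i j :
  cols4 a b c d i j = [tuple a i 0; b i 0; c i 0; d i 0]`_j.
Proof. by rewrite mxE. Qed.

Lemma big_ord4 (V : zmodType) (F : 'I_4 -> V) : \sum_j F j
  = F (inord 0) + F (inord 1) + F (inord 2) + F (inord 3).
Proof.
rewrite !big_ord_recl big_ord0 addr0 !addrA.
by do ![congr (_ + _)]; congr F; apply: val_inj; rewrite /= inordK.
Qed.

Lemma cols4_mul a b c d (h : 'cV[R]_4) : cols4 a b c d *m h =
  h (inord 0) 0 *: a + h (inord 1) 0 *: b + h (inord 2) 0 *: c + h (inord 3) 0 *: d.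
Proof.
apply/colP => i; rewrite mxE big_ord4 !mxE !inordK//=; ring.
Qed.

End Rotation.

(** * Accuracy of the runs *)

Section RunBounds.
Local Notation R := Rdefinitions.R.
Variables theta L s W : R.
Hypotheses (theta_gt0 : 0 < theta) (theta_lt1 : theta < 1).
Hypotheses (s_ge0 : 0 <= s) (s_le1 : s <= 1) (sL : s + 2 <= s * L).
Hypothesis tsL : theta^-1 + 2 * s <= 2.
Hypothesis s50 : 1 <= s * 50.
Local Notation om := (majorant theta L).
Hypothesis omW : forall n, om n <= W * theta ^+ n.
Variables (KB : nat) (B G : Z) (mu0 : R[i]) (r : R).
Local Notation b0 := (IZR B / 2 ^+ KB).
Local Notation g0 := (IZR G / 2 ^+ KB).
Hypothesis r_ge0 : 0 <= r.
Hypothesis mu0_le : cnorm mu0 <= 49.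
Hypothesis ball_le : forall b g : R, `|b - b0| <= r -> `|g - g0| <= r ->
  2 + `|g| + 2 * s * `|b| + `|b| / theta <= L.
Variables (u : R) (one : Z) (mu : zc) (N : nat) (T : Z) (Q eps : R).
Hypotheses (u_gt0 : 0 < u) (one_u : IZR one * u = 1) (mu_u : cv u mu = mu0).
Hypothesis om1 : forall n, (n < N)%N -> 1 <= om n.
Hypothesis omQ : Q <= om N /\ Q <= om N.+1.
Hypothesis eps_u : 4 * (diff2 N)%:R * u <= eps.
Hypothesis eps_t : (8 + 6 * `|b0| + 2 * `|g0|) * (IZR T * u) <= eps * Q.
Hypothesis eps_le1 : eps <= 1.
Hypothesis T_ge0 : (0 <=? T)%Z.

Let t_ge0 : 0 <= IZR T * u.
Proof. by apply: mulr_ge0; [exact: (izr_le T_ge0)|exact: ltW]. Qed.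

Let eps_ge0 : 0 <= eps.
Proof. exact: (trunc_eps_ge0 u_gt0 eps_u). Qed.

Let cv_one : cv u (one, 0%Z) = 1.
Proof. by rewrite /cv /= one_u mul0r. Qed.

Let trunc0 (X : nat -> fxstate) h : trunc u X N h 0 = cv u (h (X 0)).
Proof. by rewrite trunc_in. Qed.

Lemma free_mode (X : nat -> fxstate) :
  (forall n, X n.+1 = fx_step KB B G n zc0 (X n)) -> fx_v (X 0) = zc0 ->
  tail_ok T (X N) ->
  exists F S : nat -> R[i],
    [/\ os_mode b0 g0 F S (trunc u X N fx_f) (trunc u X N fx_w),
        forall n, cnorm (F n) <= eps * om n & forall n, cnorm (S n) <= eps * om n].
Proof.
move=> Xs Xv /and3P[fT wT vT].
have S_in n : (n < N)%N -> 0 = ii * cv u zc0 :> R[i] by rewrite cv0 mulr0.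
have S_tail n : (N <= n)%N -> cnorm (0 : R[i]) <= 6 * (IZR T * u).
  by rewrite cnorm0 => _; apply: mulr_ge0.
have [F [S [h hF hS]]] := trunc_mode u_gt0 theta_gt0 Xs Xv fT wT vT om1 omQ
  S_in S_tail (fun=> fun=> erefl) eps_u eps_t.
exists F, S; split=> // n; have [-> ->] := h n; split=> //.
by rewrite add0r.
Qed.

Section Chi.
Local Notation X := (fx_chi KB B G one mu).
Hypothesis tailX : tail_ok T (X N).

Lemma chi_run_close : `|wall (os_f b0 g0 1 mu0) (os_w b0 g0 1 mu0) - fx_wall u (X N.+1)|
  <= 2 * eps * (W / (1 - theta)) + 2 * u *+ N.+1.
Proof.
have [F [S [h hF hS]]] := @free_mode X (fun=> erefl) erefl tailX.
have ball0 b g : `|b - b0| <= 0 -> `|g - g0| <= 0 ->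
    2 + `|g| + 2 * s * `|b| + `|b| / theta <= L.
  by move=> hb hg; apply: ball_le; apply: le_trans r_ge0.
have := wall_close theta_gt0 theta_lt1 s_ge0 s_le1 sL tsL omW (lexx 0) eps_ge0 eps_le1
  s50 mu0_le ball0 h.
rewrite !trunc0 /= cv_one mu_u subrr cnorm0 mulr0 add0r.
move=> /(_ erefl eps_ge0 hF hS) h1.
have h2 := wall_trunc u_gt0 N (fun n => erefl (X n.+1)) erefl erefl.
by rewrite -(subrKA (wall (trunc u X N fx_f) (trunc u X N fx_w)))
  (le_trans (ler_normD _ _))// lerD.
Qed.

End Chi.

Section Tangent.
Local Notation Y := (fx_tan KB B G one mu).
Let Ya n := (Y n).1.1.1.
Let Yb n := (Y n).1.1.2.
Let Yg n := (Y n).1.2.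
Let Yc n := (Y n).2.
Hypothesis tailY : tan_tail_ok T (Y N).
Hypothesis r_le : r <= 1000^-1.

Let Ya_step n : Ya n.+1 = fx_step KB B G n zc0 (Ya n).
Proof. by rewrite /Ya /=; case: (fx_tan _ _ _ _ _ n) => -[[a b] g] c. Qed.
Let Yb_step n : Yb n.+1 = fx_step KB B G n (src_b (Ya n)) (Yb n).
Proof. by rewrite /Yb /Ya /=; case: (fx_tan _ _ _ _ _ n) => -[[a b] g] c. Qed.
Let Yg_step n : Yg n.+1 = fx_step KB B G n (fx_w (Ya n)) (Yg n).
Proof. by rewrite /Yg /Ya /=; case: (fx_tan _ _ _ _ _ n) => -[[a b] g] c. Qed.
Let Yc_step n : Yc n.+1 = fx_step KB B G n zc0 (Yc n).
Proof. by rewrite /Yc /=; case: (fx_tan _ _ _ _ _ n) => -[[a b] g] c. Qed.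

Local Notation fa := (trunc u Ya N fx_f).
Local Notation wa := (trunc u Ya N fx_w).

Let c2 (x : R[i]) : cnorm (2 * x) = 2 * cnorm x.
Proof.
by rewrite -[2 in LHS]/(2%:R) -(rmorph_nat (real_complex R)) /= cnormZ ger0_norm.
Qed.

Lemma tan_mode_b : exists F S : nat -> R[i],
  [/\ os_mode b0 g0 F (fun n => dbeta fa wa n + S n)
        (trunc u Yb N fx_f) (trunc u Yb N fx_w),
      forall n, cnorm (F n) <= eps * om n & forall n, cnorm (S n) <= eps * om n].
Proof.
have /and4P[/and3P[fT wT vT] /and3P[fTb wTb vTb] _ _] := tailY.
have fN := cnorm_cv u_gt0 fT; have wN := cnorm_cv u_gt0 wT.
have vN := cnorm_cv u_gt0 vT.
apply: (trunc_mode u_gt0 theta_gt0 Yb_step _ fTb wTb vTb om1 omQ _ _ _ eps_u eps_t).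
- by [].
- move=> n nN; rewrite /dbeta (delay_trunc u Ya_step _ (ltnW nN))//.
  have e2 : (IZR 2)%:C = 2 :> R[i] by exact: (rmorph_nat (real_complex R) 2).
  by rewrite (trunc_in _ _ _ (ltnW nN)) /src_b cvB cvZ e2.
- move=> n; rewrite leq_eqVlt /dbeta cnormi => /predU1P[<-|].
    rewrite (delay_trunc u Ya_step _ (leqnn N))// (trunc_in _ _ _ (leqnn N)).
    by apply: (le_trans (cnormB _ _)); rewrite c2; move: fN vN; rewrite /Ya; lra.
  case: n => // n; rewrite ltnS => nN; rewrite (trunc_out _ _ _ (nN : (N < n.+1)%N)).
  rewrite mulr0 subr0 /=; move: nN; rewrite leq_eqVlt => /predU1P[<-|nN].
    by rewrite (trunc_in _ _ _ (leqnn N)); apply: (le_trans wN); have := t_ge0; lra.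
  by rewrite (trunc_out _ _ _ nN) cnorm0; apply: mulr_ge0.
- case=> // n; rewrite ltnS => nN; rewrite /dbeta /= (trunc_out _ _ _ nN).
  by rewrite (trunc_out _ _ _ (ltnW nN : (N < n.+1)%N)) mulr0 subr0 mulr0.
Qed.

Lemma tan_mode_g : exists F S : nat -> R[i],
  [/\ os_mode b0 g0 F (fun n => dgamma wa n + S n)
        (trunc u Yg N fx_f) (trunc u Yg N fx_w),
      forall n, cnorm (F n) <= eps * om n & forall n, cnorm (S n) <= eps * om n].
Proof.
have /and4P[/and3P[fT wT vT] _ /and3P[fTb wTb vTb] _] := tailY.
have wN := cnorm_cv u_gt0 wT.
apply: (trunc_mode u_gt0 theta_gt0 Yg_step _ fTb wTb vTb om1 omQ _ _ _ eps_u eps_t).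
- by [].
- by move=> n nN; rewrite /dgamma (trunc_in _ _ _ (ltnW nN)).
- move=> n; rewrite leq_eqVlt /dgamma cnormi => /predU1P[<-|nN].
    rewrite (trunc_in _ _ _ (leqnn N)); apply: (le_trans wN).
    by have := t_ge0; lra.
  by rewrite (trunc_out _ _ _ nN) cnorm0; apply: mulr_ge0.
- move=> n nN; rewrite /dgamma (trunc_out _ _ _ _) ?mulr0//.
  exact: ltn_trans nN.
Qed.

(** Columns: derivatives in b, g, Re mu, Im mu; the last one is obtained by
    rotation. *)
Definition tan_mx (y : fxtangent) : 'M[R]_4 :=
  let: (a, b, g, c) := y in
  cols4 (fx_wall u b) (fx_wall u g) (fx_wall u c) (rot4 (fx_wall u c)).

Local Notation Om := (W / (1 - theta)).

(** J has the wall values of the truncated tangent runs as columns; the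
    matrix that is actually computed differs from it by the rounding of the
    sums. *)
Lemma tan_run_expansion (z0 : 'cV[R]_4) : z0 (inord 0) 0 = b0 -> z0 (inord 1) 0 = g0 ->
  param_mu z0 = mu0 ->
  exists2 J : 'M[R]_4,
    forall i j, `|J i j - tan_mx (Y N.+1) i j| <= 2 * u *+ N.+1 &
    forall z z', `|z - z0| <= r -> `|z' - z0| <= r ->
      `|wall_map z - wall_map z' - J *m (z - z')|
        <= 2 * (2000 * r + 7 * eps) * Om * `|z - z'|.
Proof.
move=> z00 z01 z0m.
have /and4P[tA tB tG tC] := tailY.
have [Fa [Sa [ha hFa hSa]]] := free_mode Ya_step erefl tA.
have [Fb [Sb [hb hFb hSb]]] := tan_mode_b.
have [Fg [Sg [hg hFg hSg]]] := tan_mode_g.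
have [Fc [Sc [hc hFc hSc]]] := free_mode Yc_step erefl tC.
have fa0 : trunc u Ya N fx_f 0 = 1 by rewrite trunc0.
have wa0 : cnorm (trunc u Ya N fx_w 0 - mu0) <= eps.
  by rewrite trunc0 /= mu_u subrr cnorm0.
have z0E (h : fxstate -> zc) X : h (X 0) = zc0 -> trunc u X N h 0 = 0.
  by rewrite trunc0 => ->; rewrite cv0.
have wc0 : trunc u Yc N fx_w 0 = 1 by rewrite trunc0.
have ex := wall_expansion theta_gt0 theta_lt1 s_ge0 s_le1 sL tsL omW r_ge0 eps_ge0
  eps_le1 s50 mu0_le ball_le ha fa0 wa0 hFa hSa hb hg hc
  (z0E fx_f Yb erefl) (z0E fx_w Yb erefl) (z0E fx_f Yg erefl) (z0E fx_w Yg erefl)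
  (z0E fx_f Yc erefl) wc0.
have bdc := tangent_mu_bounded theta_gt0 s_ge0 sL r_ge0 eps_le1 ball_le hc
  (z0E fx_f Yc erefl) wc0 (fun n => And3 (hFb n) (hFg n) (hFc n))
  (fun n => And3 (hSb n) (hSg n) (hSc n)).
have {}ex := ex (fun n => And3 (hFb n) (hFg n) (hFc n))
  (fun n => And3 (hSb n) (hSg n) (hSc n)).
exists (cols4 (wall (trunc u Yb N fx_f) (trunc u Yb N fx_w))
  (wall (trunc u Yg N fx_f) (trunc u Yg N fx_w))
  (wall (trunc u Yc N fx_f) (trunc u Yc N fx_w))
  (rot4 (wall (trunc u Yc N fx_f) (trunc u Yc N fx_w)))).
  have YE : Y N.+1 = (Ya N.+1, Yb N.+1, Yg N.+1, Yc N.+1).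
    by rewrite /Ya /Yb /Yg /Yc; case: (Y N.+1) => -[[a b] g] c.
  have hb' := wall_trunc u_gt0 N Yb_step erefl erefl.
  have hg' := wall_trunc u_gt0 N Yg_step erefl erefl.
  have hc' := wall_trunc u_gt0 N Yc_step erefl erefl.
  have co (v w : 'cV[R]_4) (e : R) i : `|v - w| <= e -> `|v i 0 - w i 0| <= e.
    by move=> h; apply: le_trans h; have := normr_coord_le (v - w) i; rewrite !mxE.
  move=> i j; rewrite YE /tan_mx !cols4E.
  case: j => -[|[|[|[|//]]]] j4; rewrite [nat_of_ord _]/= ![_`_ _]/=; apply: (co) => //.
  exact: (le_trans (rot4_le _ _) hc').
move=> z z' hz hz'.
have co (v : 'cV[R]_4) (k : nat) (e : R) : `|v - z0| <= e ->
    `|v (inord k) 0 - z0 (inord k) 0| <= e.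
  by move=> h; apply: le_trans h; have := normr_coord_le (v - z0) (inord k); rewrite !mxE.
have mur v : `|v - z0| <= r -> cnorm (param_mu v - mu0) <= 2 * r.
  move=> hv; rewrite -z0m /cnorm /param_mu /= mulr2n mulrDl mul1r.
  by apply: lerD; exact: co.
have mu50 v : `|v - z0| <= r -> cnorm (param_mu v) <= 50.
  move=> /mur h; have -> : param_mu v = (param_mu v - mu0) + mu0 by rewrite subrK.
  apply: (le_trans (cnormD _ _)); apply: (le_trans (lerD h mu0_le)).
  by have := r_le; lra.
have zz (k : nat) : `|z (inord k) 0 - z' (inord k) 0| <= `|z - z'|.
  by have := normr_coord_le (z - z') (inord k); rewrite !mxE.
have cb v : `|v - z0| <= r -> `|v (inord 0) 0 - b0| <= r by move/(co _ 0); rewrite z00.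
have cg v : `|v - z0| <= r -> `|v (inord 1) 0 - g0| <= r by move/(co _ 1); rewrite z01.
have := ex _ _ _ _ _ _ _ (cb z hz) (cg z hz) (mu50 z hz) (cb z' hz') (cg z' hz')
  (mur z' hz') (mu50 z' hz') (zz 0) (zz 1) (zz 2) (zz 3).
rewrite (wall_ii theta_gt0 theta_lt1 s_le1 omW bdc) cols4_mul.
by rewrite !mxE; apply.
Qed.

End Tangent.
End RunBounds.

(** * Tests on integers *)

Section Inverse.
Variable R : realType.

Lemma approx_inverse (A J Jh : 'M[R]_4) (kappa beta delta : R) : 0 <= delta ->
  (forall i, \sum_j `|(1%:M - A *m Jh) i j| <= kappa) ->
  (forall i, \sum_j `|A i j| <= beta) ->
  (forall i j, `|J i j - Jh i j| <= delta) ->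
  forall i, \sum_j `|(1%:M - A *m J) i j| <= kappa + 4 * beta * delta.
Proof.
move=> d0 hk hb hd i.
have E : 1%:M - A *m J = (1%:M - A *m Jh) - A *m (J - Jh).
  by rewrite mulmxBr opprB addrA subrK.
have h j : `|(1%:M - A *m J) i j| <= `|(1%:M - A *m Jh) i j| + beta * delta.
  rewrite E; set P := 1%:M - A *m Jh.
  have -> : (P - A *m (J - Jh)) i j = P i j - \sum_k A i k * (J - Jh) k j.
    by rewrite !mxE.
  apply: (le_trans (ler_normB _ _)); rewrite lerD2l.
  apply: (le_trans (ler_norm_sum _ _ _)).
  apply: (@le_trans _ _ (\sum_k `|A i k| * delta)).
    apply: ler_sum => k _; rewrite normrM; apply: ler_wpM2l => //.
    by have := hd k j; rewrite !mxE.
  by rewrite -mulr_suml; apply: ler_wpM2r.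
apply: (@le_trans _ _ (\sum_j (`|(1%:M - A *m Jh) i j| + beta * delta))).
  by apply: ler_sum => j _; exact: h.
rewrite big_split /= sumr_const card_ord -[_ *+ 4]mulr_natl mulrA.
by apply: lerD.
Qed.

End Inverse.

Section NumericCheck.
Local Open Scope Z_scope.

Definition zwall (s : fxstate) (i : nat) : Z :=
  nth 0 [:: (fx_sf s).1; (fx_sf s).2; (fx_sp s).1; (fx_sp s).2] i.

(** The rotation of the last column is written out on integers. *)
Definition ztan (y : fxtangent) (i j : nat) : Z :=
  let: (a, b, g, c) := y in
  nth 0 [:: zwall b i; zwall g i; zwall c i;
     nth 0 [:: - zwall c 1; zwall c 0; - zwall c 3; zwall c 2] i] j.

Definition zsum4 (F : nat -> Z) : Z := F 0%nat + F 1%nat + F 2%nat + F 3%nat.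

Definition zall4 (P : nat -> bool) : bool := [&& P 0%nat, P 1%nat, P 2%nat & P 3%nat].

Variable A : nat -> nat -> Z.

Definition rowsum_ok (c : Z) : bool :=
  zall4 (fun i => zsum4 (fun j => Z.abs (A i j)) <=? c).

Definition inverse_ok (unit c : Z) (y : fxtangent) : bool :=
  zall4 (fun i => zsum4 (fun j => Z.abs ((if (i == j)%nat then unit else 0) -
    zsum4 (fun k => A i k * ztan y k j))) <=? c).

Definition defect_ok (c : Z) (x : fxstate) : bool :=
  zall4 (fun i => Z.abs (zsum4 (fun k => A i k * zwall x k)) <=? c).

End NumericCheck.

Section NumericCheckSound.
Local Notation R := Rdefinitions.R.
Implicit Types (u v : R).

Lemma izr_abs (a : Z) : IZR (Z.abs a) = `|IZR a|.
Proof. by rewrite -Rbasic_fun.Rabs_Zabs RabsE. Qed.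

Lemma izr_sum4 (F : nat -> Z) : IZR (zsum4 F) = \sum_(i < 4) IZR (F i).
Proof. by rewrite big_ord4 !inordK// /zsum4 !izrD. Qed.

Lemma zall4P P : zall4 P -> forall i : 'I_4, P i.
Proof. by move=> /and4P[? ? ? ?] [[|[|[|[|//]]]]]. Qed.

Lemma fx_wallE u x i : fx_wall u x i 0 = IZR (zwall x i) * u.
Proof. by rewrite mxE; case: i => -[|[|[|[|//]]]]. Qed.

Lemma tan_mxE u y i j : tan_mx u y i j = IZR (ztan y i j) * u.
Proof.
case: y => -[[a b] g] c; rewrite /tan_mx cols4E /ztan.
case: j => -[|[|[|[|//]]]] j4; rewrite ?fx_wallE//.
rewrite -[LHS]/(rot4 (fx_wall u c) i 0) mxE.
by case: i => -[|[|[|[|//]]]] i4; rewrite [LHS]/= ?fx_wallE !inordK// ?izrN ?mulNr.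
Qed.

Variable A : nat -> nat -> Z.
Definition izr_mx v : 'M[R]_4 := \matrix_(i, j) (IZR (A i j) * v).

Lemma rowsum_okP v c : 0 <= v -> rowsum_ok A c ->
  forall i, \sum_j `|izr_mx v i j| <= IZR c * v.
Proof.
move=> v0 /zall4P h i; have := izr_le (h i); rewrite izr_sum4 => hi.
apply: le_trans (ler_wpM2r v0 hi); rewrite mulr_suml; apply: ler_sum => j _.
by rewrite izr_abs mxE normrM (ger0_norm v0).
Qed.

Lemma inverse_okP u v (unit c : Z) y : 0 <= u * v -> IZR unit * (u * v) = 1 ->
  inverse_ok A unit c y ->
  forall i, \sum_j `|(1%:M - izr_mx v *m tan_mx u y) i j| <= IZR c * (u * v).
Proof.
move=> uv0 unit1 /zall4P h i; have := izr_le (h i); rewrite izr_sum4 => hi.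
apply: le_trans (ler_wpM2r uv0 hi); rewrite mulr_suml; apply: ler_sum => j _.
rewrite izr_abs -[X in _ * X](ger0_norm uv0) -normrM izrB mulrBl izr_sum4.
rewrite !mxE.
have -> : IZR (if (i == j :> nat)%N then unit else 0%Z) * (u * v) = (i == j)%:R.
  have [ij|ij] := eqVneq i j; first by rewrite ij eqxx unit1.
  by rewrite (_ : (i == j :> nat)%N = false) ?mul0r//; apply/negbTE.
rewrite le_eqVlt; apply/predU1P; left; congr (`|_ - _|); rewrite mulr_suml; apply: eq_bigr => k _.
by rewrite izrM tan_mxE mxE; ring.
Qed.

Lemma defect_okP u v c x : 0 <= u * v -> defect_ok A c x ->
  `|izr_mx v *m fx_wall u x| <= IZR c * (u * v).
Proof.
move=> uv0 /zall4P h.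
have hi i : `|(izr_mx v *m fx_wall u x) i 0| <= IZR c * (u * v).
  have := izr_le (h i); rewrite izr_abs izr_sum4 => /(ler_wpM2r uv0).
  apply: le_trans.
  rewrite -[X in _ <= _ * X](ger0_norm uv0) -normrM mxE mulr_suml.
  rewrite le_eqVlt; apply/predU1P; left; congr (`|_|); apply: eq_bigr => k _.
  by rewrite izrM fx_wallE mxE; ring.
apply: norm_cV_le => //; exact: le_trans (normr_ge0 _) (hi 0).
Qed.

End NumericCheckSound.

(** * Numerical data and their verification *)

Section Certificate.
Local Open Scope Z_scope.

(** The four numbers below divided by 2^210 are an approximate zero of
    [wall_map], found by Newton iteration in multiple precision: b =
    -5814.83, g = 4295.81, Re mu = -2.71, and Im mu = -1.9e-8 (rounded). *)
Definition param_bits : nat := 210%nat.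
Definition beta0 : Z := -9568327219872027525672367335500695448092265802761323423685156640826.
Definition gamma0 : Z := 7068766869079593566810911706323209616865769488271901516976486527811.
Definition mu_re0 : Z := -4454727989063340353745547777264316026533572180766789766249398977.
Definition mu_im0 : Z := -31268003689661132827096894401208029419445070002370077210.

(** An approximate inverse of the Jacobian of [wall_map] at that point,
    scaled by 2^50. *)
Definition newton_entries : seq (seq Z) :=
  [:: [:: -80197955537815821171; -229549196743841103691;
          10728165004590472286; 12742356419407440990];
      [:: 65295417448601078412; 179134460387118687671;
          -8545556295636744408; -9877757381971302186];
      [:: 3811261480362660; 6018910905300911;
          -390678387350081; -292481415163726];
      [:: 946054788; 2502084704; -121540031; -137139565]].

Definition newton_mx (i j : nat) : Z := nth 0 (nth [::] newton_entries i) j.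

(** Coefficients at the cut, in units of the last place; the weight is at
    least 10^34 there. *)
Definition tail_bound : Z := 10 ^ 35.

(** The Jacobian in units of 2^-210 times the inverse in units of 2^-50 is
    within 2^-7 of the identity. *)
Definition tan_check (N : nat) : bool :=
  let y := fx_tan param_bits beta0 gamma0 (2 ^ 210) (mu_re0, mu_im0) N in
  tan_tail_ok tail_bound y &&
  inverse_ok newton_mx (2 ^ 260) (2 ^ 253) (fx_tan_step param_bits beta0 gamma0 N y).

(** The residual in units of 2^-400 times the inverse in units of 2^-50 is
    below 2^-205. More digits than in [tan_check] are needed because the
    error of the residual, after the factors 2^160 of the weighted bound and
    2^19 of the inverse, has to be small against the radius 2^-195 of the
    ball. *)
Definition chi_check (N : nat) : bool :=
  let x := fx_chi param_bits beta0 gamma0 (2 ^ 400) (mu_re0 * 2 ^ 190, mu_im0 * 2 ^ 190) N in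
  tail_ok tail_bound x &&
  defect_ok newton_mx (2 ^ 245) (fx_step param_bits beta0 gamma0 N zc0 x).

Definition rowsum_check : bool := rowsum_ok newton_mx (2 ^ 69).

End Certificate.

Lemma tan_check_true : tan_check 192.
Proof. by vm_cast_no_check (erefl true). Qed.

Lemma chi_check_true : chi_check 250.
Proof. by vm_cast_no_check (erefl true). Qed.

Lemma rowsum_check_true : rowsum_check.
Proof. by vm_cast_no_check (erefl true). Qed.

Local Notation chi_run := (fx_chi param_bits beta0 gamma0 (2 ^ 400)
  (mu_re0 * 2 ^ 190, mu_im0 * 2 ^ 190)%Z).
Local Notation tan_run := (fx_tan param_bits beta0 gamma0 (2 ^ 210) (mu_re0, mu_im0)).

(** Stated for a variable N, which keeps the two runs folded in the
    statements that follow. *)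
Lemma chi_checkP N : chi_check N -> tail_ok tail_bound (chi_run N) /\
  defect_ok newton_mx (2 ^ 245) (chi_run N.+1).
Proof. by move/andP. Qed.

Lemma tan_checkP N : tan_check N -> tan_tail_ok tail_bound (tan_run N) /\
  inverse_ok newton_mx (2 ^ 260) (2 ^ 253) (tan_run N.+1).
Proof. by move/andP. Qed.

(** * Existence of neutral parameters *)

Section NeutralParameters.
Local Notation R := Rdefinitions.R.

(** The factorial (2m)! as a binary integer. *)
Fixpoint zprod_diff2 (m : nat) : Z :=
  if m is k.+1 then (zprod_diff2 k * ((2 * Z.of_nat k + 1) * (2 * Z.of_nat k + 2)))%Z
  else 1%Z.

Lemma zprod_diff2E m : IZR (zprod_diff2 m) = ((2 * m)`!)%:R.
Proof.
rewrite -prod_diff2; elim: m => [|m IH]; first by rewrite big_ord0.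
by rewrite big_ord_recr /= izrM IH izr_diff2 natrM.
Qed.

(* With these constants 2 + |g| + 2 s |b| + |b| / theta is just below 11000,
   and 55 is the first n with L <= theta * diff2 n. *)
Let theta : R := 9 / 10.
Let L : R := IZR 11000.
Let s : R := 50^-1.
Local Notation om := (majorant theta L).

Let L_num : L = 11 * 1000.
Proof.
by rewrite /L -[11000%Z]/(11 * (10 * (10 * 10)))%Z !izrM !(izr_nat 11) !(izr_nat 10); lra.
Qed.

Let theta_gt0 : 0 < theta. Proof. by rewrite /theta; lra. Qed.
Let theta_lt1 : theta < 1. Proof. by rewrite /theta; lra. Qed.
Let s_ge0 : 0 <= s. Proof. by rewrite /s; lra. Qed.
Let s_le1 : s <= 1. Proof. by rewrite /s; lra. Qed.
Let sL : s + 2 <= s * L. Proof. by rewrite /s L_num; lra. Qed.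
Let tsL : theta^-1 + 2 * s <= 2. Proof. by rewrite /s /theta; lra. Qed.
Let s50 : 1 <= s * 50. Proof. by rewrite /s; lra. Qed.
Let L_gt0 : 0 < L. Proof. by rewrite L_num; lra. Qed.

Let W : R := (L / theta) ^+ 55 / ((2 * 55)`!)%:R.

Lemma diff2_51 : (diff2 51)%:R <= L.
Proof. by rewrite -izr_diff2; apply: izr_le. Qed.

Lemma diff2_54 : theta * (diff2 54)%:R <= L.
Proof.
have h : IZR 9 * (diff2 54)%:R <= IZR 10 * L.
  by rewrite -izr_diff2 -!izrM; apply: izr_le.
by move: h; rewrite (izr_nat 9) (izr_nat 10) /theta; lra.
Qed.

Lemma diff2_55 : L <= theta * (diff2 55)%:R.
Proof.
have h : IZR 10 * L <= IZR 9 * (diff2 55)%:R.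
  by rewrite -izr_diff2 -!izrM; apply: izr_le.
by move: h; rewrite (izr_nat 9) (izr_nat 10) /theta; lra.
Qed.

Lemma om_le_geo n : om n <= W * theta ^+ n.
Proof.
apply: majorant_le => // j hj.
  apply: le_trans diff2_55 _; rewrite ler_pM2l// ler_nat; exact: diff2_le.
apply: le_trans _ diff2_54; rewrite ler_pM2l// ler_nat; exact: diff2_le.
Qed.

Let Q : R := IZR (10 ^ 34).

(** The weight peaks near n = 52, at L^52 / 104! or more, and then decreases
    by at most 9/10 per step. *)
Lemma om_ge_Q n : (52 <= n <= 252)%N -> Q <= om n.
Proof.
move=> /andP[h1 h2]; rewrite -(subnKC h1).
apply: le_trans (majorantD L theta_gt0 52 (n - 52)).
have hk : theta ^+ 200 <= theta ^+ (n - 52).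
  by apply: ler_wiXn2l; rewrite ?ltW// leq_subLR.
have hP := majorant_ge theta L_gt0 52.
have m0 := majorant_gt0 L theta_gt0 52.
apply: (le_trans _ (ler_wpM2r (ltW m0) hk)).
apply: (le_trans _ (ler_wpM2l _ hP)); last by rewrite exprn_ge0// ltW.
rewrite -zprod_diff2E /theta expr_div_n.
rewrite -[9]/(9%:R) -[10]/(10%:R) -(izr_nat 9) -(izr_nat 10) -!izrX.
have p1 : 0 < IZR (10 ^ 200) by apply: izr_lt.
have p2 : 0 < IZR (zprod_diff2 52) by apply: izr_lt.
rewrite mulrAC mulrA ler_pdivlMr// ler_pdivlMr// -!izrM.
by apply: izr_le; vm_cast_no_check (erefl true).
Qed.

Lemma om_ge1 n : (n <= 252)%N -> 1 <= om n.
Proof.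
move=> h; have [h1|h1] := ltnP n 52.
  apply: majorant_ge1 => j hj; apply: (le_trans _ diff2_51).
  by rewrite ler_nat; apply: diff2_le; rewrite -ltnS (ltn_trans hj).
apply: le_trans (om_ge_Q _); last by rewrite h1.
by rewrite /Q -izr1; apply: izr_le.
Qed.

Local Notation Om := (W / (1 - theta)).

Lemma frac_le (x y f z t : R) : 0 < y -> 0 < f -> x * t <= z * y * f ->
  x / y / f * t <= z.
Proof.
move=> y0 f0 h; rewrite mulrAC ler_pdivrMr// mulrAC ler_pdivrMr//.
by rewrite mulrAC.
Qed.

Lemma izrX2 n : 2 ^+ n = IZR (2 ^ Z.of_nat n).
Proof. by rewrite izrX. Qed.

(** The constant by which the weighted bound exceeds the sources, after
    summation over n. *)
Lemma Om_le : Om <= 2 ^+ 160.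
Proof.
have -> : 1 - theta = 10^-1 by rewrite /theta; lra.
have LT : L / theta = IZR 110000 / IZR 9.
  rewrite /L /theta invf_div -[110000%Z]/(11000 * 10)%Z izrM (izr_nat 9) (izr_nat 10).
  by rewrite mulrA.
rewrite invrK /W -zprod_diff2E LT expr_div_n -!izrX izrX2 -(izr_nat 10).
apply: frac_le.
- by apply: izr_lt.
- by apply: izr_lt; vm_cast_no_check (erefl true).
- by rewrite -!izrM; apply: izr_le; vm_cast_no_check (erefl true).
Qed.

Local Notation b0 := (IZR beta0 / 2 ^+ param_bits).
Local Notation g0 := (IZR gamma0 / 2 ^+ param_bits).

Lemma param_le (a c : Z) : (c * 2 ^ 210 <=? a)%Z -> IZR c <= IZR a / 2 ^+ param_bits.
Proof.
move=> h; rewrite ler_pdivlMr ?exprn_gt0// izrX2 -izrM; exact: izr_le.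
Qed.

Lemma param_ge (a c : Z) : (a <=? c * 2 ^ 210)%Z -> IZR a / 2 ^+ param_bits <= IZR c.
Proof.
move=> h; rewrite ler_pdivrMr ?exprn_gt0// izrX2 -izrM; exact: izr_le.
Qed.

Lemma b0_bounds : - (5 * 1000 + 815) <= b0 <= - (5 * 1000 + 814).
Proof.
have e1 : IZR 5815 = 5 * 1000 + 815.
  by rewrite -[IZR _]/(IZR (5 * 1000 + 815)) izrD izrM (izr_nat 5) (izr_nat 1000) (izr_nat 815).
have e2 : IZR 5814 = 5 * 1000 + 814.
  by rewrite -[IZR _]/(IZR (5 * 1000 + 814)) izrD izrM (izr_nat 5) (izr_nat 1000) (izr_nat 814).
rewrite -e1 -e2 -!izrN; apply/andP; split.
  by apply: param_le; vm_cast_no_check (erefl true).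
by apply: param_ge; vm_cast_no_check (erefl true).
Qed.

Lemma g0_bounds : 4 * 1000 + 295 <= g0 <= 4 * 1000 + 296.
Proof.
have e1 : IZR 4295 = 4 * 1000 + 295.
  by rewrite -[IZR _]/(IZR (4 * 1000 + 295)) izrD izrM (izr_nat 4) (izr_nat 1000) (izr_nat 295).
have e2 : IZR 4296 = 4 * 1000 + 296.
  by rewrite -[IZR _]/(IZR (4 * 1000 + 296)) izrD izrM (izr_nat 4) (izr_nat 1000) (izr_nat 296).
rewrite -e1 -e2; apply/andP; split.
  by apply: param_le; vm_cast_no_check (erefl true).
by apply: param_ge; vm_cast_no_check (erefl true).
Qed.

Let mu0 : R[i] := (IZR mu_re0 / 2 ^+ param_bits) +i* (IZR mu_im0 / 2 ^+ param_bits).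

Lemma mu0_le : cnorm mu0 <= 49.
Proof.
have abs1 (a : Z) : (- 10 * 2 ^ 210 <=? a)%Z -> (a <=? 10 * 2 ^ 210)%Z ->
    `|IZR a / 2 ^+ param_bits| <= 10.
  move=> /param_le h1 /param_ge h2; move: h1 h2; rewrite -[IZR (-10)]/(IZR (Z.opp 10)) izrN.
  by rewrite (izr_nat 10) ler_norml => -> ->.
rewrite /cnorm /mu0 /=.
have h1 : `|IZR mu_re0 / 2 ^+ param_bits| <= 10.
  by apply: abs1; vm_cast_no_check (erefl true).
have h2 : `|IZR mu_im0 / 2 ^+ param_bits| <= 10.
  by apply: abs1; vm_cast_no_check (erefl true).
lra.
Qed.

Lemma ball_bound (b g : R) : `|b - b0| <= 1 / 1000 -> `|g - g0| <= 1 / 1000 ->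
  [/\ 2 + `|g| + 2 * s * `|b| + `|b| / theta <= L, b < 0 & g < - b].
Proof.
have /andP[b1 b2] := b0_bounds; have /andP[g1 g2] := g0_bounds.
move: b1 b2 g1 g2; move: (b0) (g0) => x y b1 b2 g1 g2.
rewrite !ler_norml => /andP[h1 h2] /andP[h3 h4].
have bn : b < 0 by lra.
have gp : 0 < g by lra.
split=> //; last by lra.
rewrite (gtr0_norm gp) (ltr0_norm bn) L_num /s /theta; lra.
Qed.

Lemma pow2_mul m n : 2 ^- (m + n) * 2 ^+ m = 2 ^- n :> R.
Proof.
by rewrite exprD invfM mulrAC mulVf ?mul1r// gt_eqF// exprn_gt0.
Qed.

Lemma pow2_ratio m n p q : (p + q = m + n)%N ->
  2 ^+ m * (2 ^- p * 2 ^- q) <= 2 ^- n :> R.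
Proof. by move=> pq; rewrite -invfM -exprD pq mulrC pow2_mul. Qed.

Let z0 : 'cV[R]_4 := \col_i
  [tuple b0; g0; IZR mu_re0 / 2 ^+ param_bits; IZR mu_im0 / 2 ^+ param_bits]`_i.

Let z00 : z0 (inord 0) 0 = b0. Proof. by rewrite mxE inordK. Qed.
Let z01 : z0 (inord 1) 0 = g0. Proof. by rewrite mxE inordK. Qed.
Let z0m : param_mu z0 = mu0. Proof. by rewrite /param_mu !mxE !inordK. Qed.

Lemma eps_bounds (N K K' : nat) : (4 * Z.of_nat (diff2 N) <=? 2 ^ 20)%Z ->
  K' = (20 + K)%N -> 4 * (diff2 N)%:R * 2 ^- K' <= 2 ^- K :> R.
Proof.
move=> h ->; rewrite -[leRHS](pow2_mul 20 K) [leRHS]mulrC.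
rewrite ler_pM2r ?invr_gt0 ?exprn_gt0//.
by rewrite -(izr_nat 4) -(izr_nat (diff2 N)) izrX2 -izrM; apply: izr_le.
Qed.

Lemma tail_eps (K K' : nat) : K' = (20 + K)%N ->
  (8 + 6 * `|b0| + 2 * `|g0|) * (IZR tail_bound * 2 ^- K') <= 2 ^- K * Q.
Proof.
move=> ->.
have /andP[b1 b2] := b0_bounds; have /andP[g1 g2] := g0_bounds.
have c : 8 + 6 * `|b0| + 2 * `|g0| <= IZR (50 * 1000).
  rewrite izrM (izr_nat 50) (izr_nat 1000).
  move: b1 b2 g1 g2; move: (b0) (g0) => x y b1 b2 g1 g2.
  rewrite ler0_norm ?ger0_norm; lra.
have p0 : 0 < 2 ^- (20 + K) :> R by rewrite invr_gt0 exprn_gt0.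
rewrite -(pow2_mul 20 K) mulrA; move: p0; set p := 2 ^- (20 + K) => p0.
rewrite [leRHS](_ : _ = 2 ^+ 20 * Q * p); last by rewrite -mulrA mulrC.
apply: ler_wpM2r; first exact: ltW.
have T0 : 0 <= IZR tail_bound by apply: izr_le.
apply: (le_trans (ler_wpM2r T0 c)).
by rewrite izrX2 /Q -!izrM; apply: izr_le; vm_cast_no_check (erefl true).
Qed.

Let om1 N n : (N <= 252)%N -> (n < N)%N -> 1 <= om n.
Proof. by move=> hN hn; apply: om_ge1; rewrite ltnW// (leq_trans hn). Qed.

Let omQ N : (52 <= N <= 251)%N -> Q <= om N /\ Q <= om N.+1.
Proof.
move=> /andP[h1 h2]; split; apply: om_ge_Q; first by rewrite h1 ltnW.
by apply/andP; split; [exact: ltnW|exact: h2].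
Qed.

Let r : R := 2 ^- 195.

Let r_gt0 : 0 < r. Proof. by rewrite invr_gt0 exprn_gt0. Qed.

Let r_le : r <= 1000^-1.
Proof.
have h : IZR 1000 <= 2 ^+ 195 by rewrite izrX2; apply: izr_le.
rewrite (izr_nat 1000) in h.
have p1 : 0 < 1000 :> R := ltr0Sn _ 999.
have p2 : 0 < 2 ^+ 195 :> R := exprn_gt0 195 (ltr0Sn _ 1).
rewrite /r lef_pV2; [exact: h|exact: p2|exact: p1].
Qed.

Let ball_le b g : `|b - b0| <= r -> `|g - g0| <= r ->
  2 + `|g| + 2 * s * `|b| + `|b| / theta <= L.
Proof.
move=> hb hg; have h : r <= 1 / 1000 by rewrite div1r.
by have [] := ball_bound (le_trans hb h) (le_trans hg h).
Qed.

Let one_u K : IZR (2 ^ Z.of_nat K) * 2 ^- K = 1 :> R.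
Proof. by rewrite -izrX2 mulfV// gt_eqF// exprn_gt0. Qed.

Let u_gt0 K : 0 < 2 ^- K :> R. Proof. by rewrite invr_gt0 exprn_gt0. Qed.

Let pow_le1 K : 2 ^- K <= 1 :> R.
Proof. by rewrite invf_le1 ?exprn_gt0// exprn_ege1// ler1n. Qed.

Let tan_N : nat := 192.
Let chi_N : nat := 250.

Lemma chi_defect : `|wall_map z0
   - fx_wall (2 ^- 400) (chi_run 251)|
   <= 2 * 2 ^- 380 * Om + 2 * 2 ^- 400 *+ 251.
Proof.
have [tailX _] := chi_checkP chi_check_true.
have mu_u : cv (2 ^- 400) (mu_re0 * 2 ^ 190, mu_im0 * 2 ^ 190)%Z = mu0.
  have e (a : Z) : IZR (a * 2 ^ 190) * 2 ^- 400 = IZR a / 2 ^+ param_bits.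
    rewrite izrM -mulrA; congr (_ * _); rewrite -(izrX2 190) mulrC.
    exact: (pow2_mul 190 210).
  by rewrite /cv /mu0 !e.
rewrite /wall_map z00 z01 z0m.
have e1 := @eps_bounds 250 380 400 isT erefl.
have e2 := @tail_eps 380 400 erefl.
have H := chi_run_close theta_gt0 theta_lt1 s_ge0 s_le1 sL tsL s50 om_le_geo
  (ltW r_gt0) mu0_le ball_le (u_gt0 400) (one_u 400) mu_u.
have {}H := H chi_N tail_bound Q (2 ^- 380) (@om1 chi_N ^~ isT) (omQ (N := chi_N) isT) e1 e2
  (pow_le1 380) isT tailX.
exact: H.
Qed.

Let z0_mx := tan_mx (2 ^- 210) (tan_run 193).

Lemma tangent_expansion : exists2 J : 'M[R]_4,
  forall i j, `|J i j - z0_mx i j| <= 2 * 2 ^- 210 *+ 193 &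
  forall z z', `|z - z0| <= r -> `|z' - z0| <= r ->
    `|wall_map z - wall_map z' - J *m (z - z')|
      <= 2 * (2000 * r + 7 * 2 ^- 190) * Om * `|z - z'|.
Proof.
have [tailY _] := tan_checkP tan_check_true.
have e1 := @eps_bounds 192 190 210 isT erefl.
have e2 := @tail_eps 190 210 erefl.
have mu_u : cv (2 ^- 210) (mu_re0, mu_im0) = mu0 by [].
have H := tan_run_expansion theta_gt0 theta_lt1 s_ge0 s_le1 sL tsL s50 om_le_geo
  (ltW r_gt0) mu0_le ball_le (u_gt0 210) (one_u 210) mu_u.
have {}H := H tan_N tail_bound Q (2 ^- 190) (@om1 tan_N ^~ isT) (omQ (N := tan_N) isT) e1 e2
  (pow_le1 190) isT tailY r_le z0 z00 z01 z0m.
exact: H.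
Qed.

Lemma pow2_le m n : (m <= n)%N -> 2 ^- n <= 2 ^- m :> R.
Proof.
move=> mn; rewrite lef_pV2 ?posrE ?exprn_gt0//.
by rewrite ler_weXn2l// ler1n.
Qed.

Lemma pow2_add m n k (x y : R) : (n < m)%N -> (n < k)%N ->
  x <= 2 ^- m -> y <= 2 ^- k -> x + y <= 2 ^- n.
Proof.
move=> nm nk hx hy.
have -> : 2 ^- n = 2 ^- n.+1 + 2 ^- n.+1 :> R.
  rewrite -(pow2_mul 1 n) add1n expr1 mulr_natr mulr2n//.
by apply: lerD; [apply: le_trans hx _|apply: le_trans hy _]; exact: pow2_le.
Qed.

Lemma pow2_prod m n k (x y : R) : k = (m + n)%N -> 0 <= y ->
  x <= 2 ^- k -> y <= 2 ^+ m -> x * y <= 2 ^- n.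
Proof.
move=> -> y0 hx hy; rewrite -(pow2_mul m n).
apply: (le_trans (ler_wpM2r y0 hx)); exact: ler_wpM2l.
Qed.

Lemma nat_pow2 (c m : nat) : (Z.of_nat c <=? 2 ^ Z.of_nat m)%Z -> c%:R <= 2 ^+ m :> R.
Proof. by move=> h; rewrite -izr_nat izrX2; apply: izr_le. Qed.

Let A := izr_mx newton_mx (2 ^- 50).

Let A_rowsum i : \sum_j `|A i j| <= 2 ^+ 19.
Proof.
have := rowsum_okP (ltW (u_gt0 50)) rowsum_check_true i.
have -> : IZR (2 ^ 69) * 2 ^- 50 = 2 ^+ 19.
  have n0 : 2 ^+ 50 != 0 :> R by exact: lt0r_neq0 (exprn_gt0 50 (ltr0Sn _ 1)).
  by rewrite -(izrX2 69) (exprD 2 50 19) mulrC (mulKf n0).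
exact.
Qed.

Lemma Om_ge0 : 0 <= Om.
Proof.
apply: mulr_ge0; last by rewrite invr_ge0 subr_ge0 ltW.
by have := om_le_geo 0; rewrite mulr1; apply: le_trans.
Qed.

Lemma expansion_small : 2 * (2000 * r + 7 * 2 ^- 190) * Om <= 2 ^- 22.
Proof.
have h1 : r * 2000 <= 2 ^- 184.
  exact: (@pow2_prod 11 184 195 r 2000 erefl (ler0n _ _) (lexx _)
    (@nat_pow2 2000 11 isT)).
have h2 : 2 ^- 190 * 7 <= 2 ^- 187 :> R.
  exact: (@pow2_prod 3 187 190 _ 7 erefl (ler0n _ _) (lexx _) (@nat_pow2 7 3 isT)).
have h3 := @pow2_add 184 183 187 _ _ isT isT h1 h2.
have two0 : 0 <= 2 :> R := ler0n _ 2.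
have h4 : 2 * Om <= 2 ^+ 161 by rewrite exprS; exact: (ler_wpM2l two0 Om_le).
rewrite mulrAC mulrC [2000 * r]mulrC [7 * _]mulrC.
exact: (@pow2_prod 161 22 183 _ _ erefl (mulr_ge0 two0 Om_ge0) h3 h4).
Qed.

Lemma pow2_half K : 2 * 2 ^- K.+1 <= 2 ^- K :> R.
Proof. by rewrite -(pow2_mul 1 K) expr1 add1n mulrC. Qed.

Lemma chi_defect_small : 2 * 2 ^- 380 * Om + 2 * 2 ^- 400 *+ 251 <= 2 ^- 218.
Proof.
have h1 : 2 * 2 ^- 380 * Om <= 2 ^- 219.
  exact: (@pow2_prod 160 219 379 _ _ erefl Om_ge0 (pow2_half 379) Om_le).
have h2 : 2 * 2 ^- 400 *+ 251 <= 2 ^- 391 :> R.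
  rewrite -mulr_natr.
  exact: (@pow2_prod 8 391 399 _ _ erefl (ler0n _ _) (pow2_half 399)
    (@nat_pow2 251 8 isT)).
exact: (@pow2_add 219 218 391 _ _ isT isT h1 h2).
Qed.

(** The hypotheses of [approx_newton] hold on the ball of radius 2^-195 with
    |1 - A J| <= 2^-2, |A| <= 2^19, expansion error 2^-22 and |A G(z0)| <=
    2^-196. The signs of b and of g + b are read off from the approximate
    zero. *)
Theorem neutral_parameters : exists (b g : R) (mu : R[i]),
  [/\ b < 0, g < - b & wall (os_f b g 1 mu) (os_w b g 1 mu) = 0].
Proof.
have [J hJ hexp] := tangent_expansion.
have [_ hd] := chi_checkP chi_check_true.
have [_ hi] := tan_checkP tan_check_true.
have unit1 : IZR (2 ^ 260) * (2 ^- 210 * 2 ^- 50) = 1.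
  have n0 : 2 ^+ 260 != 0 :> R by exact: lt0r_neq0 (exprn_gt0 260 (ltr0Sn _ 1)).
  by rewrite -(izrX2 260) -invfM -exprD (mulfV n0).
have uv0 K K' : 0 <= 2 ^- K * 2 ^- K' :> R.
  exact: (mulr_ge0 (ltW (u_gt0 K)) (ltW (u_gt0 K'))).
have hk := inverse_okP (uv0 210 50) unit1 hi.
have d0 : 0 <= 2 * 2 ^- 210 *+ 193 :> R.
  exact: (mulrn_wge0 _ (mulr_ge0 (ler0n _ 2) (ltW (u_gt0 210)))).
have two0 : 0 <= 2 :> R := ler0n _ 2.
have hkappa i : \sum_j `|(1%:M - A *m J) i j| <= 2 ^- 2.
  apply: (le_trans (approx_inverse d0 hk A_rowsum hJ i)).
  have h1 : IZR (2 ^ 253) * (2 ^- 210 * 2 ^- 50) <= 2 ^- 7.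
    by rewrite -(izrX2 253); exact: (@pow2_ratio 253 7 210 50 erefl).
  have h2 : 2 * 2 ^- 210 *+ 193 <= 2 ^- 201 :> R.
    rewrite -mulr_natr.
    exact: (@pow2_prod 8 201 209 _ _ erefl (ler0n _ _) (pow2_half 209)
      (@nat_pow2 193 8 isT)).
  have h3 : 4 * 2 ^+ 19 = 2 ^+ 21 :> R.
    by rewrite (exprD 2 2 19); congr (_ * _); rewrite expr2 -natrM.
  have h4 := @pow2_prod 21 180 201 _ _ erefl (exprn_ge0 21 two0) h2 (lexx _).
  rewrite mulrC -h3 in h4.
  exact: (@pow2_add 7 2 180 _ _ isT isT h1 h4).
have r2 : r / 2 = 2 ^- 196 by rewrite /r -invfM -exprSr.
have hz0 : `|A *m wall_map z0| <= r / 2.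
  rewrite r2; set x := fx_wall (2 ^- 400) (chi_run 251).
  have -> : A *m wall_map z0 = A *m (wall_map z0 - x) + A *m x.
    by rewrite mulmxBr subrK.
  have h1 : `|A *m (wall_map z0 - x)| <= 2 ^- 199.
    apply: (le_trans (norm_mulmx_le _ (exprn_ge0 19 two0) A_rowsum)).
    rewrite mulrC.
    exact: (@pow2_prod 19 199 218 _ _ erefl (exprn_ge0 19 two0)
      (le_trans chi_defect chi_defect_small) (lexx _)).
  have h2 : `|A *m x| <= 2 ^- 205.
    apply: (le_trans (defect_okP (uv0 400 50) hd)).
    by rewrite -(izrX2 245); exact: (@pow2_ratio 245 205 400 50 erefl).
  apply: (le_trans (ler_normD _ _)).
  exact: (@pow2_add 199 196 205 _ _ isT isT h1 h2).
have e0 : 0 <= 2 * (2000 * r + 7 * 2 ^- 190) * Om.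
  exact: (mulr_ge0 (mulr_ge0 two0 (addr_ge0 (mulr_ge0 (ler0n _ _) (ltW r_gt0))
    (mulr_ge0 (ler0n _ _) (ltW (u_gt0 190))))) Om_ge0).
have hq : 2 ^- 2 + 2 ^+ 19 * (2 * (2000 * r + 7 * 2 ^- 190) * Om) <= 2^-1.
  have h1 : 2 ^+ 19 * (2 * (2000 * r + 7 * 2 ^- 190) * Om) <= 2 ^- 3.
    rewrite mulrC.
    exact: (@pow2_prod 19 3 22 _ _ erefl (exprn_ge0 19 two0) expansion_small (lexx _)).
  exact: (@pow2_add 2 1 3 _ _ isT isT (lexx _) h1).
have [z zr Gz] := approx_newton r_gt0 (ltW (u_gt0 2)) (exprn_ge0 19 two0) e0 hexp
  hkappa A_rowsum hq hz0.
exists (z (inord 0) 0), (z (inord 1) 0), (param_mu z).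
have co k : `|z (inord k) 0 - z0 (inord k) 0| <= 1 / 1000.
  rewrite div1r; apply: le_trans r_le; apply: le_trans zr.
  by have := normr_coord_le (z - z0) (inord k); rewrite !mxE.
have [_ bn gb] : [/\ 2 + `|z (inord 1) 0| + 2 * s * `|z (inord 0) 0|
    + `|z (inord 0) 0| / theta <= L, z (inord 0) 0 < 0
    & z (inord 1) 0 < - z (inord 0) 0].
  by apply: ball_bound; [rewrite -z00|rewrite -z01]; exact: co.
by split.
Qed.

End NeutralParameters.

(** * Even and odd entire functions *)

Section EntireSeries.
Variable R : realType.
Implicit Types (u v : nat -> R) (x y : R) (n : nat).

(** Coefficients that decrease faster than every geometric sequence; for
    this class sums, shifts and termwise derivatives need no radius of
    convergence. *)
Definition entire u := forall e : R, 0 < e -> exists M, forall n, `|u n| <= M * e ^+ n.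

Definition psum u x : R := limn (pseries u x).

Lemma entire_cvg u x : entire u -> cvgn (pseries u x).
Proof.
move=> hu; pose e : R := (2 * (`|x| + 1))^-1.
have x1 : 0 < `|x| + 1 by rewrite ltr_wpDl.
have e0 : 0 < e by rewrite invr_gt0 mulr_gt0.
have [M hM] := hu e e0.
apply: (@geo_bounded_cvg _ (1 / 2)); [lra|lra|].
exists M => n; rewrite normrM normrX.
have M0 : 0 <= M by have := hM 0; rewrite mulr1; apply: le_trans.
apply: (le_trans (ler_wpM2r (exprn_ge0 n (normr_ge0 x)) (hM n))).
rewrite -mulrA; apply: ler_wpM2l => //; rewrite -exprMn.
have ex : e * `|x| <= 1 / 2.
  rewrite /e mulrC ler_pdivrMr ?mulr_gt0// mulrA divfK ?pnatr_eq0//.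
  by rewrite mul1r lerDl.
have ex0 : 0 <= e * `|x| by exact: (mulr_ge0 (ltW e0) (normr_ge0 x)).
by apply: lerXn2r => //; rewrite nnegrE; lra.
Qed.

Lemma entireD u v : entire u -> entire v -> entire (fun n => u n + v n).
Proof.
move=> hu hv e e0; have [M hM] := hu e e0; have [P hP] := hv e e0.
exists (M + P) => n; rewrite mulrDl.
by apply: (le_trans (ler_normD _ _)); exact: lerD.
Qed.

Lemma entireZ (a : R) u : entire u -> entire (fun n => a * u n).
Proof.
move=> hu e e0; have [M hM] := hu e e0; exists (`|a| * M) => n.
by rewrite normrM -mulrA; exact: ler_wpM2l.
Qed.

Lemma entire_nat u : entire u -> entire (fun n => n%:R * u n).
Proof.
move=> hu e e0; have e2 : 0 < e / 2 by lra.
have [M hM] := hu _ e2; exists M => n.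
have M0 : 0 <= M by have := hM 0; rewrite mulr1; apply: le_trans.
rewrite normrM ger0_norm//.
apply: (le_trans (ler_wpM2l (ler0n _ n) (hM n))).
rewrite mulrCA; apply: ler_wpM2l => //.
rewrite expr_div_n mulrCA ler_piMr ?exprn_ge0 ?(ltW e0)//.
rewrite ler_pdivrMr ?exprn_gt0// mul1r -natrX ler_nat.
exact/ltnW/ltn_expl.
Qed.

Lemma entire_succ u : entire u -> entire (fun n => u n.+1).
Proof.
move=> hu e e0; have [M hM] := hu e e0; exists (M * e) => n.
by rewrite -mulrA -exprS.
Qed.

Lemma entire_delay u : entire u -> entire (delay u).
Proof.
move=> hu e e0; have [M hM] := hu e e0; exists (M / e) => -[|n] /=.
  have M0 : 0 <= M by have := hM 0; rewrite mulr1; apply: le_trans.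
  by rewrite normr0 mulr_ge0 ?mulr_ge0 ?invr_ge0 ?(ltW e0).
by rewrite exprS mulrA divfK ?gt_eqF.
Qed.

Lemma entire_diffs u : entire u -> entire (pseries_diffs u).
Proof. by move=> /entire_nat/entire_succ. Qed.

Lemma psum_derive u x : entire u ->
  is_derive x 1 (psum u) (psum (pseries_diffs u) x).
Proof.
move=> hu; apply: (@pseries_snd_diffs _ u (`|x| + 1)).
- exact: entire_cvg.
- exact/entire_cvg/entire_diffs.
- exact/entire_cvg/entire_diffs/entire_diffs.
- by rewrite [ltRHS]ger0_norm ?addr_ge0// ltrDl.
Qed.

Lemma psumD u v x : entire u -> entire v ->
  psum (fun n => u n + v n) x = psum u x + psum v x.
Proof.
move=> hu hv; rewrite -(lim_seriesD (entire_cvg hu) (entire_cvg hv)) /psum /pseries.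
by congr (limn (series _)); apply/funext => n /=; rewrite mulrDl.
Qed.

Lemma psumZ (a : R) u x : entire u -> psum (fun n => a * u n) x = a * psum u x.
Proof.
move=> hu; rewrite -[RHS](lim_seriesZ a (entire_cvg hu)) /psum /pseries.
by congr (limn (series _)); apply/funext => n /=; rewrite -mulrA.
Qed.

Lemma psum_delay u x : entire u -> psum (delay u) x = x * psum u x.
Proof.
move=> hu; rewrite /psum; apply/cvg_lim => //.
rewrite -(cvg_shiftS (pseries (delay u) x)) /=.
have -> : (fun n => pseries (delay u) x n.+1) = (fun n => x * pseries u x n).
  apply/funext => n; rewrite /pseries /series /= big_nat_recl// mul0r add0r.
  by rewrite mulr_sumr; apply: eq_bigr => i _ /=; rewrite exprS mulrCA.
by apply: cvgMl_tmp; exact: (entire_cvg (u := u) (x := x) hu).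
Qed.

Lemma psum0 u : psum u 0 = u 0.
Proof.
rewrite /psum; apply: lim_near_cst => //; near=> n.
have n0 : (0 < n)%N by near: n; exact: nbhs_infty_gt.
rewrite /pseries /series /= -(prednK n0) big_nat_recl// mulr1 big1 ?addr0//.
by move=> i _; rewrite exprS mul0r mulr0.
Unshelve. all: by end_near. Qed.

Lemma psum1 u : psum u 1 = tsum u.
Proof.
rewrite /psum /pseries /tsum; congr (limn (series _)).
by apply/funext => n /=; rewrite expr1n mulr1.
Qed.

(** Series in y^2, and y times such a series. *)
Definition even_fun u y : R := psum u (y ^+ 2).
Definition odd_fun u y : R := y * psum u (y ^+ 2).

Lemma is_derive_sqr y : is_derive y 1 (fun t : R => t ^+ 2) (2 * y).
Proof.
have -> : (fun t : R => t ^+ 2) = (id : R -> R) * id.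
  by apply/funext => t; rewrite expr2.
apply: is_derive_eq (is_deriveM (is_derive_id y 1) (is_derive_id y 1)) _.
rewrite /GRing.scale /=; ring.
Qed.

Lemma even_fun_derive u y : entire u ->
  is_derive y 1 (even_fun u) (odd_fun (fun n => (2 * n + 2)%:R * u n.+1) y).
Proof.
move=> hu.
have h := @is_derive1_comp R (psum u) (fun t => t ^+ 2) y _ _
  (psum_derive (y ^+ 2) hu) (is_derive_sqr y).
apply: is_derive_eq h _.
rewrite /odd_fun.
have -> : (fun n => (2 * n + 2)%:R * u n.+1) = (fun n => 2 * pseries_diffs u n).
  apply/funext => n; rewrite /pseries_diffs mulrA -natrM.
  by congr (_%:R * _); rewrite mulnS addnC.
rewrite psumZ; last exact: entire_diffs.
ring.
Qed.

Lemma odd_fun_derive u y : entire u ->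
  is_derive y 1 (odd_fun u) (even_fun (fun n => (2 * n + 1)%:R * u n) y).
Proof.
move=> hu.
have h := @is_derive1_comp R (psum u) (fun t => t ^+ 2) y _ _
  (psum_derive (y ^+ 2) hu) (is_derive_sqr y).
apply: is_derive_eq (is_deriveM (is_derive_id y 1) h) _.
rewrite /GRing.scale /= mulr1 /even_fun.
have -> : (fun n => (2 * n + 1)%:R * u n)
    = (fun n => 2 * delay (pseries_diffs u) n + u n).
  apply/funext => -[|n] /=; first by rewrite mulr0 add0r mul1r.
  by rewrite /pseries_diffs natrD natrM mulrDl mul1r mulrA.
have hd := entire_diffs hu; have hs := entire_delay hd.
rewrite psumD//; last exact: entireZ.
rewrite psumZ// psum_delay//; ring.
Qed.

End EntireSeries.

(** * The Orr-Sommerfeld system of functions *)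

Section NeutralMode.
Variable R : realType.

(** The weighted bound holds for every ratio theta = e, with L and the
    constant depending on e. *)
Lemma os_mode_entire (b g : R) (f w : nat -> R[i]) :
  os_mode b g (fun=> 0) (fun=> 0) f w ->
  forall e : R, 0 < e ->
  exists M, forall n, cnorm (f n) <= M * e ^+ n /\ cnorm (w n) <= M * e ^+ n.
Proof.
move=> h e e0; pose L := 3 + `|g| + 2 * `|b| + `|b| / e.
have b0 := normr_ge0 b; have g0 := normr_ge0 g.
have be0 : 0 <= `|b| / e by rewrite divr_ge0// ltW.
have L0 : 0 < L by rewrite /L; lra.
pose M := cnorm (f 0) + cnorm (w 0).
have f0 := cnorm_ge0 (f 0); have w0 := cnorm_ge0 (w 0).
have M0 : 0 <= M by rewrite /M; lra.
have [W W0 hW] := majorant_geometric_ex e0 L0.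
have src n : cnorm (0 : R[i]) <= M * majorant e L n.
  by rewrite cnorm0 mulr_ge0// ltW// majorant_gt0.
have bd := os_mode_bound e0 M0 ler01 (L := L) _ _ h _ _ src src.
exists (M * W) => n; rewrite -mulrA.
have Mn := ler_wpM2l M0 (hW n).
have [||||h1 h2] := bd _ _ _ _ n; rewrite /L ?mul1r ?mulr1 /M; try lra.
by rewrite mul1r in h1; split; [apply: le_trans h1 Mn|apply: le_trans h2 Mn].
Qed.

(** Real and imaginary parts phi = P + i Q and w = U + i V, with first
    derivatives P1, Q1, U1, V1. *)
Definition os_system (b g : R) (P P1 Q Q1 U U1 V V1 : R -> R) : Prop :=
  forall y, let F := b * y ^+ 2 + g in
  [/\ is_derive y 1 P (P1 y), is_derive y 1 P1 (P y + U y),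
      is_derive y 1 Q (Q1 y) & is_derive y 1 Q1 (Q y + V y)] /\
  [/\ is_derive y 1 U (U1 y), is_derive y 1 U1 (U y - (F * V y - 2 * b * Q y)),
      is_derive y 1 V (V1 y) & is_derive y 1 V1 (V y + (F * U y - 2 * b * P y))].

Lemma os_mode_system (b g : R) (f w : nat -> R[i]) :
  os_mode b g (fun=> 0) (fun=> 0) f w ->
  let fr n := complex.Re (f n) in let fi n := complex.Im (f n) in
  let wr n := complex.Re (w n) in let wi n := complex.Im (w n) in
  let D u n := (2 * n + 2)%:R * u n.+1 in
  os_system b g (even_fun fr) (odd_fun (D fr)) (even_fun fi) (odd_fun (D fi))
    (even_fun wr) (odd_fun (D wr)) (even_fun wi) (odd_fun (D wi)).
Proof.
move=> h fr fi wr wi D.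
have ent := os_mode_entire h.
have efr : entire fr.
  move=> e /ent[M hM]; exists M => n; have [h1 _] := hM n.
  exact: le_trans (normr_Re_le _) h1.
have efi : entire fi.
  move=> e /ent[M hM]; exists M => n; have [h1 _] := hM n.
  exact: le_trans (normr_Im_le _) h1.
have ewr : entire wr.
  move=> e /ent[M hM]; exists M => n; have [_ h1] := hM n.
  exact: le_trans (normr_Re_le _) h1.
have ewi : entire wi.
  move=> e /ent[M hM]; exists M => n; have [_ h1] := hM n.
  exact: le_trans (normr_Im_le _) h1.
have eD u : entire u -> entire (D u).
  move=> /entire_diffs/(entireZ 2) hu.
  rewrite (_ : D u = (fun n => 2 * pseries_diffs u n))//.
  apply/funext => n; rewrite /D /pseries_diffs mulrA -natrM.
  by congr (_%:R * _); rewrite mulnS addnC.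
have DE u n : (2 * n + 1)%:R * D u n = (diff2 n)%:R * u n.+1.
  by rewrite /D mulrA -natrM.
have d1 (u : nat -> R) (y : R) : entire u -> is_derive y 1 (even_fun u) (odd_fun (D u) y).
  exact: even_fun_derive.
have d_odd (u v : nat -> R) (y : R) : entire u -> (forall n, (diff2 n)%:R * u n.+1 = v n) ->
    is_derive y 1 (odd_fun (D u)) (even_fun v y).
  move=> hu uv; have := odd_fun_derive y (eD _ hu).
  by rewrite (_ : (fun n => _) = v)//; apply/funext => n; rewrite DE uv.
have RC n (x y : R[i]) : (diff2 n)%:R%:C * x = y ->
    (diff2 n)%:R * complex.Re x = complex.Re y /\
    (diff2 n)%:R * complex.Im x = complex.Im y.
  by move=> <-; case: x => a c /=; rewrite !mul0r subr0 addr0.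
have eD2 (u v : nat -> R) (y a c : R) : entire u -> entire v ->
    even_fun (fun n => a * u n + c * v n) y = a * even_fun u y + c * even_fun v y.
  by move=> hu hv; rewrite /even_fun psumD ?psumZ//; exact: entireZ.
have shE (u : nat -> R) (y : R) : entire u -> even_fun (delay u) y = y ^+ 2 * even_fun u y.
  by move=> hu; rewrite /even_fun psum_delay.
move=> y F; split; split.
- exact: d1.
- have -> : even_fun fr y + even_fun wr y = even_fun (fun n => 1 * fr n + 1 * wr n) y.
    by rewrite eD2// !mul1r.
  apply: d_odd => // n; have [h1 _] := h n; have [-> _] := RC n _ _ h1.
  by rewrite /fr /wr; case: (f n) (w n) => a c [a' c'] /=; ring.
- exact: d1.
- have -> : even_fun fi y + even_fun wi y = even_fun (fun n => 1 * fi n + 1 * wi n) y.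
    by rewrite eD2// !mul1r.
  apply: d_odd => // n; have [h1 _] := h n; have [_ ->] := RC n _ _ h1.
  by rewrite /fi /wi; case: (f n) (w n) => a c [a' c'] /=; ring.
- exact: d1.
- have -> : even_fun wr y - (F * even_fun wi y - 2 * b * even_fun fi y)
    = even_fun (fun n => 1 * (1 * wr n + - g * wi n)
        + 1 * (- b * delay wi n + 2 * b * fi n)) y.
    rewrite eD2; [|exact/entireD/entireZ/ewi/entireZ/ewr|].
      rewrite !eD2//; last exact: entire_delay.
      rewrite shE// /F; ring.
    by apply: entireD; apply: entireZ => //; exact: entire_delay.
  apply: d_odd => // n; have [_ h1] := h n; have [-> _] := RC n _ _ h1.
  rewrite /wr /wi /fi; case: n {h1} => [|n] /=;
   [case: (f 0) (w 0) => a c [a' c']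
   |case: (f n.+1) (w n.+1) (w n) => a c [a' c'] [a'' c'']] => /=; ring.
- exact: d1.
- have -> : even_fun wi y + (F * even_fun wr y - 2 * b * even_fun fr y)
    = even_fun (fun n => 1 * (1 * wi n + g * wr n)
        + 1 * (b * delay wr n + - (2 * b) * fr n)) y.
    rewrite eD2; [|exact/entireD/entireZ/ewr/entireZ/ewi|].
      rewrite !eD2//; last exact: entire_delay.
      rewrite shE// /F; ring.
    by apply: entireD; apply: entireZ => //; exact: entire_delay.
  apply: d_odd => // n; have [_ h1] := h n; have [_ ->] := RC n _ _ h1.
  rewrite /wr /wi /fr; case: n {h1} => [|n] /=;
   [case: (f 0) (w 0) => a c [a' c']
   |case: (f n.+1) (w n.+1) (w n) => a c [a' c'] [a'' c'']] => /=; ring.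
Qed.

End NeutralMode.

Section WallConditions.
Variable R : realType.

Lemma os_mode_wall (b g : R) (f w : nat -> R[i]) :
  os_mode b g (fun=> 0) (fun=> 0) f w -> wall f w = 0 ->
  let D u n := (2 * n + 2)%:R * u n.+1 : R in
  let fr n := complex.Re (f n) in let fi n := complex.Im (f n) in
  forall y : R, y ^+ 2 = 1 ->
  [/\ even_fun fr y = 0, even_fun fi y = 0,
      odd_fun (D fr) y = 0 & odd_fun (D fi) y = 0].
Proof.
move=> h w0 D fr fi y y2; rewrite /even_fun /odd_fun y2 !psum1.
have wi (k : nat) : (k < 4)%N -> tsum (fun n => wall_coef f w n (inord k)) = 0.
  by move=> _; have := congr1 (fun v : 'cV[R]_4 => v (inord k) 0) w0; rewrite !mxE.
have DE n (c : R[i] -> R) : (forall (a : R) x, c (a%:C * x) = a * c x) ->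
    (2 * n + 2)%:R * c (f n.+1) = c ((2 * n + 1)%:R^-1%:C * (f n + w n)).
  move=> hc; have [h1 _] := h n.
  have n0 : (2 * n + 1)%:R != 0 :> R by rewrite pnatr_eq0 addn1.
  rewrite -[f n + w n]addr0 -h1 !hc /diff2 natrM mulrA mulrA mulVf// mul1r//.
have cRe (a : R) (x : R[i]) : complex.Re (a%:C * x) = a * complex.Re x.
  by case: x => x1 x2 /=; rewrite mul0r subr0.
have cIm (a : R) (x : R[i]) : complex.Im (a%:C * x) = a * complex.Im x.
  by case: x => x1 x2 /=; rewrite mul0r addr0.
split.
- rewrite -[RHS](wi 0%N)//; congr tsum; apply/funext => n.
  by rewrite /wall_coef inordK.
- rewrite -[RHS](wi 1%N)//; congr tsum; apply/funext => n.
  by rewrite /wall_coef inordK.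
- rewrite -[RHS](mulr0 y) -(wi 2%N)//; congr (_ * tsum _); apply/funext => n.
  by rewrite /wall_coef inordK//= /D /fr (DE n _ cRe) cRe.
- rewrite -[RHS](mulr0 y) -(wi 3%N)//; congr (_ * tsum _); apply/funext => n.
  by rewrite /wall_coef inordK//= /D /fi (DE n _ cIm) cIm.
Qed.

End WallConditions.

Section NeutralModeExistence.
Local Notation R := Rdefinitions.R.

(** Since phi is even, the conditions at y = 1 give those at y = -1. *)
Theorem neutral_mode : exists b g : R, exists P P1 Q Q1 U U1 V V1 : R -> R,
  [/\ b < 0, g < - b, os_system b g P P1 Q Q1 U U1 V V1, P 0 = 1 &
      forall y, y ^+ 2 = 1 -> [/\ P y = 0, Q y = 0, P1 y = 0 & Q1 y = 0]].
Proof.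
have [b [g [mu [b0 gb w0]]]] := neutral_parameters.
have h := os_coefP b g 1 mu.
exists b, g; do 8!eexists; split; [exact: b0|exact: gb|exact: (os_mode_system h)| |].
- by rewrite /even_fun expr0n psum0.
- by move=> y y1; have [] := os_mode_wall h w0 y1.
Qed.

End NeutralModeExistence.

(** * Integration on the plane *)

Section PlaneMeasure.
Variable R : realType.
Implicit Types (f g : R * R -> R) (p : R * R).
Local Notation T2 := (measurableTypeR R * measurableTypeR R)%type.

Let sq (a b : R) n : set T2 :=
  [set x : R | `|a - x| < n.+1%:R^-1] `*` [set y : R | `|b - y| < n.+1%:R^-1].

Let sq_measurable a b n : measurable (sq a b n).
Proof.
have mI (c : R) : measurable ([set x : R | `|c - x| < n.+1%:R^-1] : set (measurableTypeR R)).
  rewrite (_ : [set x | _] = ball c n.+1%:R^-1); first exact: measurable_ball.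
  by rewrite -ball_normE.
exact: measurableX.
Qed.

(** The sigma-algebra of the plane is here the product one, so an open set
    has to be written as a countable union of squares with rational centres. *)
Lemma open_measurable2 (O : set (R * R)) : open O -> measurable (O : set T2).
Proof.
move=> oO.
pose F (a b : rat) n : set T2 :=
  if pselect (sq (ratr a) (ratr b) n `<=` O) then sq (ratr a) (ratr b) n else set0.
have -> : O = \bigcup_a \bigcup_b \bigcup_n F a b n.
  apply/seteqP; split; last first.
    move=> p [a _ [b _ [n _]]]; rewrite /F; case: pselect => // sub.
    exact: sub.
  move=> p Op.
  have /nbhs_ballP[e /= e0 pe] : nbhs p O by exact: open_nbhs_nbhs.
  have [n n2e] : exists n, n.+1%:R^-1 < e / 2.
    have e2 : 0 < e / 2 by rewrite divr_gt0.
    near \oo => n; exists n; near: n; exact: near_infty_natSinv_lt (PosNum e2).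
  have d0 : 0 < n.+1%:R^-1 :> R by rewrite invr_gt0.
  have ratclose (x : R) : exists q : rat, `|ratr q - x| < n.+1%:R^-1.
    have /rat_in_itvoo[q] : x - n.+1%:R^-1 < x + n.+1%:R^-1.
      by rewrite ltrD2l gtrN.
    rewrite in_itv /= => /andP[h1 h2]; exists q.
    by rewrite ltr_distl h1 h2.
  have [a ha] := ratclose p.1; have [b hb] := ratclose p.2.
  exists a => //; exists b => //; exists n => //.
  rewrite /F; case: pselect => [sub|nsub]; first by split.
  have tri (c x y : R) : `|c - x| < n.+1%:R^-1 -> `|c - y| < n.+1%:R^-1 ->
      `|x - y| < e.
    move=> cx cy; rewrite (splitr e) (le_lt_trans (ler_distD c x y))//.
    by rewrite ltrD ?(lt_trans _ n2e)// distrC.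
  exfalso; apply: nsub => q [/= q1 q2]; apply: pe. split; rewrite -ball_normE /=.
    by have := tri (ratr a) p.1 q.1 ha q1.
  by have := tri (ratr b) p.2 q.2 hb q2.
apply: bigcupT_measurable_rat => a; apply: bigcupT_measurable_rat => b.
apply: bigcupT_measurable => n; rewrite /F; case: pselect => [sub|nsub]; last exact: measurable0.
exact: sq_measurable.
Unshelve. all: by end_near. Qed.

Lemma closed_measurable2 (K : set (R * R)) : closed K -> measurable (K : set T2).
Proof.
by move=> /closed_openC/open_measurable2/measurableC; rewrite setCK.
Qed.

Lemma compact_measurable2 (K : set (R * R)) : compact K -> measurable (K : set T2).
Proof.
by move=> cK; apply: closed_measurable2; exact: compact_closed.
Qed.

Lemma continuous_measurable2 f : continuous f -> measurable_fun (setT : set T2) f.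
Proof.
move=> cf; apply: (measurability _ (RGenOpens.measurableE R)).
move=> _ [_ [a [b ->] <-]]; rewrite setTI.
by apply: open_measurable2; move/continuousP: cf; apply; exact: interval_open.
Qed.

End PlaneMeasure.

Section PlaneIntegral.
Variable R : realType.
Implicit Types (f g h : R * R -> R) (p : R * R) (K U : set (R * R)).
Local Notation T2 := (measurableTypeR R * measurableTypeR R)%type.
Local Notation mu := (@leb2 R).

Lemma compact_in_box K : compact K -> exists2 M : R, 0 < M &
  K `<=` `[- M, M] `*` `[- M, M].
Proof.
move=> /compact_bounded[M [Mr hM]]; exists (`|M| + 1); first by rewrite ltr_wpDl.
have /hM KM : M < `|M| + 1 by rewrite (le_lt_trans (ler_norm M))// ltrDl.
move=> p /KM /=; rewrite prod_normE ge_max => /andP[h1 h2].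
by split; rewrite /= in_itv /= -ler_norml.
Qed.

Lemma box_finite (a b c d : R) : (mu (`[a, b] `*` `[c, d]) < +oo)%E.
Proof.
have -> : mu (`[a, b] `*` `[c, d]) =
    (@lebesgue_measure R `[a, b] * @lebesgue_measure R `[c, d])%E.
  by apply: product_measure1E.
apply: lte_mul_pinfty.
- exact: measure_ge0.
- by rewrite lebesgue_measure_itv; case: ifP.
- by rewrite lebesgue_measure_itv; case: ifP => // _; rewrite ltry.
Qed.

Lemma compact_finite K : compact K -> (mu K < +oo)%E.
Proof.
move=> cK; have [M M0 KM] := compact_in_box cK.
apply: le_lt_trans (box_finite (- M) M (- M) M); apply: le_measure => //.
  by rewrite inE; exact: compact_measurable2.
by rewrite inE; apply: measurableX.
Qed.

Lemma continuous_compact_integrable2 f K : continuous f -> compact K ->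
  mu.-integrable K (EFin \o f).
Proof.
move=> cf cK; apply: measurable_bounded_integrable.
- exact: compact_measurable2.
- exact: compact_finite.
- apply: measurable_funS (continuous_measurable2 cf) => //.
- have /compact_bounded[M [Mr hM]] : compact (f @` K).
    by apply: continuous_compact => //; exact: continuous_subspaceT.
  exists M; split=> // x Mx p Kp; apply: (hM x Mx); by exists p.
Qed.

Lemma compact_support_integrable f K : continuous f -> compact K ->
  (forall p, ~ K p -> f p = 0) -> mu.-integrable setT (EFin \o f).
Proof.
move=> cf cK f0; have := continuous_compact_integrable2 cf cK.
move=> /(integrable_mkcond _ (compact_measurable2 cK)).1.
congr (integrable _ _ _); apply/funext => p; rewrite patchE.
by case: ifPn => //; rewrite notin_setE => /f0 /= ->.
Qed.

Lemma Rintegral_support f K U : K `<=` U -> (forall p, ~ K p -> f p = 0) ->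
  \int[mu]_(p in U) f p = \int[mu]_p f p.
Proof.
move=> KU f0; rewrite Rintegral_mkcond; apply: eq_Rintegral => p _.
rewrite patchE; case: ifPn => //; rewrite notin_setE => Up.
by rewrite f0// => /KU.
Qed.

(** The fundamental theorem of calculus on an interval that contains the
    support in its interior. *)
Lemma integral_derive_line (u u' : R -> R) (M : R) : 0 < M ->
  continuous u' -> (forall x : R, is_derive x 1 u (u' x)) ->
  (forall x, M < `|x| -> u x = 0) -> (forall x, M < `|x| -> u' x = 0) ->
  (\int[@lebesgue_measure R]_x (u' x)%:E = 0)%E.
Proof.
move=> M0 cu' du u0 u'0; pose N := M + 1.
have MN : - N < N by rewrite /N; lra.
have N0 : M < `|N| by rewrite ger0_norm /N; lra.
pose I : set R := [set` `[- N, N]].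
transitivity (\int[@lebesgue_measure R]_(x in I) (u' x)%:E)%E.
  rewrite [RHS]integral_mkcond; apply: eq_integral => x _.
  rewrite patchE; case: ifPn => //; rewrite notin_setE /I /= in_itv /= => /negP.
  rewrite -ler_norml -ltNge => Nx; rewrite u'0//; apply: lt_trans Nx.
  by rewrite /N ltrDl.
rewrite /I (continuous_FTC2 (F := u) MN).
- by rewrite !u0 ?normrN// subee.
- exact: continuous_subspaceT.
- have cu : continuous u.
    move=> x; apply/differentiable_continuous/derivable1_diffP.
    by have := du x; case.
  split; first by move=> x _; have := du x; case.
    by apply: cvg_at_right_filter; exact: cu.
  by apply: cvg_at_left_filter; exact: cu.
- by move=> x _; rewrite derive1E; have := du x; case.
Qed.

End PlaneIntegral.

(** * Classical derivatives are weak derivatives *)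

Section WeakDerivatives.
Variable R : realType.
Implicit Types (f g phi : R * R -> R) (p : R * R) (K U : set (R * R)).
Local Notation mu := (@leb2 R).
Local Notation ex := (@e_x R).
Local Notation ey := (@e_y R).

Let slice_xE f p : (fun h : R => h^-1 *: (f (h *: ex + p) - f p)) =
  (fun h : R => h^-1 *: ((fun x => f (x, p.2)) (h *: (1 : R) + p.1) - f (p.1, p.2))).
Proof.
apply/funext => h; rewrite -surjective_pairing.
have -> // : h *: ex + p = (h *: (1 : R) + p.1, p.2).
by rewrite /e_x; congr (_, _); rewrite /= scaler0 add0r.
Qed.

Let slice_yE f p : (fun h : R => h^-1 *: (f (h *: ey + p) - f p)) =
  (fun h : R => h^-1 *: ((fun y => f (p.1, y)) (h *: (1 : R) + p.2) - f (p.1, p.2))).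
Proof.
apply/funext => h; rewrite -surjective_pairing.
have -> // : h *: ey + p = (p.1, h *: (1 : R) + p.2).
by rewrite /e_y; congr (_, _); rewrite /= scaler0 add0r.
Qed.

Lemma is_derive_slice_x f p d :
  is_derive p ex f d <-> is_derive p.1 1 (fun x => f (x, p.2)) d.
Proof.
split=> -[df dE]; split.
- by move: df; rewrite /derivable /= slice_xE.
- by rewrite -dE /derive /= slice_xE.
- by move: df; rewrite /derivable /= slice_xE.
- by rewrite -dE /derive /= slice_xE.
Qed.

Lemma is_derive_slice_y f p d :
  is_derive p ey f d <-> is_derive p.2 1 (fun y => f (p.1, y)) d.
Proof.
split=> -[df dE]; split.
- by move: df; rewrite /derivable /= slice_yE.
- by rewrite -dE /derive /= slice_yE.
- by move: df; rewrite /derivable /= slice_yE.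
- by rewrite -dE /derive /= slice_yE.
Qed.

Lemma continuous_slice_x f y : continuous f -> continuous (fun x => f (x, y)).
Proof.
move=> cf x; apply: (@continuous_comp _ _ _ (fun x => (x, y)) f); last exact: cf.
exact: (cvg_pair (f := id) (g := fun=> y) cvg_id (cvg_cst _)).
Qed.

Lemma continuous_slice_y f x : continuous f -> continuous (fun y => f (x, y)).
Proof.
move=> cf y; apply: (@continuous_comp _ _ _ (fun y => (x, y)) f); last exact: cf.
exact: (cvg_pair (f := fun=> x) (g := id) (cvg_cst _) cvg_id).
Qed.

(** Fubini's theorem with the x-integral inside, which vanishes on each
    line. *)
Lemma integral_derive_x f fx K : continuous f -> continuous fx ->
  (forall p, is_derive p ex f (fx p)) -> compact K ->
  (forall p, ~ K p -> f p = 0) -> (forall p, ~ K p -> fx p = 0) ->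
  \int[mu]_p fx p = 0.
Proof.
move=> cf cfx df cK f0 fx0.
have [M M0 KM] := compact_in_box cK.
have out x y : M < `|x| -> ~ K (x, y).
  by move=> Mx /KM[/=]; rewrite in_itv /= -ler_norml leNgt Mx.
have ifx := compact_support_integrable cfx cK fx0.
rewrite /Rintegral -[X in fine X](integral21_prod_meas1 ifx) /fubini_G /=.
rewrite integral0_eq// => y _.
apply: (@integral_derive_line _ (fun x => f (x, y)) (fun x => fx (x, y)) M M0).
- exact: continuous_slice_x.
- by move=> x; exact: ((is_derive_slice_x f _ _).1 (df (x, y))).
- by move=> x Mx; exact/f0/out.
- by move=> x Mx; exact/fx0/out.
Qed.

Lemma integral_derive_y f fy K : continuous f -> continuous fy ->
  (forall p, is_derive p ey f (fy p)) -> compact K ->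
  (forall p, ~ K p -> f p = 0) -> (forall p, ~ K p -> fy p = 0) ->
  \int[mu]_p fy p = 0.
Proof.
move=> cf cfy df cK f0 fy0.
have [M M0 KM] := compact_in_box cK.
have out x y : M < `|y| -> ~ K (x, y).
  by move=> My /KM[_ /=]; rewrite in_itv /= -ler_norml leNgt My.
have ify := compact_support_integrable cfy cK fy0.
rewrite /Rintegral -[X in fine X](integral12_prod_meas1 ify) /fubini_F /=.
rewrite integral0_eq// => x _.
apply: (@integral_derive_line _ (fun y => f (x, y)) (fun y => fy (x, y)) M M0).
- exact: continuous_slice_y.
- by move=> y; exact: ((is_derive_slice_y f _ _).1 (df (x, y))).
- by move=> y My; exact/f0/out.
- by move=> y My; exact/fy0/out.
Qed.

Lemma derive_outside (v : R * R) f K : closed K -> (forall p, ~ K p -> f p = 0) ->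
  forall p, ~ K p -> 'D_v f p = 0.
Proof.
move=> cK f0 p Kp.
have : \forall q \near p, f q = cst 0 q.
  by apply: filterS (open_nbhs_nbhs (conj (closed_openC cK) Kp)) => q; exact: f0.
by move=> /near_eq_derive ->; exact: derive_cst.
Qed.

End WeakDerivatives.

Section TestFunctions.
Variable R : realType.
Implicit Types (f g phi : R * R -> R) (p : R * R) (K U : set (R * R)).
Local Notation mu := (@leb2 R).
Local Notation ex := (@e_x R).
Local Notation ey := (@e_y R).

Lemma Ck_continuous k phi : Ck k phi -> continuous phi.
Proof. by case: k => [|k] []. Qed.

Lemma test_function_is_derive_x U phi : test_function U phi ->
  forall p, is_derive p ex phi ('D_ex phi p).
Proof. by move=> [/(_ 1%N)[_ [h _ _ _]] _] p; split. Qed.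

Lemma test_function_is_derive_y U phi : test_function U phi ->
  forall p, is_derive p ey phi ('D_ey phi p).
Proof. by move=> [/(_ 1%N)[_ [_ h _ _]] _] p; split. Qed.

Lemma test_function_derive_x U phi : test_function U phi ->
  test_function U ('D_ex phi).
Proof.
move=> [Cphi [K [cK KU phi0]]]; split.
  by move=> k; have [_ []] := Cphi k.+1.
exists K; split=> // p; apply: derive_outside => //.
by apply: compact_closed.
Qed.

Lemma test_function_derive_y U phi : test_function U phi ->
  test_function U ('D_ey phi).
Proof.
move=> [Cphi [K [cK KU phi0]]]; split.
  by move=> k; have [_ []] := Cphi k.+1.
exists K; split=> // p; apply: derive_outside => //.
by apply: compact_closed.
Qed.

Lemma test_function_partial U m n phi : test_function U phi ->
  test_function U (partial m n phi).
Proof.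
move=> h; rewrite /partial; elim: m => [|m IH] /=; last exact: test_function_derive_x.
elim: n => [|n IH] //=; exact: test_function_derive_y.
Qed.

Lemma continuousM2 f g : continuous f -> continuous g -> continuous (fun p => f p * g p).
Proof. by move=> cf cg p; exact: cvgM (cf p) (cg p). Qed.

Lemma by_parts_x U f fx phi : continuous f -> continuous fx ->
  (forall p, is_derive p ex f (fx p)) -> test_function U phi ->
  \int[mu]_(p in U) (f p * 'D_ex phi p) = - \int[mu]_(p in U) (fx p * phi p).
Proof.
move=> cf cfx df tphi.
have tdx := test_function_derive_x tphi.
have dphi := test_function_is_derive_x tphi.
have cphi := Ck_continuous (tphi.1 0%N); have cdx := Ck_continuous (tdx.1 0%N).
have [_ [K [cK KU phi0]]] := tphi.
have dx0 : forall p, ~ K p -> 'D_ex phi p = 0.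
  by apply: derive_outside => //; apply: compact_closed.
have c1 := continuousM2 cf cdx; have c2 := continuousM2 cfx cphi.
have z1 p : ~ K p -> f p * 'D_ex phi p = 0 by move=> /dx0 ->; rewrite mulr0.
have z2 p : ~ K p -> fx p * phi p = 0 by move=> /phi0 ->; rewrite mulr0.
rewrite (Rintegral_support KU z1) (Rintegral_support KU z2).
apply/eqP; rewrite -subr_eq0 opprK; apply/eqP.
rewrite -(RintegralD _ (compact_support_integrable c1 cK z1)
  (compact_support_integrable c2 cK z2))//.
apply: (@integral_derive_x _ (fun p => f p * phi p) _ K) => //.
- exact: continuousM2.
- by move=> p; apply: cvgD; [exact: c1|exact: c2].
- move=> p; apply: (is_derive_eq (is_deriveM (df p) (dphi p))).
  by rewrite /GRing.scale /= [phi p * _]mulrC.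
- by move=> p /phi0 ->; rewrite mulr0.
- by move=> p Kp; rewrite z1// z2// addr0.
Qed.

Lemma by_parts_y U f fy phi : continuous f -> continuous fy ->
  (forall p, is_derive p ey f (fy p)) -> test_function U phi ->
  \int[mu]_(p in U) (f p * 'D_ey phi p) = - \int[mu]_(p in U) (fy p * phi p).
Proof.
move=> cf cfy df tphi.
have tdy := test_function_derive_y tphi.
have dphi := test_function_is_derive_y tphi.
have cphi := Ck_continuous (tphi.1 0%N); have cdy := Ck_continuous (tdy.1 0%N).
have [_ [K [cK KU phi0]]] := tphi.
have dy0 : forall p, ~ K p -> 'D_ey phi p = 0.
  by apply: derive_outside => //; apply: compact_closed.
have c1 := continuousM2 cf cdy; have c2 := continuousM2 cfy cphi.
have z1 p : ~ K p -> f p * 'D_ey phi p = 0 by move=> /dy0 ->; rewrite mulr0.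
have z2 p : ~ K p -> fy p * phi p = 0 by move=> /phi0 ->; rewrite mulr0.
rewrite (Rintegral_support KU z1) (Rintegral_support KU z2).
apply/eqP; rewrite -subr_eq0 opprK; apply/eqP.
rewrite -(RintegralD _ (compact_support_integrable c1 cK z1)
  (compact_support_integrable c2 cK z2))//.
apply: (@integral_derive_y _ (fun p => f p * phi p) _ K) => //.
- exact: continuousM2.
- by move=> p; apply: cvgD; [exact: c1|exact: c2].
- move=> p; apply: (is_derive_eq (is_deriveM (df p) (dphi p))).
  by rewrite /GRing.scale /= [phi p * _]mulrC.
- by move=> p /phi0 ->; rewrite mulr0.
- by move=> p Kp; rewrite z1// z2// addr0.
Qed.

Lemma continuous_loc_integrable U f : continuous f -> loc_integrable U f.
Proof. by move=> cf K cK _; exact: continuous_compact_integrable2. Qed.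

Lemma weak_deriv_refl U f : continuous f -> weak_deriv U 0 0 f f.
Proof.
move=> cf; split; [exact: continuous_loc_integrable|exact: continuous_loc_integrable|].
by move=> phi _; rewrite expr0 mul1r.
Qed.

(** The x-derivatives are outermost in [partial], so an x-derivative can be
    peeled off for every (m, n), whereas in [weak_deriv_step_y] this is
    possible only when there are no x-derivatives. *)
Lemma weak_deriv_step_x U m n f fx g : continuous f -> continuous fx ->
  (forall p, is_derive p ex f (fx p)) -> weak_deriv U m n fx g ->
  weak_deriv U m.+1 n f g.
Proof.
move=> cf cfx df [_ ig h]; split=> //; first exact: continuous_loc_integrable.
move=> phi tphi; have := by_parts_x cf cfx df (test_function_partial m n tphi).
by rewrite (h _ tphi) addSn exprS mulN1r mulNr.
Qed.

Lemma weak_deriv_step_y U n f fy g : continuous f -> continuous fy ->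
  (forall p, is_derive p ey f (fy p)) -> weak_deriv U 0 n fy g ->
  weak_deriv U 0 n.+1 f g.
Proof.
move=> cf cfy df [_ ig h]; split=> //; first exact: continuous_loc_integrable.
move=> phi tphi; have := by_parts_y cf cfy df (test_function_partial 0 n tphi).
by rewrite (h _ tphi) addnS exprS mulN1r mulNr.
Qed.

Lemma slice_in_box (a b : R) : slice a b `<=` `[a, b] `*` `[-1, 1].
Proof.
move=> p [/andP[h1 h2] /andP[h3 h4]]; split; rewrite /= in_itv /=.
  by rewrite !ltW.
by rewrite !ltW.
Qed.

Lemma slice_open (a b : R) : open (slice a b).
Proof.
have -> : slice a b = (fst @^-1` `]a, b[) `&` (snd @^-1` `]-1, 1[) :> set (R * R).
  apply/seteqP; split=> p; rewrite /slice /= !in_itv /=; last by case.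
  by case=> h1 h2; split.
apply: openI; apply: open_comp; try exact: interval_open.
  by move=> p _; exact: cvg_fst.
by move=> p _; exact: cvg_snd.
Qed.

(** Fields that are continuous on the whole plane are bounded on the closure
    of a slice. *)
Lemma continuous_L2_slice (a b : R) f : continuous f -> L2 (slice a b) f.
Proof.
move=> cf; split.
  exact: measurable_funS (continuous_measurable2 cf).
have cbox : compact (`[a, b] `*` `[-1, 1] : set (R * R)).
  by apply: compact_setX; exact: segment_compact.
have cf2 : continuous (fun p => f p ^+ 2).
  by under eq_fun do rewrite expr2; exact: continuousM2.
have ib := continuous_compact_integrable2 cf2 cbox.
have H := integrableS (compact_measurable2 cbox) (open_measurable2 (slice_open (a := a) (b := b)))
  (slice_in_box (a := a) (b := b)) ib.
exact: H.
Qed.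

End TestFunctions.

(** * Trigonometric modes *)

Section Modes.
Variable R : realType.
Implicit Types (P Q : R -> R) (p : R * R) (U : set (R * R)).
Local Notation ex := (@e_x R).
Local Notation ey := (@e_y R).

(** Re ((P + i Q)(y) e^{ix}); the x-derivative multiplies P + i Q by i. *)
Definition mode P Q p : R := P p.2 * cos p.1 - Q p.2 * sin p.1.

Lemma is_derive_continuous P P' : (forall y : R, is_derive y 1 P (P' y)) -> continuous P.
Proof.
move=> dP y; apply/differentiable_continuous/derivable1_diffP.
by have := dP y; case.
Qed.

Lemma mode_continuous P Q : continuous P -> continuous Q -> continuous (mode P Q).
Proof.
move=> cP cQ p.
have c1 (F : R -> R) : continuous F -> {for p, continuous (fun q : R * R => F q.1)}.
  by move=> cF; apply: (continuous_comp (f := fst)); [exact: cvg_fst|exact: cF].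
have c2 (F : R -> R) : continuous F -> {for p, continuous (fun q : R * R => F q.2)}.
  by move=> cF; apply: (continuous_comp (f := snd)); [exact: cvg_snd|exact: cF].
by apply: cvgB; apply: cvgM;
  [exact: c2|apply: c1; exact: continuous_cos|exact: c2|apply: c1; exact: continuous_sin].
Qed.

Lemma mode_x P Q p : is_derive p ex (mode P Q) (mode (fun y => - Q y) P p).
Proof.
apply/is_derive_slice_x; rewrite /mode /=.
have h1 := is_deriveZ (P p.2) (is_derive_cos p.1).
have h2 := is_deriveZ (Q p.2) (is_derive_sin p.1).
apply: (is_derive_eq (is_deriveB h1 h2)).
by rewrite /GRing.scale /= mulrN addrC mulNr.
Qed.

Lemma mode_y P Q P' Q' p : (forall y : R, is_derive y 1 P (P' y)) ->
  (forall y : R, is_derive y 1 Q (Q' y)) -> is_derive p ey (mode P Q) (mode P' Q' p).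
Proof.
move=> dP dQ; apply/is_derive_slice_y; rewrite /mode /=.
have h1 := is_deriveZ (cos p.1) (dP p.2).
have h2 := is_deriveZ (sin p.1) (dQ p.2).
have := is_deriveB h1 h2.
rewrite /GRing.scale /= [cos p.1 * _]mulrC [sin p.1 * _]mulrC.
congr (is_derive _ _ _ _); apply/funext => y.
rewrite -[LHS]/(cos p.1 * P y - sin p.1 * Q y); ring.
Qed.

Lemma opp_continuous P : continuous P -> continuous (fun y => - P y).
Proof. by move=> cP y; apply: cvgN; exact: cP. Qed.

Section WeakMode.
Variables (P P1 Q Q1 : R -> R).
Hypotheses (dP : forall y : R, is_derive y 1 P (P1 y))
  (dQ : forall y : R, is_derive y 1 Q (Q1 y)).
Hypotheses (cP1 : continuous P1) (cQ1 : continuous Q1).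

Let cP := is_derive_continuous dP.
Let cQ := is_derive_continuous dQ.
Let cNP := opp_continuous cP.
Let cNQ := opp_continuous cQ.

Lemma weak_mode_x U : weak_deriv U 1 0 (mode P Q) (mode (fun y => - Q y) P).
Proof.
apply: (weak_deriv_step_x (fx := mode (fun y => - Q y) P)).
- exact: mode_continuous.
- exact: mode_continuous.
- exact: mode_x.
- by apply: weak_deriv_refl; exact: mode_continuous.
Qed.

Lemma weak_mode_y U : weak_deriv U 0 1 (mode P Q) (mode P1 Q1).
Proof.
apply: (weak_deriv_step_y (fy := mode P1 Q1)).
- exact: mode_continuous.
- exact: mode_continuous.
- by move=> p; exact: mode_y.
- by apply: weak_deriv_refl; exact: mode_continuous.
Qed.

Lemma mode_Hk_loc1 : Hk_loc 1 (mode P Q).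
Proof.
move=> a b; split; first exact/continuous_L2_slice/mode_continuous.
case=> [|[|m]] [|[|n]]; rewrite ?addSn ?addnS // => _.
- exists (mode P Q); split; first exact/continuous_L2_slice/mode_continuous.
  by apply: weak_deriv_refl; exact: mode_continuous.
- exists (mode P1 Q1); split; first exact/continuous_L2_slice/mode_continuous.
  exact: weak_mode_y.
- exists (mode (fun y => - Q y) P); split; first exact/continuous_L2_slice/mode_continuous.
  exact: weak_mode_x.
Qed.

End WeakMode.

Section WeakMode2.
Variables (P P1 P2 Q Q1 Q2 : R -> R).
Hypotheses (dP : forall y : R, is_derive y 1 P (P1 y))
  (dQ : forall y : R, is_derive y 1 Q (Q1 y)).
Hypotheses (dP1 : forall y : R, is_derive y 1 P1 (P2 y))
  (dQ1 : forall y : R, is_derive y 1 Q1 (Q2 y)).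
Hypotheses (cP2 : continuous P2) (cQ2 : continuous Q2).

Let cP := is_derive_continuous dP.
Let cQ := is_derive_continuous dQ.
Let cP1 := is_derive_continuous dP1.
Let cQ1 := is_derive_continuous dQ1.

Let dNQ (y : R) : is_derive y 1 (fun y => - Q y) (- Q1 y).
Proof. exact: is_deriveN. Qed.
Let dNP (y : R) : is_derive y 1 (fun y => - P y) (- P1 y).
Proof. exact: is_deriveN. Qed.

Lemma weak_mode_xx U :
  weak_deriv U 2 0 (mode P Q) (mode (fun y => - P y) (fun y => - Q y)).
Proof.
apply: (weak_deriv_step_x (fx := mode (fun y => - Q y) P)).
- exact: mode_continuous.
- by apply: mode_continuous => //; exact: opp_continuous.
- exact: mode_x.
- exact: (weak_mode_x dNQ dP).
Qed.

Lemma weak_mode_xy U :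
  weak_deriv U 1 1 (mode P Q) (mode (fun y => - Q1 y) P1).
Proof.
apply: (weak_deriv_step_x (fx := mode (fun y => - Q y) P)).
- exact: mode_continuous.
- by apply: mode_continuous => //; exact: opp_continuous.
- exact: mode_x.
- by apply: (weak_mode_y dNQ dP) => //; exact: opp_continuous.
Qed.

Lemma weak_mode_yy U : weak_deriv U 0 2 (mode P Q) (mode P2 Q2).
Proof.
apply: (weak_deriv_step_y (fy := mode P1 Q1)).
- exact: mode_continuous.
- exact: mode_continuous.
- by move=> p; exact: mode_y.
- exact: (weak_mode_y dP1 dQ1).
Qed.

Lemma mode_Hk_loc2 : Hk_loc 2 (mode P Q).
Proof.
move=> a b; split; first exact/continuous_L2_slice/mode_continuous.
case=> [|[|[|m]]] [|[|[|n]]]; rewrite ?addSn ?addnS // => _.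
- exists (mode P Q); split; first exact/continuous_L2_slice/mode_continuous.
  by apply: weak_deriv_refl; exact: mode_continuous.
- exists (mode P1 Q1); split; first exact/continuous_L2_slice/mode_continuous.
  exact: weak_mode_y.
- exists (mode P2 Q2); split; first exact/continuous_L2_slice/mode_continuous.
  exact: weak_mode_yy.
- exists (mode (fun y => - Q y) P); split.
    by apply/continuous_L2_slice/mode_continuous => //; exact: opp_continuous.
  exact: (weak_mode_x dP dQ).
- exists (mode (fun y => - Q1 y) P1); split.
    by apply/continuous_L2_slice/mode_continuous => //; exact: opp_continuous.
  exact: weak_mode_xy.
- exists (mode (fun y => - P y) (fun y => - Q y)); split.
    by apply/continuous_L2_slice/mode_continuous; exact: opp_continuous.
  exact: weak_mode_xx.
Qed.

End WeakMode2.
End Modes.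

(** * The neutral flow *)

Section NeutralFlow.
Variable R : realType.
Variables (b g : R) (P P1 Q Q1 U U1 V V1 : R -> R).
Hypothesis sys : os_system b g P P1 Q Q1 U U1 V V1.
Hypothesis P0 : P 0 = 1.
Hypothesis walls : forall y, y ^+ 2 = 1 -> [/\ P y = 0, Q y = 0, P1 y = 0 & Q1 y = 0].
Local Notation ex := (@e_x R).
Local Notation ey := (@e_y R).
Local Notation strip := (@strip R).

(* P2, Q2 and P3, Q3 are the second and third derivatives of P and Q. The
   pressure amplitude is q1 + i q2 = - i w' - F phi' + F' phi, and q1' + i q2'
   is its derivative after substitution of the system. *)
Let F (y : R) : R := b * y ^+ 2 + g.
Let P2 y := P y + U y.
Let Q2 y := Q y + V y.
Let P3 y := P1 y + U1 y.
Let Q3 y := Q1 y + V1 y.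
Let NP y := - P y.
Let NP1 y := - P1 y.
Let NP2 y := - P2 y.
Let q1 y := V1 y - F y * P1 y + 2 * b * y * P y.
Let q2 y := - U1 y - F y * Q1 y + 2 * b * y * Q y.
Let q1' y := V y - F y * P y.
Let q2' y := - U y - F y * Q y.

Let dP (y : R) : is_derive y 1 P (P1 y). Proof. by have [[]] := sys y. Qed.
Let dP1 (y : R) : is_derive y 1 P1 (P2 y). Proof. by have [[]] := sys y. Qed.
Let dQ (y : R) : is_derive y 1 Q (Q1 y). Proof. by have [[]] := sys y. Qed.
Let dQ1 (y : R) : is_derive y 1 Q1 (Q2 y). Proof. by have [[]] := sys y. Qed.
Let dU (y : R) : is_derive y 1 U (U1 y). Proof. by have [_ []] := sys y. Qed.
Let dV (y : R) : is_derive y 1 V (V1 y). Proof. by have [_ []] := sys y. Qed.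
Let dU1 (y : R) : is_derive y 1 U1 (U y - (F y * V y - 2 * b * Q y)).
Proof. by have [_ []] := sys y. Qed.
Let dV1 (y : R) : is_derive y 1 V1 (V y + (F y * U y - 2 * b * P y)).
Proof. by have [_ []] := sys y. Qed.
Let dP2 (y : R) : is_derive y 1 P2 (P3 y). Proof. exact: is_deriveD. Qed.
Let dQ2 (y : R) : is_derive y 1 Q2 (Q3 y). Proof. exact: is_deriveD. Qed.
Let dNP (y : R) : is_derive y 1 NP (NP1 y). Proof. exact: is_deriveN. Qed.
Let dNP1 (y : R) : is_derive y 1 NP1 (NP2 y). Proof. exact: is_deriveN. Qed.

Let dF (y : R) : is_derive y 1 F (2 * b * y).
Proof.
have h := is_deriveD (is_deriveZ b (is_derive_sqr y)) (is_derive_cst g y 1).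
apply: (is_derive_eq h); rewrite /GRing.scale /=; ring.
Qed.

Let dl (y : R) : is_derive y 1 (fun y => 2 * b * y) (2 * b).
Proof.
have h := is_deriveZ (2 * b) (is_derive_id y (1 : R)).
by apply: (is_derive_eq h); rewrite /GRing.scale /= mulr1.
Qed.

Let dq1 (y : R) : is_derive y 1 q1 (q1' y).
Proof.
have h := is_deriveD (is_deriveB (dV1 y) (is_deriveM (dF y) (dP1 y)))
  (is_deriveM (dl y) (dP y)).
apply: (is_derive_eq h); rewrite /GRing.scale /= /P2 /q1' /F; ring.
Qed.

Let dq2 (y : R) : is_derive y 1 q2 (q2' y).
Proof.
have h := is_deriveD (is_deriveB (is_deriveN (dU1 y)) (is_deriveM (dF y) (dQ1 y)))
  (is_deriveM (dl y) (dQ y)).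
apply: (is_derive_eq h); rewrite /GRing.scale /= /Q2 /q2' /F; ring.
Qed.

Let der_cont (f f' : R -> R) := @is_derive_continuous R f f'.
Let cU1 := der_cont dU1.
Let cV1 := der_cont dV1.
Let cP1 := der_cont dP1.
Let cQ1 := der_cont dQ1.
Let cP := der_cont dP.
Let cQ := der_cont dQ.
Let cP2 := der_cont dP2.
Let cQ2 := der_cont dQ2.
Let cU := der_cont dU.
Let cV := der_cont dV.
Let cF := der_cont dF.
Let cNP := der_cont dNP.
Let cNP1 := der_cont dNP1.

Let cP3 : continuous P3. Proof. by move=> y; apply: cvgD; [exact: cP1|exact: cU1]. Qed.
Let cQ3 : continuous Q3. Proof. by move=> y; apply: cvgD; [exact: cQ1|exact: cV1]. Qed.
Let cNP2 : continuous NP2. Proof. exact: opp_continuous. Qed.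
Let cq1' : continuous q1'.
Proof. by move=> y; apply: cvgB; [exact: cV|apply: cvgM; [exact: cF|exact: cP]]. Qed.
Let cq2' : continuous q2'.
Proof.
by move=> y; apply: cvgB; [apply: cvgN; exact: cU|apply: cvgM; [exact: cF|exact: cQ]].
Qed.

Definition flow_velocity (p : R * R) : R * R := (mode P1 Q1 p, mode Q NP p).
Definition flow_pressure : R * R -> R := mode q1 q2.
Definition flow_pressure_gradient (p : R * R) : R * R :=
  (mode (fun y => - q2 y) q1 p, mode q1' q2' p).

Local Notation v := flow_velocity.
Local Notation q := flow_pressure.
Local Notation gq := flow_pressure_gradient.

Let fst_pair (f1 f2 : R * R -> R) : fst \o (fun p => (f1 p, f2 p)) = f1.
Proof. by []. Qed.
Let snd_pair (f1 f2 : R * R -> R) : snd \o (fun p => (f1 p, f2 p)) = f2.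
Proof. by []. Qed.

Lemma mode_periodic A B (x y : R) : mode A B (x + 2 * pi / 1, y) = mode A B (x, y).
Proof.
rewrite /mode /= divr1 mulr_natl (cosD2pi x).
by rewrite (sinD2pi x).
Qed.

Lemma flow_continuous : continuous v.
Proof.
move=> p.
have h1 : mode P1 Q1 x @[x --> p] --> mode P1 Q1 p by exact: mode_continuous.
have h2 : mode Q NP x @[x --> p] --> mode Q NP p.
  by apply: mode_continuous => //; exact: (der_cont dNP).
exact (cvg_pair h1 h2).
Qed.

Lemma flow_gradient (O : set (R * R)) : weak_gradient O q gq.
Proof.
split; first exact: (weak_mode_x dq1 dq2).
exact: (weak_mode_y dq1 dq2).
Qed.

(** The flux through x = 0 is P(1) - P(-1). *)
Lemma flow_flux : \int[@lebesgue_measure R]_(y in `[-1, 1]) (v (0, y)).1 = 0.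
Proof.
have [p1 _ _ _] := walls (expr1n _ 2).
have [m1 _ _ _] := walls (sqrr_sign _ 1).
rewrite /Rintegral.
under eq_integral => y _.
  rewrite /v /mode /= cos0 sin0 mulr1 mulr0 subr0; over.
have h11 : -1 < 1 :> R by lra.
rewrite (continuous_FTC2 (F := P) h11).
- by rewrite p1 expr1 in m1 *; rewrite m1 subee.
- exact: continuous_subspaceT.
- split; first by move=> x _; have := dP x; case.
    by apply: cvg_at_right_filter; exact: cP.
  by apply: cvg_at_left_filter; exact: cP.
- by move=> x _; rewrite derive1E; have := dP x; case.
Qed.

Lemma flow_divergence_free : divergence_free strip v.
Proof.
exists (mode (fun y => - Q1 y) P1), (mode Q1 NP1).
rewrite /v fst_pair snd_pair; split.
- exact: (weak_mode_x dP1 dQ1).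
- exact: (weak_mode_y dQ dNP).
- by apply: aeW => p _; rewrite /mode /NP1; ring.
Qed.

Lemma flow_channel_domain : channel_domain 1 v q.
Proof.
split.
- split; last exact/continuous_subspaceT/flow_continuous.
    rewrite /v fst_pair; exact: (mode_Hk_loc2 dP1 dQ1 dP2 dQ2).
  rewrite /v snd_pair; exact: (mode_Hk_loc2 dQ dNP dQ1 dNP1).
- split; [|exact: flow_divergence_free| |exact: flow_flux].
    by move=> x y _; rewrite /v !mode_periodic.
  have w (x y : R) : y ^+ 2 = 1 -> v (x, y) = 0.
    move=> /walls[a1 a2 a3 a4].
    by rewrite /v /mode /NP /= a1 a2 a3 a4 oppr0 !mul0r subr0.
  by move=> x; split; apply: w; rewrite ?sqrrN expr1n.
- exact: (mode_Hk_loc1 dq1 dq2).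
- exists gq; split; first exact: flow_gradient.
  by apply: aeW => -[x y] _; rewrite /gq !mode_periodic.
Qed.

Lemma is_derive_scale_vec (f : R * R -> R) (df : R) (w p e : R * R) :
  is_derive p e f df -> is_derive p e (fun z => f z *: w) (df *: w).
Proof.
move=> [h hE].
have E : (fun h : R => h^-1 *: (f (h *: e + p) *: w - f p *: w))
    = (fun h : R => (h^-1 *: (f (h *: e + p) - f p)) *: w).
  by apply/funext => t; rewrite -scalerBl scalerA.
have cv : (fun h : R => h^-1 *: (f (h *: e + p) *: w - f p *: w)) @ 0^' --> df *: w.
  by rewrite E; apply: cvgZr_tmp; rewrite -hE; exact: h.
split; first by apply/cvg_ex; exists (df *: w); exact: cv.
exact: (cvg_lim _ cv).
Qed.

Let b3 : 3 * (b / 3) = b. Proof. by field. Qed.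

Lemma couette_poiseuille_derive p :
  'D_ex (couette_poiseuille (b / 3) g) p = 0 /\
  'D_ey (couette_poiseuille (b / 3) g) p = (2 * b * p.2) *: ex.
Proof.
have uE : couette_poiseuille (b / 3) g = (fun z : R * R => F z.2 *: ex).
  apply/funext => z; rewrite /couette_poiseuille /F; congr (_ *: _).
  by rewrite b3.
rewrite uE; split.
  have h : is_derive p ex (fun z : R * R => F z.2) 0.
    by apply/is_derive_slice_x => /=; exact: is_derive_cst.
  by have [_ ->] := is_derive_scale_vec ex h; rewrite scale0r.
have h : is_derive p ey (fun z : R * R => F z.2) (2 * b * p.2).
  by apply/is_derive_slice_y => /=; exact: dF.
by have [_ ->] := is_derive_scale_vec ex h.
Qed.

(** The x-momentum balance is the definition of the pressure amplitude. In
    the y-momentum balance its derivative appears, and the Orr-Sommerfeld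
    equation cancels it. *)
Lemma flow_linearized : linearized_operator (couette_poiseuille (b / 3) g) v q (fun=> 0).
Proof.
exists (fun p => (mode (fun y => - Q1 y) P1 p, mode (fun y => - NP y) Q p)).
exists (fun p => (mode P2 Q2 p, mode Q1 NP1 p)).
exists (fun p => (mode (fun y => - P1 y) (fun y => - Q1 y) p,
                  mode (fun y => - Q y) (fun y => - NP y) p)).
exists (fun p => (mode P3 Q3 p, mode Q2 NP2 p)), gq; split.
- rewrite /weak_deriv_vec /v !fst_pair !snd_pair; split; split.
  + exact: (weak_mode_x dP1 dQ1).
  + exact: (weak_mode_x dQ dNP).
  + exact: (weak_mode_y dP1 dQ1).
  + exact: (weak_mode_y dQ dNP).
- rewrite /weak_deriv_vec /v !fst_pair !snd_pair; split; split.
  + exact: (weak_mode_xx dP1 dQ1).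
  + exact: (weak_mode_xx dQ dNP).
  + exact: (weak_mode_yy dP1 dQ1 dP2 dQ2).
  + exact: (weak_mode_yy dQ dNP dQ1 dNP1).
- exact: flow_gradient.
- apply: aeW => p _; have [-> ->] := couette_poiseuille_derive p.
  rewrite /gq /v /couette_poiseuille /e_x /mode /=.
  rewrite b3.
  congr (_, _); rewrite /= /GRing.scale /=;
    rewrite /P3 /Q3 /P2 /Q2 /NP /NP1 /NP2 /P2 /q1 /q2 /q1' /q2' /F; ring.
Qed.

(** At x = pi / 2 on the centre line the second component is P(0) = 1. *)
Lemma flow_nonzero : exists p, strip p /\ v p <> 0.
Proof.
exists (pi / 2, 0); split; first by rewrite /strip /=; apply/andP; split; lra.
move=> /(congr1 snd); rewrite /v /mode /NP /= P0 sin_pihalf cos_pihalf.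
by rewrite mulr0 mulr1 sub0r opprK => /eqP; rewrite oner_eq0.
Qed.

End NeutralFlow.

Theorem theorem6 :
  exists A C T : Rdefinitions.R,
    [/\ A < 0, C < 3 * `|A|, 0 < T &
      exists (v : Rdefinitions.R * Rdefinitions.R -> Rdefinitions.R * Rdefinitions.R)
             (q : Rdefinitions.R * Rdefinitions.R -> Rdefinitions.R),
        [/\ channel_domain T v q,
            exists p, strip p /\ v p <> 0 &
            linearized_operator (couette_poiseuille A C) v q (fun _ => 0)]].
Proof.
have [b [g [P [P1 [Q [Q1 [U [U1 [V [V1 [b0 gb sys P01 walls]]]]]]]]]]] := neutral_mode.
exists (b / 3), g, 1; split.
- by rewrite ltr_pdivrMr ?mul0r.
- rewrite normrM (ltr0_norm b0) ger0_norm; last by rewrite invr_ge0.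
  by rewrite mulrC divfK ?pnatr_eq0.
- exact: ltr01.
exists (flow_velocity P P1 Q Q1), (flow_pressure b g P P1 Q Q1 U1 V1); split.
- exact: (flow_channel_domain sys walls).
- exact: (flow_nonzero P1 Q Q1 P01).
- exact: (flow_linearized sys).
Qed.
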